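(* Let $M$ be an $n$-dimensional Riemannian manifold. If $M$ is a $k$-D'Atri space for some $k\ge1$, then $$\operatorname{tr}(R_v\circ R_v')=0$$ for all $m\in M$ and all unit vectors $v\in T_mM$.
   Context: With $R(u,v)=[\nabla_u,\nabla_v]-\nabla_{[u,v]}$, the Jacobi operator of a unit vector $v$ is $R_vw=R(w,v)v$. For a unit vector $v\in T_mM$, $\gamma_v$ is the geodesic with $\gamma_v(0)=m$, $\gamma_v'(0)=v$, and $R_v'$ is the covariant derivative at $t=0$ of the operator field $t\mapsto R_{\gamma_v'(t)}$ along $\gamma_v$. For small $t>0$, $S_v(t)$ is the shape operator at $\gamma_v(t)$, with respect to the outward unit normal $\gamma_v'(t)$, of the geodesic sphere of radius $t$ centered at $m$. Let $\sigma_k(A)$ denote the $k$-th elementary symmetric function of the eigenvalues (with multiplicity) of a symmetric endomorphism $A$. For $1\le k\le n-1$, $M$ is a $k$-D'Atri space if for each $m\in M$ and each small $t>0$, $\sigma_k(S_v(t))=\sigma_k(S_{-v}(t))$ for all unit $v\in T_mM$. *)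

(* Defs.v *)
From HB Require Import structures.
From mathcomp Require Import all_boot all_order all_algebra.
From mathcomp Require Import all_classical all_reals all_analysis.
Set Implicit Arguments.
Unset Strict Implicit.
Unset Printing Implicit Defensive.
Import Order.TTheory GRing.Theory Num.Theory.
Import numFieldNormedType.Exports.
Local Open Scope ring_scope.
Local Open Scope classical_set_scope.

(* Tangent vectors are represented by the row vectors of their components in a
   chart, endomorphisms by matrices acting on the right: w is sent to w *m A,
   so that (A after B) is B *m A. *)

Definition elem_sym (R : realType) (k : nat) (s : seq R) : R :=
  \sum_(I : {set 'I_(size s)} | #|I| == k) \prod_(i in I) s`_i.

(* The eigenvalues of A listed with multiplicity (in an unspecified order).
   The default [::] is used only when A has a non-real eigenvalue, which does
   not happen for operators that are symmetric for some inner product. *)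
Definition eigenvalues (R : realType) (m : nat) (A : 'M[R]_m) : seq R :=
  xget [::] [set s | char_poly A = \prod_(a <- s) ('X - a%:P)].

Definition sigma (R : realType) (k m : nat) (A : 'M[R]_m) : R :=
  elem_sym k (eigenvalues A).

Definition inner (R : realType) (n : nat) (g : 'M[R]_n) (u w : 'rV[R]_n) : R :=
  (u *m g *m w^T) 0 0.

Definition basis_vec (R : realType) (n : nat) (l : 'I_n) : 'rV[R]_n :=
  delta_mx 0 l.

(* Continuous partial derivatives up to order k; meant for open U. *)
Fixpoint Ck_on (R : realType) (n : nat) (V : normedModType R) (k : nat)
    (U : set 'rV[R]_n) (f : 'rV[R]_n -> V) : Prop :=
  (forall x, U x -> {for x, continuous f}) /\
  (if k is k'.+1 then
     forall l : 'I_n, (forall x, U x -> derivable f x (basis_vec R l)) /\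
                      Ck_on k' U ('D_(basis_vec R l) f)
   else True).

Definition smooth_on (R : realType) (n : nat) (V : normedModType R)
    (U : set 'rV[R]_n) (f : 'rV[R]_n -> V) : Prop :=
  forall k, Ck_on k U f.

(* A smooth manifold given by an atlas, with a metric given by its matrix of
   components in each chart.  The values of chart i outside chart_dom i, and
   those of param i and metric i outside chart i @` chart_dom i, are irrelevant. *)
Record riemannian_manifold (R : realType) (n : nat) := RiemannianManifold {
  carrier :> topologicalType ;
  chart_index : Type ;
  chart_dom : chart_index -> set carrier ;
  chart : chart_index -> carrier -> 'rV[R]_n ;
  param : chart_index -> 'rV[R]_n -> carrier ;
  metric : chart_index -> 'rV[R]_n -> 'M[R]_n ;
  carrier_hausdorff : hausdorff_space carrier ;
  carrier_second_countable : @second_countable carrier ;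
  dom_cover : forall p, exists i, chart_dom i p ;
  dom_open : forall i, open (chart_dom i) ;
  chart_open : forall i, open (chart i @` chart_dom i) ;
  chartK : forall i p, chart_dom i p -> param i (chart i p) = p ;
  chart_continuous : forall i p, chart_dom i p ->
    {for p, continuous (chart i)} ;
  param_continuous : forall i p, chart_dom i p ->
    {for chart i p, continuous (param i)} ;
  transition_smooth : forall i j,
    smooth_on (chart i @` (chart_dom i `&` chart_dom j)) (chart j \o param i) ;
  metric_smooth : forall i, smooth_on (chart i @` chart_dom i) (metric i) ;
  metric_symmetric : forall i p, chart_dom i p ->
    (metric i (chart i p))^T = metric i (chart i p) ;
  metric_pos : forall i p (u : 'rV[R]_n), chart_dom i p -> u != 0 ->
    0 < inner (metric i (chart i p)) u u ;
  metric_compat : forall i j p u w, chart_dom i p -> chart_dom j p ->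
    inner (metric i (chart i p)) u w =
    inner (metric j (chart j p)) ('D_u (chart j \o param i) (chart i p))
                                 ('D_w (chart j \o param i) (chart i p))
}.

(* Local expressions, for a metric G on an open subset of R^n. *)
Section LocalGeometry.
Variables (R : realType) (n : nat) (G : 'rV[R]_n -> 'M[R]_n).
Implicit Types (x u v w : 'rV[R]_n) (X Y Z : 'rV[R]_n -> 'rV[R]_n).

(* The vector with components
     sum_(a, b) Gamma^l_(a b) u^a w^b,
     Gamma^l_(a b) = 1/2 sum_c (d_a g_bc + d_b g_ac - d_c g_ab) g^(c l). *)
Definition christoffel x u w : 'rV[R]_n :=
  (2^-1 *: \row_c ('D_u (fun y => inner (G y) w (basis_vec R c)) x
                 + 'D_w (fun y => inner (G y) u (basis_vec R c)) x
                 - 'D_(basis_vec R c) (fun y => inner (G y) u w) x))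
  *m invmx (G x).

Definition nabla X Z : 'rV[R]_n -> 'rV[R]_n :=
  fun x => 'D_(X x) Z x + christoffel x (X x) (Z x).

Definition lie_bracket X Y : 'rV[R]_n -> 'rV[R]_n :=
  fun x => 'D_(X x) Y x - 'D_(Y x) X x.

Definition curvature X Y Z : 'rV[R]_n -> 'rV[R]_n :=
  fun x => nabla X (nabla Y Z) x - nabla Y (nabla X Z) x
           - nabla (lie_bracket X Y) Z x.

(* R(u, v)w at x; the curvature being tensorial, the vectors may be extended
   by fields with constant components. *)
Definition curvature_at x u v w : 'rV[R]_n :=
  curvature (fun=> u) (fun=> v) (fun=> w) x.

Definition jacobi_op x v : 'M[R]_n := lin1_mx (fun w => curvature_at x w v v).

Definition covD (c W : R -> 'rV[R]_n) (t : R) : 'rV[R]_n :=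
  derive1 W t + christoffel (c t) (derive1 c t) (W t).

(* (D_t A) w = D_t (A W) - A (D_t W), with W the field along c with constant
   components w. *)
Definition covD_op (c : R -> 'rV[R]_n) (A : R -> 'M[R]_n) (t : R) : 'M[R]_n :=
  lin1_mx (fun w => covD c (fun s => w *m A s) t - covD c (fun=> w) t *m A t).

(* The operator w |-> nabla_w N on the orthogonal complement of N x, in a basis
   of that hyperplane; N is a unit field with geodesic integral curves. *)
Definition shape_matrix (N : 'rV[R]_n -> 'rV[R]_n) x :=
  restrictmx (kermx (G x *m (N x)^T))
         (lin1_mx (fun w => nabla (fun=> w) N x)).

End LocalGeometry.

Section Manifold.
Variables (R : realType) (n : nat) (M : riemannian_manifold R n).

Definition metric_at (i : chart_index M) (m : M) : 'M[R]_n :=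
  metric i (chart i m).

Definition unit_vector (i : chart_index M) (m : M) (v : 'rV[R]_n) : Prop :=
  inner (metric_at i m) v v = 1.

Definition geodesic (gamma : R -> M) (a b : R) : Prop :=
  forall t, a < t < b ->
    {for t, continuous gamma} /\
    forall i : chart_index M, chart_dom i (gamma t) ->
      let c := chart i \o gamma in
      [/\ \forall s \near t, derivable c s 1,
          derivable (derive1 c) t 1
        & covD (metric i) c (derive1 c) t = 0].

(* gamma = gamma_v on ]-d, d[, where v has components v in chart i. *)
Definition geodesic_from (i : chart_index M) (m : M) (v : 'rV[R]_n) (d : R)
    (gamma : R -> M) : Prop :=
  [/\ geodesic gamma (- d) d, gamma 0 = m & derive1 (chart i \o gamma) 0 = v].

Definition tangent_ball (i : chart_index M) (m : M) (e : R) : set 'rV[R]_n :=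
  [set y | inner (metric_at i m) y y < e ^+ 2].

(* E is exp_m on the ball of radius e of T_m M, and it is a diffeomorphism from
   that ball onto an open subset of M, with inverse L. *)
Record normal_ball (i : chart_index M) (m : M) (e : R)
    (E : 'rV[R]_n -> M) (L : M -> 'rV[R]_n) : Prop := NormalBall {
  normal_ball_radius : 0 < e ;
  normal_ball_exp : forall v, unit_vector i m v ->
    geodesic_from i m v e (fun t => E (t *: v)) ;
  normal_ball_open : open (E @` tangent_ball i m e) ;
  normal_ballK : forall y, tangent_ball i m e y -> L (E y) = y ;
  normal_ball_continuous : forall y, tangent_ball i m e y ->
    {for y, continuous E} ;
  normal_ball_smooth : forall j : chart_index M,
    smooth_on (tangent_ball i m e `&` (E @^-1` chart_dom j)) (chart j \o E) ;
  normal_ball_inv_smooth : forall j : chart_index M,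
    smooth_on (chart j @` (chart_dom j `&` (E @` tangent_ball i m e)))
              (L \o param j)
}.

(* In chart j, the field whose value at E (t v), for v unit and 0 < t < e, is
   gamma_v'(t): the outward unit normal of the geodesic spheres centered at m. *)
Definition radial_field (i : chart_index M) (m : M)
    (E : 'rV[R]_n -> M) (L : M -> 'rV[R]_n) (j : chart_index M) (x : 'rV[R]_n)
    : 'rV[R]_n :=
  let y := L (param j x) in
  'D_((Num.sqrt (inner (metric_at i m) y y))^-1 *: y) (chart j \o E) y.

(* S_v(t), at the point E (t v), computed in a chart j around that point. *)
Definition sphere_shape (i : chart_index M) (m : M)
    (E : 'rV[R]_n -> M) (L : M -> 'rV[R]_n) (j : chart_index M)
    (v : 'rV[R]_n) (t : R) :=
  shape_matrix (metric j) (radial_field i m E L j) (chart j (E (t *: v))).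

(* "t small" means t < e where e is the radius of a normal ball at m, so that
   the geodesic sphere of radius t is a hypersurface. *)
Definition k_DAtri (k : nat) : Prop :=
  forall (i : chart_index M) (m : M), chart_dom i m ->
  exists (e : R) (E : 'rV[R]_n -> M) (L : M -> 'rV[R]_n),
    normal_ball i m e E L /\
    forall (t : R) (v : 'rV[R]_n) (j j' : chart_index M),
      0 < t < e -> unit_vector i m v ->
      chart_dom j (E (t *: v)) -> chart_dom j' (E (t *: - v)) ->
      sigma k (sphere_shape i m E L j v t) =
      sigma k (sphere_shape i m E L j' (- v) t).

(* R_(gamma'(t)), along the part of gamma contained in chart_dom i. *)
Definition jacobi_along (i : chart_index M) (gamma : R -> M) (t : R)
    : 'M[R]_n :=
  jacobi_op (metric i) (chart i (gamma t)) (derive1 (chart i \o gamma) t).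

Definition jacobi_deriv (i : chart_index M) (gamma : R -> M) : 'M[R]_n :=
  covD_op (metric i) (chart i \o gamma) (jacobi_along i gamma) 0.

End Manifold.

(* Main.v *)
From HB Require Import structures.
Require Import Defs.
From mathcomp Require Import all_boot all_order all_algebra.
From mathcomp Require Import ring lra complex.
From mathcomp Require Import all_classical all_reals all_analysis.
Set Implicit Arguments.
Unset Strict Implicit.
Unset Printing Implicit Defensive.
Import Order.TTheory GRing.Theory Num.Theory.
Import numFieldNormedType.Exports.
Local Open Scope classical_set_scope.
Local Open Scope ring_scope.

(** The theorem comes from the Taylor expansion of the shape operators of small
    geodesic spheres, in which only two coefficients have to be understood.

    Let [r] be the distance to [m], let [P] be the gradient of [r^2 / 2], and let
    [A] be the operator [w |-> nabla_w P].  By the Gauss lemma [P] is [r] times the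
    outward unit normal of the geodesic spheres centred at [m].  Hence [A] fixes
    the normal, and on the tangent space of the sphere of radius [t] it is [t]
    times the shape operator.  Moreover [nabla_P P = P]; differentiating this
    identity shows that along a unit speed geodesic [gamma] starting at [m] with
    velocity [v] the operator [X = A - 1] solves
      [t X' = - X - X^2 - t^2 R_(gamma'(t))],  [X(0) = 0],
    up to a commutator, which is the difference between the covariant derivative
    and the derivative of the components (lemmas [gauss], [nabla_radial],
    [riccati_curve]).  Integrating twice,
      [X = - t^2/3 R_v - t^3/4 R'_v + o(t^3)]  ([riccati_order2], [riccati_order3]).

    Since [A] is self-adjoint, its eigenvalues are real, and
      [t^k sigma_k(S_v(t)) = 'C(n-1, k) + c1 tr X + c2 ((tr X)^2 - tr X^2)/2 + O(t^6)]
    with [c1 = 'C(n-2, k-1) > 0] and [c2 >= 0] ([sigma_sphere],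
    [elem_sym_shift_bound]).  The sphere in the direction [-v] is met by the same
    geodesic at time [-t], so that the hypothesis says that the odd part of the
    right-hand side is [O(t^6)] ([even_expansion]).

    The coefficient of [t^3] gives [tr R'_v = 0] ([trace_deriv_eq0]).  This holds
    for every unit vector at every point, so [tr R_(gamma')] is constant along
    geodesics.  The trace of the Riccati equation reads
      [(t tr X)' = - tr X^2 - t^2 tr R_(gamma')],
    and its last term has become even.  Therefore the odd part of [tr X] at order
    5 is determined by that of [tr X^2], which is [q t^5] with
    [q = tr(R_v R'_v) / 6]: no higher derivative of the curvature enters.  The
    coefficient of [t^5] in the expansion is then [- (c1/6 + c2/2) q], and parity
    forces it to vanish; so [q = 0], which is the claim ([trace_mul_deriv_eq0]).

    The whole computation takes place in a single chart around [m], in which the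
    exponential map is the map [F] of the record [normal_chart]. *)

(** * Elementary symmetric functions *)

(** The generating function through which the scaling and recursion rules are
    obtained. *)
Lemma elem_symE (R : realType) k (s : seq R) :
  elem_sym k s = (\prod_(a <- s) (1 + a *: 'X))`_k.
Proof.
rewrite (big_nth 0) big_mkord; under eq_bigr do rewrite addrC.
rewrite bigA_distr coef_sum /elem_sym big_mkcond; apply: eq_bigr => I _.
rewrite -big_mkcondr /=.
have -> : \prod_(i in I) (s`_i *: 'X) = (\prod_(i in I) s`_i) *: 'X^(#|I|).
  by rewrite scaler_prod prodr_const.
by rewrite coefZ coefXn eq_sym; case: eqP; rewrite (mulr1, mulr0).
Qed.

Lemma elem_sym_perm (R : realType) k (s1 s2 : seq R) :
  perm_eq s1 s2 -> elem_sym k s1 = elem_sym k s2.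
Proof. by move=> e; rewrite !elem_symE (perm_big _ e). Qed.

Lemma elem_sym_scale (R : realType) k (c : R) (s : seq R) :
  elem_sym k [seq c * a | a <- s] = c ^+ k * elem_sym k s.
Proof.
rewrite !elem_symE big_map.
have -> : \prod_(a <- s) (1 + (c * a) *: 'X) =
          (\prod_(a <- s) (1 + a *: 'X)) \Po (c *: 'X).
  rewrite rmorph_prod; apply: eq_bigr => a _ /=.
  by rewrite rmorphD rmorph1 /= comp_polyZ comp_polyX scalerA mulrC.
rewrite comp_polyE coef_sum.
set p := \prod_(a <- s) _.
under eq_bigr do rewrite exprZn coefZ coefZ coefXn.
case: (ltnP k (size p)) => h.
  rewrite (bigD1 (Ordinal h)) //= big1 ?addr0 ?eqxx ?mulr1 1?mulrC // => i ne.
  case: eqP => [e|_]; last by rewrite !mulr0.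
  by case/eqP: ne; apply: val_inj.
rewrite big1; first by rewrite nth_default ?mulr0.
move=> i _; case: eqP => [e|_]; last by rewrite !mulr0.
by move: h; rewrite e leqNgt ltn_ord.
Qed.

Lemma elem_sym0 (R : realType) (s : seq R) : elem_sym 0 s = 1.
Proof.
rewrite elem_symE; elim: s => [|a s IH]; first by rewrite big_nil coef1.
by rewrite big_cons mulrDl mul1r -scalerAl mulrC coefD coefZ coefMX mulr0 IH addr0.
Qed.

Lemma elem_symS_cons (R : realType) k a (s : seq R) :
  elem_sym k.+1 (a :: s) = elem_sym k.+1 s + a * elem_sym k s.
Proof.
by rewrite !elem_symE big_cons mulrDl mul1r -scalerAl mulrC coefD coefZ coefMX.
Qed.

Lemma elem_symS_nil (R : realType) k : elem_sym k.+1 (Nil R) = 0.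
Proof. by rewrite elem_symE big_nil coef1. Qed.

Lemma elem_sym1 (R : realType) (s : seq R) : elem_sym 1 s = \sum_(a <- s) a.
Proof.
elim: s => [|a s IH]; first by rewrite elem_symS_nil big_nil.
by rewrite elem_symS_cons IH elem_sym0 mulr1 big_cons addrC.
Qed.

Lemma elem_sym2 (R : realType) (s : seq R) :
  elem_sym 2 s = ((\sum_(a <- s) a) ^+ 2 - \sum_(a <- s) a ^+ 2) / 2.
Proof.
elim: s => [|a s IH]; first by rewrite elem_symS_nil !big_nil subr0 expr0n mul0r.
by rewrite elem_symS_cons IH elem_sym1 !big_cons; field.
Qed.

Lemma elem_sym_bound (R : realType) k (s : seq R) (e : R) :
  (forall a, a \in s -> `|a| <= e) -> `|elem_sym k s| <= 'C(size s, k)%:R * e ^+ k.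
Proof.
elim: s k => [|a s IH] [|k] h;
  rewrite ?elem_sym0 ?elem_symS_nil ?bin0 ?bin0n ?normr0 ?normr1 ?mul0r ?mul1r //=.
rewrite elem_symS_cons binS natrD mulrDl; apply: le_trans (ler_normD _ _) _.
have hs b : b \in s -> `|b| <= e by move=> bs; apply: h; rewrite inE bs orbT.
apply: lerD; first exact: IH.
rewrite normrM exprS mulrCA; apply: ler_pM => //; last exact: IH.
by apply: h; rewrite inE eqxx.
Qed.

Lemma coef_X1n (R : nzRingType) n m : ((1 + 'X : {poly R}) ^+ n)`_m = 'C(n, m)%:R.
Proof.
elim: n m => [|n IH] [|m]; rewrite ?expr0 ?coef1 ?bin0 //.
  by rewrite exprS mulrDl mul1r coefD coefXM /= IH bin0 addr0.
by rewrite exprS mulrDl mul1r coefD coefXM /= !IH binS natrD.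
Qed.

(** Each factor of the generating function is [(1 + 'X) + a *: 'X]; expanding
    the product groups the terms by the set of factors in which [a *: 'X] is
    chosen. *)
Lemma elem_sym_shift (R : realType) k (s : seq R) :
  elem_sym k [seq 1 + a | a <- s] =
  \sum_(j < k.+1) 'C(size s - j, k - j)%:R * elem_sym j s.
Proof.
rewrite elem_symE big_map.
transitivity ((\sum_(j < (size s).+1) elem_sym j s *: ('X ^+ j * (1 + 'X) ^+ (size s - j)))`_k).
  congr (polyseq _)`_k.
  rewrite (big_nth 0) big_mkord.
  under eq_bigr do rewrite scalerDl scale1r addrA addrC.
  rewrite bigA_distr.
  transitivity (\sum_(I : {set 'I_(size s)})
     (\prod_(i in I) s`_i) *: ('X ^+ #|I| * (1 + 'X) ^+ (size s - #|I|))).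
    apply: eq_bigr => I _.
    rewrite (bigID (mem I)) /= (eq_bigr (fun i : 'I__ => s`_i *: 'X)); last by move=> i ->.
    rewrite [X in _ * X](eq_bigr (fun i : 'I__ => 1 + 'X)); last by move=> i /negbTE ->.
    rewrite scaler_prod !prodr_const -scalerAl; congr (_ *: (_ * _ ^+ _)).
    have H : (#|I| + #|[predC I]| = size s)%N by rewrite cardC card_ord.
    rewrite -(canRL (addKn _) H).
    by apply: eq_card => i; rewrite !inE.
  rewrite (partition_big (fun I : {set 'I_(size s)} => inord #|I| : 'I_(size s).+1) xpredT) //=.
  apply: eq_bigr => j _; rewrite /elem_sym scaler_suml.
  apply: eq_big => I.
    rewrite -val_eqE /= inordK // ltnS; have := max_card (mem I); rewrite card_ord; apply.
  move/eqP=> <-; rewrite inordK // ltnS; have := max_card (mem I); rewrite card_ord; apply.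
rewrite coef_sum.
pose f j := if (j <= k)%N then 'C(size s - j, k - j)%:R * elem_sym j s else 0.
have E (j : nat) :
    (elem_sym j s *: ('X ^+ j * (1 + 'X) ^+ (size s - j)))`_k = f j.
  rewrite coefZ coefXnM ltnNge /f.
  by case: leqP => jk /=; rewrite ?mulr0 // coef_X1n mulrC.
have big j : (size s < j)%N -> elem_sym j s = 0.
  move=> h; apply/eqP; rewrite -normr_le0.
  have -> : 0 = 'C(size s, j)%:R * (\sum_(a <- s) `|a|) ^+ j.
    by rewrite bin_small // mul0r.
  apply: elem_sym_bound => a as_.
  by rewrite (big_rem a) //= lerDl sumr_ge0.
transitivity (\sum_(j < (k + size s).+1) f j).
  rewrite (eq_bigr (fun j : 'I__ => f j)) => [|j _]; last exact: E.
  rewrite (big_ord_widen (k + size s).+1 f) ?ltnS ?leq_addl //.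
  rewrite big_mkcond; apply: eq_bigr => j _; rewrite ltnS.
  by case: leqP => // h; rewrite /f big // mulr0 if_same.
rewrite [RHS](big_ord_widen (k + size s).+1
  (fun j => 'C(size s - j, k - j)%:R * elem_sym j s)) ?ltnS ?leq_addr //.
by rewrite [RHS]big_mkcond; apply: eq_bigr => j _; rewrite ltnS.
Qed.

(** The coefficient of [elem_sym j] in [elem_sym_shift], extended by zero so that
    sums over [j] may run past [k]. *)
Definition bin_shift N k j : nat := if (j <= k)%N then 'C(N - j, k - j) else 0.

(** The symmetric functions of degree at least 3 are of third order in the size
    of the variables; those of degree 1 and 2 are expressed by power sums, which
    are traces when the variables are eigenvalues. *)
Lemma elem_sym_shift_bound (R : realType) N k : exists K : R, 0 <= K /\
  forall (s : seq R) (e : R), size s = N -> 0 <= e <= 1 ->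
  (forall a, a \in s -> `|a| <= e) ->
  `|elem_sym k [seq 1 + a | a <- s] - ('C(N, k)%:R
     + (bin_shift N k 1)%:R * \sum_(a <- s) a
     + (bin_shift N k 2)%:R *
         (((\sum_(a <- s) a) ^+ 2 - \sum_(a <- s) a ^+ 2) / 2))| <= K * e ^+ 3.
Proof.
exists (\sum_(j < k.+3) (bin_shift N k j)%:R * 'C(N, j)%:R); split.
  by apply: sumr_ge0 => j _; rewrite mulr_ge0.
move=> s e sN /andP[e0 e1] h; rewrite elem_sym_shift sN.
have -> : \sum_(j < k.+1) 'C(N - j, k - j)%:R * elem_sym j s =
          \sum_(j < k.+3) (bin_shift N k j)%:R * elem_sym j s.
  rewrite (big_ord_widen k.+3
    (fun j => 'C(N - j, k - j)%:R * elem_sym j s)) ?ltnS ?leqW //.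
  rewrite big_mkcond; apply: eq_bigr => j _; rewrite ltnS /bin_shift.
  by case: ifP => // _; rewrite mul0r.
rewrite !big_ord_recl /= elem_sym0 elem_sym1 elem_sym2.
rewrite /bump /= {1}/bin_shift /= !subn0 mulr1.
set A := _ * (\sum_(a <- s) a); set B := _ * (_ / 2); set T := \sum_(i < k) _.
have -> : 'C(N, k)%:R + (A + (B + T)) - ('C(N, k)%:R + A + B) = T by ring.
rewrite !mulrDl; apply: ler_wpDl; first by rewrite !mulr_ge0 ?exprn_ge0.
apply: ler_wpDl; first by rewrite !mulr_ge0 ?exprn_ge0.
apply: ler_wpDl; first by rewrite !mulr_ge0 ?exprn_ge0.
rewrite mulr_suml; apply: le_trans (ler_norm_sum _ _ _) _.
apply: ler_sum => i _; rewrite normrM normr_nat -mulrA.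
apply: ler_wpM2l => //; apply: le_trans (elem_sym_bound _ h) _; rewrite sN.
by apply: ler_wpM2l => //; apply: ler_wiXn2l.
Qed.

(** * Characteristic polynomials and real eigenvalues *)

Lemma comp_poly_X2_inj (R : nzRingType) (p q : {poly R}) :
  p \Po 'X^2 = q \Po 'X^2 -> p = q.
Proof.
move=> e; apply/polyP => i; have := congr1 (fun r : {poly R} => r`_(i * 2)) e.
by rewrite !coef_comp_poly_Xn // !dvdn_mull // !mulnK.
Qed.

(** The identity [det('X - A) * det('X + A) = det('X^2 - A^2)]; the sign comes from
    [det('X + A) = (-1)^n det(- 'X - A)]. *)
Lemma char_poly_sqr (R : comNzRingType) n (A : 'M[R]_n) :
  char_poly (A *m A) \Po 'X^2 =
  (-1) ^+ n * (char_poly A * (char_poly A \Po (- 'X))).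
Proof.
have comp r (B : 'M[R]_n) :
    char_poly B \Po r = \det (r%:M - map_mx polyC B).
  rewrite /char_poly -[_ \Po _]/(comp_poly r _) -det_map_mx; congr (\det _).
  apply/matrixP => i j; rewrite !mxE /=.
  by rewrite rmorphB rmorphMn /= comp_polyX comp_polyC.
rewrite -[X in _ * (X * _)]comp_polyXr !comp mulrCA -detZ -det_mulmx.
congr (\det _); rewrite map_mxM /= scaleN1r opprB mulmxBl !mulmxBr.
have -> : (- 'X)%:M = - 'X%:M :> 'M[{poly R}]_n by rewrite raddfN.
rewrite !mulmxN !opprK -scalar_mxM -expr2 scalar_mxC.
by rewrite opprD [_ + 'X^2%:M]addrC addrACA subrr addr0.
Qed.

Lemma char_poly_split_trace (R : idomainType) n (A : 'M[R]_n) s :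
  char_poly A = \prod_(a <- s) ('X - a%:P) -> \tr A = \sum_(a <- s) a.
Proof.
move=> e; have sz : size s = n.
  by have := size_char_poly A; rewrite e size_prod_XsubC => -[].
case: n A e sz => [|n] A e sz.
  by rewrite (size0nil sz) big_nil /mxtrace big_ord0.
have h := char_poly_trace A isT; apply: oppr_inj; rewrite -h e.
by have := @coefPn_prod_XsubC R s; rewrite sz => ->.
Qed.

(** The roots of [char_poly (A *m A)] are the squares of those of [char_poly A],
    by [char_poly_sqr], which gives the trace of the square without choosing a
    basis of eigenvectors. *)
Lemma char_poly_split_trace_sqr (R : idomainType) n (A : 'M[R]_n) s :
  char_poly A = \prod_(a <- s) ('X - a%:P) ->
  \tr (A *m A) = \sum_(a <- s) a ^+ 2.
Proof.
move=> e; have sz : size s = n.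
  by have := size_char_poly A; rewrite e size_prod_XsubC => -[].
rewrite -(big_map (fun a => a ^+ 2) xpredT id) /=.
apply: char_poly_split_trace; apply: comp_poly_X2_inj.
rewrite char_poly_sqr e !rmorph_prod /= -sz big_map.
elim: s {e sz} => [|a s IH]; first by rewrite !big_nil !mulr1 expr0.
rewrite !big_cons /= -IH !rmorphB /= !comp_polyX !comp_polyC.
by rewrite exprS rmorphXn /=; ring.
Qed.

(** In the basis formed by the rows of [V] and [N], the matrix [A] is block
    diagonal. *)
Lemma char_poly_block1 (F : fieldType) r n (V : 'M[F]_(r, n)) (N : 'rV[F]_n)
    (A : 'M[F]_n) (B : 'M[F]_r) :
  (r + 1 = n)%N -> V *m A = B *m V -> N *m A = N -> row_free (col_mx V N) ->
  char_poly A = char_poly B * ('X - 1).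
Proof.
move=> e; subst n => VA NA fr.
have uM : col_mx V N \in unitmx by rewrite -row_free_unit.
set M := col_mx V N in uM.
have MA : M *m A = block_mx B 0 0 1%:M *m M.
  by rewrite mul_col_mx mul_block_col !mul0mx addr0 add0r mul1mx VA NA.
set MP := map_mx polyC M.
have dM : \det MP != 0.
  by rewrite det_map_mx polyC_eq0 -unitfE -unitmxE.
apply: (mulfI dM); rewrite -det_mulmx mulmxBr.
have -> : MP *m map_mx polyC A = map_mx polyC (block_mx B 0 0 1%:M) *m MP.
  by rewrite -!map_mxM MA.
rewrite scalar_mxC -mulmxBl det_mulmx mulrC; congr (_ * _).
rewrite map_block_mx !map_mx0 map_mx1 scalar_mx_block opp_block_mx add_block_mx.
rewrite !oppr0 !addr0 det_ublock; congr (_ * _).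
by rewrite -[1%:M]/(1%:M) -raddfB /= det_scalar1.
Qed.

(** The real and imaginary parts of an eigenvector [x + i y] for [a + i b]
    satisfy [x A = a x - b y] and [y A = b x + a y]; self-adjointness then gives
    [b (<x, x> + <y, y>) = 0]. *)
Lemma selfadjoint_split (R : rcfType) n (G A : 'M[R]_n) :
  G^T = G -> (forall u : 'rV[R]_n, u != 0 -> 0 < (u *m G *m u^T) 0 0) ->
  A *m G = G *m A^T ->
  exists s, char_poly A = \prod_(a <- s) ('X - a%:P).
Proof.
move=> Gs Gp AG.
pose rc : {rmorphism R -> complex.complex R} := complex.real_complex R.
pose AC := map_mx rc A.
have trmx_scale (k : R) (w : 'rV[R]_n) : (k *: w)^T = k *: w^T by rewrite linearZ.
have [z zE] := closed_field_poly_normal (char_poly AC).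
rewrite (monicP (char_poly_monic _)) scale1r in zE.
have ReD : {morph (@complex.Re R : complex.complex R -> R) : x y / x + y} by case=> a b [c d].
have ImD : {morph (@complex.Im R : complex.complex R -> R) : x y / x + y} by case=> a b [c d].
have ReM (u : 'rV[complex.complex R]_n) : map_mx (@complex.Re R) (u *m AC) =
    map_mx (@complex.Re R) u *m A.
  apply/rowP => j; rewrite !mxE (big_morph (@complex.Re R : complex.complex R -> R) ReD erefl).
  by apply: eq_bigr => k _; rewrite !mxE; case: (u 0 k) => a b /=; rewrite mulr0 subr0.
have ImM (u : 'rV[complex.complex R]_n) : map_mx (@complex.Im R) (u *m AC) =
    map_mx (@complex.Im R) u *m A.
  apply/rowP => j; rewrite !mxE (big_morph (@complex.Im R : complex.complex R -> R) ImD erefl).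
  by apply: eq_bigr => k _; rewrite !mxE; case: (u 0 k) => a b /=; rewrite mulr0 add0r.
have real_root (c : complex.complex R) : c \in z -> c = rc (complex.Re c).
  move=> cz; have : root (char_poly AC) c by rewrite zE root_prod_XsubC.
  rewrite -eigenvalue_root_char => /eigenvalueP[u uA u0].
  have := congr1 (map_mx (@complex.Re R)) uA; rewrite ReM.
  have := congr1 (map_mx (@complex.Im R)) uA; rewrite ImM.
  set x := map_mx _ u; set y := map_mx _ u.
  case: c {cz} uA => a b uA.
  have -> : map_mx (@complex.Im R) (complex.Complex a b *: u) = b *: y + a *: x.
    by apply/rowP => j; rewrite !mxE; case: (u 0 j) => p q /=; rewrite addrC.
  have -> : map_mx (@complex.Re R) (complex.Complex a b *: u) = a *: y - b *: x.
    by apply/rowP => j; rewrite !mxE; case: (u 0 j) => p q /=.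
  move=> xA yA.
  have E : y *m A *m G *m x^T = y *m G *m (x *m A)^T.
    by rewrite trmx_mul !mulmxA -[y *m A *m G]mulmxA AG !mulmxA.
  have := congr1 (fun m : 'M[R]_1 => m 0 0) E; rewrite /= xA yA !mulmxBl.
  rewrite [(_ + _)^T]raddfD /= !trmx_scale mulmxDr -!scalemxAl -!scalemxAr.
  set p := (x *m G *m x^T); set q := y *m G *m y^T; set r := y *m G *m x^T.
  have aux (p' q' r' : 'M[R]_1) : (a *: r' - b *: p') 0 0 = (b *: q' + a *: r') 0 0 ->
      b * (p' 0 0 + q' 0 0) = 0 by rewrite !mxE; lra.
  move/aux => {aux} H.
  have ge (w : 'rV[R]_n) : 0 <= (w *m G *m w^T) 0 0.
    by have [->|/Gp/ltW //] := eqVneq w 0; rewrite !mul0mx mxE.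
  suff pq : 0 < p 0 0 + q 0 0.
    move/eqP: H; rewrite mulf_eq0 (gt_eqF pq) orbF => /eqP ->.
    by [].
  have [x0|x0] := eqVneq x 0; last by apply: ltr_wpDr; [exact: ge|exact: Gp].
  have [y0|y0] := eqVneq y 0; last by apply: ltr_wpDl; [exact: ge|exact: Gp].
  case/eqP: u0; apply/rowP => j; rewrite mxE.
  have := congr1 (fun w : 'rV_n => w 0 j) x0; have := congr1 (fun w : 'rV_n => w 0 j) y0.
  by rewrite !mxE; case: (u 0 j) => c d /= -> ->.
exists [seq complex.Re c | c <- z].
apply: (@map_poly_inj _ _ rc); rewrite map_char_poly /= -/AC zE big_map rmorph_prod /=.
apply: eq_big_seq => c cz; rewrite rmorphB /= map_polyX map_polyC /=.
by rewrite {1}(real_root c cz).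
Qed.

(** * Partial and directional derivatives *)

Lemma cvg_sumr (K : numFieldType) (V : normedModType K) (T : Type)
    (F : set_system T) {FF : Filter F} (I : Type) (r : seq I)
    (f : I -> T -> V) (l : I -> V) :
  (forall i, f i @ F --> l i) ->
  (fun t => \sum_(i <- r) f i t) @ F --> \sum_(i <- r) l i.
Proof.
move=> h; elim: r => [|i r IH].
  by under eq_fun do rewrite big_nil; rewrite big_nil; exact: cvg_cst.
by under eq_fun do rewrite big_cons; rewrite big_cons; apply: cvgD.
Qed.

Lemma line_derive (R : realType) (U V : normedModType R) (f : U -> V) p w (t : R) :
  derivable f (p + t *: w) w ->
  is_derive t 1 (fun s : R => f (p + s *: w)) ('D_w f (p + t *: w)).
Proof.
have e : (fun h : R => h^-1 *: ((fun s : R => f (p + s *: w)) (h *: 1 + t) -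
            (fun s : R => f (p + s *: w)) t)) =
         (fun h : R => h^-1 *: (f (h *: w + (p + t *: w)) - f (p + t *: w))).
  apply/funext => h /=; congr (_ *: (f _ - _)).
  by rewrite scalerDl addrCA [h *: 1]mulr1.
move=> d; apply: DeriveDef; first by move: d; rewrite /derivable e.
by rewrite /derive e.
Qed.

(** The increment [b] may have either sign, which is why the intermediate point is
    parametrised by [c] in the unit interval. *)
Lemma MVT_dir (R : realType) (V : normedModType R) (f : V -> R) p v (b : R) :
  (forall t : R, 0 <= t <= 1 -> derivable f (p + (t * b) *: v) v) ->
  exists2 c : R, 0 <= c <= 1 &
    f (p + b *: v) - f p = b * 'D_v f (p + (c * b) *: v).
Proof.
move=> df; pose g (s : R) := f (p + s *: v); pose phi t := g (t * b).
have dphi (t : R) : 0 <= t <= 1 ->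
    is_derive t 1 phi (b * 'D_v f (p + (t * b) *: v)).
  move=> /df /line_derive dg.
  have dl : is_derive t 1 (fun s : R => s * b) b.
    have := @is_deriveM R _ id (cst b) t 1 1 0 _ _.
    by rewrite scaler0 add0r /GRing.scale /= mulr1; apply.
  by have := @is_derive1_comp R g (fun s => s * b) t _ _ dg dl; rewrite mulrC.
have [||c c01] := @MVT R phi (fun t => b * 'D_v f (p + (t * b) *: v)) 0 1 ltr01.
- by move=> t; rewrite in_itv /= => /andP[t0 t1]; apply: dphi; rewrite !ltW.
- apply: derivable_within_continuous => t; rewrite in_itv /= => t01.
  by have [] := dphi t t01.
rewrite /phi /g mul1r mul0r scale0r addr0 subr0 mulr1 => ->.
by exists c => //; move: c01; rewrite in_itv /= => /andP[? ?]; rewrite !ltW.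
Qed.

Section Calc.
Variables (R : realType) (n : nat).
Local Notation E := 'rV[R]_n.
Implicit Types (U : set E) (x p v w h : E).

Lemma normr_rV_le (k h : E) : (forall l, `|k 0 l| <= `|h 0 l|) -> `|k| <= `|h|.
Proof.
move=> kh; rewrite [leLHS]/Num.Def.normr /= mx_normrE bigmax_le // => -[i j] _ /=.
rewrite ord1; apply: le_trans (kh j) _.
by rewrite [leRHS]/Num.Def.normr /= mx_normrE; exact: (le_bigmax _ _ (0, j)).
Qed.

Lemma normr_rV_coord (h : E) l : `|h 0 l| <= `|h|.
Proof.
by rewrite [leRHS]/Num.Def.normr /= mx_normrE; exact: (le_bigmax _ _ (0, l)).
Qed.

(** Moving from [x] to [x + h] along the coordinate axes, each step is
    controlled by the mean value theorem for one partial derivative. *)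
Lemma partials_differentiable (f : E -> R) x :
  (forall l, \forall y \near x, derivable f y (basis_vec R l)) ->
  (forall l, {for x, continuous ('D_(basis_vec R l) f)}) ->
  differentiable f x /\
  'd f x = (fun h : E => \sum_l h 0 l * 'D_(basis_vec R l) f x) :> (E -> R).
Proof.
move=> df cf.
pose L (h : E) : R := \sum_l h 0 l * 'D_(basis_vec R l) f x.
have Llin : linear L.
  move=> a u v; rewrite /L /GRing.scale /= mulr_sumr -big_split; apply: eq_bigr => l _.
  by rewrite !mxE mulrDl mulrA.
pose LL : {linear E -> R} := HB.pack L (GRing.isLinear.Build _ _ _ _ L Llin).
have Lc : continuous LL.
  move=> y; rewrite /= /L; apply: (@cvg_sumr _ _ _ (nbhs y)) => l.
  by apply: cvgM; [exact: coord_continuous|exact: cvg_cst].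
have key : (f : E -> R^o) \o shift x = cst (f x) + (LL : E -> R^o) +o_ (0 : E) id.
  apply/eqaddoP => _ /posnumP[e].
  pose e' := e%:num / n.+1%:R.
  have e'0 : 0 < e' by rewrite divr_gt0.
  have : \forall y \near x, forall l : 'I_n, derivable f y (basis_vec R l) /\
      `|'D_(basis_vec R l) f x - 'D_(basis_vec R l) f y| <= e'.
    apply: (@filter_forall _ 'I_n _ (nbhs x)) => l; apply: filterI; first exact: df.
    have := cf l; move/cvgrPdist_le; exact.
  move=> /nbhs_ballP[r /= r0 hr].
  near=> h.
  have hr' : `|h| < r.
    by near: h; apply/nbhs_ballP; exists r => //= h; rewrite -ball_normE /= sub0r normrN.
  pose P j : E := \row_l (x 0 l + if (l < j)%N then h 0 l else 0).
  have P0 : P 0%N = x by apply/rowP => l; rewrite mxE addr0.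
  have Pn : P n = h + x by apply/rowP => l; rewrite !mxE ltn_ord addrC.
  have PS (j : 'I_n) : P j.+1 = P j + h 0 j *: basis_vec R j.
    apply/rowP => l; rewrite !mxE eqxx /= ltnS leq_eqVlt -val_eqE /= eq_sym.
    case: (ltngtP j l) => jl; rewrite /= ?mulr0 ?addr0 ?mulr1 //.
    by rewrite (val_inj jl).
  have step (j : 'I_n) : `|f (P j.+1) - f (P j) - h 0 j * 'D_(basis_vec R j) f x|
      <= e' * `|h|.
    have inb (t : R) : 0 <= t <= 1 -> ball x r (P j + (t * h 0 j) *: basis_vec R j).
      move=> /andP[t0 t1]; rewrite -ball_normE /=; apply: le_lt_trans hr'.
      apply: normr_rV_le => l; rewrite !mxE eqxx /=.
      set a := if _ then _ else _; set b := _ * _.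
      have -> : x 0 l - (x 0 l + a + b) = - (a + b) by ring.
      rewrite normrN /a /b -val_eqE /=; case: (ltngtP l j) => lj /=.
      - by rewrite mulr0 addr0.
      - by rewrite mulr0 addr0 normr0.
      rewrite mulr1 add0r normrM (ger0_norm t0) (val_inj lj).
      by rewrite ler_piMl.
    rewrite PS; have [t t01|c c01 ->] := @MVT_dir R _ f (P j) (basis_vec R j) (h 0 j).
      by have [] := hr _ (inb t t01) j.
    rewrite -mulrBr normrM mulrC distrC; apply: ler_pM => //.
      by have [] := hr _ (inb c c01) j.
    exact: normr_rV_coord.
  rewrite /= !fctE /= [in X in `|X|]/L -Pn -P0 opprD addrA.
  have -> : f (P n) - f (P 0%N) = \sum_(j < n) (f (P j.+1) - f (P j)).
    by rewrite -(big_mkord xpredT (fun j => f (P j.+1) - f (P j))) telescope_sumr.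
  rewrite P0 -sumrB; apply: le_trans (ler_norm_sum _ _ _) _.
  apply: (@le_trans _ _ (\sum_(j < n) e' * `|h|)); first exact: ler_sum.
  rewrite sumr_const card_ord -mulr_natr mulrAC ler_wpM2r //.
  by rewrite /e' -mulrA ler_piMr // ler_pdivrMl // mulr1 ler_nat.
have dL : 'd f x = LL :> (E -> R) by apply: diff_unique.
split; last by rewrite dL.
by apply/diff_locallyP; rewrite dL.
Unshelve. all: by end_near. Qed.

(** The second difference over a small parallelogram with sides [s u] and [s w]:
    the mean value theorem is applied in the direction [u] and then, to the
    resulting derivative, in the direction [w]. *)
Lemma second_difference (f : E -> R) x u w :
  (\forall y \near x, derivable f y u) ->
  (\forall y \near x, derivable ('D_u f) y w) ->
  {for x, continuous ('D_w ('D_u f))} ->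
  forall e : R, 0 < e -> \forall s \near (0 : R)^'+,
    `|(f (x + s *: u + s *: w) - f (x + s *: u) - f (x + s *: w) + f x)
        - s ^+ 2 * 'D_w ('D_u f) x| <= s ^+ 2 * e.
Proof.
move=> du dwu c e e0.
have : \forall y \near x, [/\ derivable f y u, derivable ('D_u f) y w &
    `|'D_w ('D_u f) x - 'D_w ('D_u f) y| <= e].
  move/cvgrPdist_le : c => /(_ _ e0) c.
  by apply: filterS (filterI (filterI du dwu) c) => y [[? ?] ?]; split.
move=> /nbhs_ballP[r /= r0 hr].
near=> s.
have s0 : 0 < s by near: s; exact: nbhs_right_gt.
have inb (a b : R) : 0 <= a <= 1 -> 0 <= b <= 1 ->
    ball x r (x + (a * s) *: u + (b * s) *: w).
  move=> /andP[a0 a1] /andP[b0 b1]; rewrite -ball_normE /=.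
  have -> : x - (x + (a * s) *: u + (b * s) *: w) = - (s *: (a *: u + b *: w)).
    rewrite scalerDr !scalerA ![s * _]mulrC -addrA opprD addrA subrr sub0r.
    by [].
  rewrite normrN normrZ (gtr0_norm s0).
  apply: (@le_lt_trans _ _ (s * (`|u| + `|w|))).
    apply: ler_wpM2l; first exact: ltW.
    apply: le_trans (ler_normD _ _) _; rewrite !normrZ !ger0_norm //.
    by apply: lerD; rewrite ler_piMl.
  apply: (@le_lt_trans _ _ (s * (`|u| + `|w| + 1))).
    by rewrite ler_pM2l // lerDl.
  rewrite -ltr_pdivlMr ?ltr_wpDl ?addr_ge0 //.
  by near: s; apply: nbhs_right_lt; rewrite divr_gt0 ?ltr_wpDl ?addr_ge0.
pose g := (fun y => f (y + s *: w)) - f.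
have dg (t : R) : 0 <= t <= 1 -> is_derive (x + (t * s) *: u) u g
    ('D_u f (x + (t * s) *: u + s *: w) - 'D_u f (x + (t * s) *: u)).
  move=> t01; apply: is_deriveB.
    have h : derivable f (x + (t * s) *: u + s *: w) u.
      have := inb t 1 t01; rewrite mul1r lexx ler01 => /(_ isT) h.
      by have [] := hr _ h.
    have e1 : (fun h : R => h^-1 *: ((fun y => f (y + s *: w))
          (h *: u + (x + (t * s) *: u)) - f (x + (t * s) *: u + s *: w))) =
        (fun h : R => h^-1 *: (f (h *: u + (x + (t * s) *: u + s *: w))
             - f (x + (t * s) *: u + s *: w))).
      by apply/funext => k /=; rewrite !addrA.
    by apply: DeriveDef; [move: h; rewrite /derivable e1|rewrite /derive e1].
  apply: derivableP.
  have := inb t 0 t01; rewrite mul0r scale0r addr0 lexx ler01 => /(_ isT) h.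
  by have [] := hr _ h.
have -> : f (x + s *: u + s *: w) - f (x + s *: u) - f (x + s *: w) + f x =
    g (x + s *: u) - g x.
  have gE y : g y = f (y + s *: w) - f y by [].
  by rewrite !gE; ring.
have [|a a01 ->] := @MVT_dir R _ g x u s; first by move=> t /dg[].
rewrite (@derive_val _ _ _ _ _ _ _ (dg a a01)).
have [|b b01 ->] := @MVT_dir R _ ('D_u f) (x + (a * s) *: u) w s.
  by move=> t t01; have [] := hr _ (inb a t a01 t01).
rewrite mulrA -expr2 -mulrBr normrM ger0_norm ?exprn_ge0 ?(ltW s0) //.
apply: ler_wpM2l; first by rewrite exprn_ge0 ?(ltW s0).
by rewrite distrC; have [] := hr _ (inb a b a01 b01).
Unshelve. all: by end_near. Qed.

(** Both mixed derivatives approximate the same second difference. *)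
Lemma derive_comm (f : E -> R) x u w :
  (\forall y \near x, derivable f y u) ->
  (\forall y \near x, derivable f y w) ->
  (\forall y \near x, derivable ('D_u f) y w) ->
  (\forall y \near x, derivable ('D_w f) y u) ->
  {for x, continuous ('D_w ('D_u f))} ->
  {for x, continuous ('D_u ('D_w f))} ->
  'D_w ('D_u f) x = 'D_u ('D_w f) x.
Proof.
move=> du dw duw dwu cuw cwu; apply/eqP; rewrite -subr_eq0 -normr_le0.
apply/ler_addgt0Pr => e e0; rewrite add0r.
have e20 : 0 < e / 2 by rewrite divr_gt0.
have H1 := second_difference du duw cuw e20.
have H2 := second_difference dw dwu cwu e20.
have H3 : \forall s \near (0 : R)^'+, 0 < s by exact: nbhs_right_gt.
have [s [[h1 h2] s0]] := filter_ex (filterI (filterI H1 H2) H3).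
have s20 : 0 < s ^+ 2 by rewrite exprn_gt0.
rewrite -(ler_pM2l s20) -[X in X * `|_|](gtr0_norm s20) -normrM.
move: h1 h2; rewrite [x + s *: w + _]addrAC.
set A := f _; set B := f (x + s *: u); set C := f (x + s *: w).
move: ('D_w _ x) ('D_u _ x) (f x) => a b c; move: A B C => A B C h1 h2.
have -> : s ^+ 2 * (a - b) =
  (A - C - B + c - s ^+ 2 * b) - (A - B - C + c - s ^+ 2 * a) by ring.
apply: le_trans (ler_normB _ _) _; apply: le_trans (lerD h2 h1) _.
by rewrite -mulrDr -splitr.
Qed.

End Calc.

(** * Smooth functions *)

Section Smooth.
Variables (R : realType) (n : nat).
Local Notation E := 'rV[R]_n.
Local Notation e_ := (basis_vec R (n := n)).
Implicit Types (U : set E) (f g : E -> R).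

Lemma Ck_on_ext (V : normedModType R) k U (f g : E -> V) : open U ->
  (forall x, U x -> f x = g x) -> Ck_on k U f -> Ck_on k U g.
Proof.
move=> oU.
have nfg (f0 g0 : E -> V) x : (forall x, U x -> f0 x = g0 x) -> U x ->
    \forall y \near x, f0 y = g0 y.
  by move=> h Ux; apply: filterS (open_nbhs_nbhs (conj oU Ux)) => y; exact: h.
have cts (f0 g0 : E -> V) : (forall x, U x -> f0 x = g0 x) ->
    (forall x, U x -> {for x, continuous f0}) ->
    forall x, U x -> {for x, continuous g0}.
  move=> h c x Ux; rewrite /prop_for /continuous_at -(h _ Ux).
  by apply: cvg_trans (c _ Ux); apply: (@near_eq_cvg _ _ (nbhs x)); exact: nfg.
elim: k f g => [|k IH] f g fg [cf df].
  by split=> //; exact: cts cf.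
split=> [|l]; first exact: cts cf.
have [dfl cl] := df l; split=> [x Ux|].
  exact: near_eq_derivable (nfg _ _ x fg Ux) (dfl x Ux).
by apply: IH cl => x Ux; apply: near_eq_derive; exact: nfg.
Qed.

Lemma Ck_onW (V : normedModType R) k U (f : E -> V) : Ck_on k.+1 U f -> Ck_on k U f.
Proof.
elim: k f => [|k IH] f [cf df]; first by split.
by split=> // l; have [dl cl] := df l; split=> //; exact: IH.
Qed.

Lemma Ck_on_sub (V : normedModType R) k U (U' : set E) (f : E -> V) :
  U' `<=` U -> Ck_on k U f -> Ck_on k U' f.
Proof.
move=> sU; elim: k f => [|k IH] f [cf df]; first by split=> // x /sU; exact: cf.
split=> [x /sU|l]; first exact: cf.
by have [dl cl] := df l; split=> [x /sU|]; [exact: dl|exact: IH].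
Qed.

Lemma Ck_on_coord p q k U (f : E -> 'M[R]_(p, q)) i j : open U ->
  Ck_on k U f -> Ck_on k U (fun x => f x i j : R^o).
Proof.
move=> oU.
have ij (f0 : E -> 'M[R]_(p, q)) x : {for x, continuous f0} ->
    {for x, continuous (fun x => f0 x i j : R^o)}.
  by move=> c; exact: (continuous_comp c (@coord_continuous _ p q i j _)).
elim: k f => [|k IH] f [cf df]; first by split=> // x Ux; apply: ij; exact: cf.
split=> [x Ux|l]; first by apply: ij; exact: cf.
have [dl cl] := df l; split=> [x Ux|]; first by move/derivable_mxP: (dl x Ux).
apply: Ck_on_ext (IH _ cl) => // x Ux.
by rewrite derive_mx ?mxE //; exact: dl.
Qed.

Lemma Ck_on_cst k U (c : R) : Ck_on k U (cst c : E -> R^o).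
Proof.
elim: k c => [|k IH] c; first by split=> // x _; exact: cst_continuous.
split=> [x _|l]; first exact: cst_continuous.
split=> [x _|]; first exact: derivable_cst.
have -> : 'D_(e_ l) (cst c : E -> R^o) = cst 0.
  by apply/funext => x; exact: derive_cst.
exact: IH.
Qed.

Lemma Ck_onD k U (f g : E -> R^o) : open U ->
  Ck_on k U f -> Ck_on k U g -> Ck_on k U (f + g).
Proof.
move=> oU; elim: k f g => [|k IH] f g [cf df] [cg dg].
  split; last by []. by move=> x Ux; apply: continuousD; [exact: cf|exact: cg].
split=> [x Ux|l]; first by apply: continuousD; [exact: cf|exact: cg].
have [dfl cfl] := df l; have [dgl cgl] := dg l; split=> [x Ux|].
  by apply: derivableD; [exact: dfl|exact: dgl].
apply: Ck_on_ext (IH _ _ cfl cgl) => // x Ux.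
by rewrite deriveD; [|exact: dfl|exact: dgl].
Qed.

Lemma Ck_onM k U f g : open U ->
  Ck_on k U (f : E -> R^o) -> Ck_on k U (g : E -> R^o) ->
  Ck_on k U (f * g : E -> R^o).
Proof.
move=> oU; elim: k f g => [|k IH] f g Cf Cg.
  case: Cf Cg => [cf _] [cg _].
  by split=> // x Ux; apply: continuousM; [exact: cf|exact: cg].
have Cf' := Ck_onW Cf; have Cg' := Ck_onW Cg; case: Cf Cg => [cf df] [cg dg].
split=> [x Ux|l]; first by apply: continuousM; [exact: cf|exact: cg].
have [dfl cfl] := df l; have [dgl cgl] := dg l; split=> [x Ux|].
  by apply: derivableM; [exact: dfl|exact: dgl].
apply: Ck_on_ext (Ck_onD oU (IH _ _ Cf' cgl) (IH _ _ Cg' cfl)) => // x Ux.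
by rewrite deriveM; [|exact: dfl|exact: dgl].
Qed.

(** Induction on the order is possible because the derivative of [1 / f] is a
    polynomial in [1 / f] and the derivative of [f]. *)
Lemma Ck_onV k U f : open U -> (forall x, U x -> f x != 0) ->
  Ck_on k U (f : E -> R^o) -> Ck_on k U (fun x => (f x)^-1 : R^o).
Proof.
move=> oU f0; elim: k => [|k IH] Cf.
  by case: Cf => [cf _]; split=> // x Ux; apply: continuousV; [exact: f0|exact: cf].
have Cf' := Ck_onW Cf; case: Cf => [cf df].
split=> [x Ux|l]; first by apply: continuousV; [exact: f0|exact: cf].
have [dfl cfl] := df l; split=> [x Ux|].
  by apply: derivableV; [exact: f0|exact: dfl].
have h := Ck_onM oU (Ck_onM oU (Ck_on_cst k U (-1)) cfl)
                    (Ck_onM oU (IH Cf') (IH Cf')).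
apply: Ck_on_ext h => // x Ux.
rewrite deriveV; [|exact: f0|exact: dfl].
by rewrite -exprVn expr2 !fctE /GRing.scale /=; ring.
Qed.

Definition smoothR U f : Prop := smooth_on U (f : E -> R^o).

Section Open.
Variables (U : set E).
Hypothesis oU : open U.

Lemma smoothR_ext f g : (forall x, U x -> f x = g x) -> smoothR U f -> smoothR U g.
Proof. by move=> fg h k; apply: Ck_on_ext (h k). Qed.

Lemma smooth_coord p q (f : E -> 'M[R]_(p, q)) i j :
  smooth_on U f -> smoothR U (fun x => f x i j).
Proof. by move=> h k; exact: Ck_on_coord. Qed.

Lemma smoothR_cst c : smoothR U (cst c).
Proof. by move=> k; exact: Ck_on_cst. Qed.

Lemma smoothRD f g : smoothR U f -> smoothR U g -> smoothR U (fun x => f x + g x).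
Proof. by move=> hf hg k; exact: Ck_onD. Qed.

Lemma smoothRM f g : smoothR U f -> smoothR U g -> smoothR U (fun x => f x * g x).
Proof. by move=> hf hg k; exact: Ck_onM. Qed.

Lemma smoothRV f : (forall x, U x -> f x != 0) ->
  smoothR U f -> smoothR U (fun x => (f x)^-1).
Proof. by move=> f0 hf k; exact: Ck_onV. Qed.

Lemma smoothR_sum (I : Type) (r : seq I) (P : pred I) (F : I -> E -> R) :
  (forall i, smoothR U (F i)) -> smoothR U (fun x => \sum_(i <- r | P i) F i x).
Proof.
move=> h; elim: r => [|i r IH].
  by apply: smoothR_ext (smoothR_cst 0) => x _; rewrite big_nil.
have [Pi|Pi] := boolP (P i).
  by apply: smoothR_ext (smoothRD (h i) IH) => x _; rewrite big_cons Pi.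
by apply: smoothR_ext IH => x _; rewrite big_cons (negbTE Pi).
Qed.

Lemma smoothR_prod (I : Type) (r : seq I) (F : I -> E -> R) :
  (forall i, smoothR U (F i)) -> smoothR U (fun x => \prod_(i <- r) F i x).
Proof.
move=> h; elim: r => [|i r IH].
  by apply: smoothR_ext (smoothR_cst 1) => x _; rewrite big_nil.
by apply: smoothR_ext (smoothRM (h i) IH) => x _; rewrite big_cons.
Qed.

Lemma smoothR_det p (A : E -> 'M[R]_p) :
  (forall i j, smoothR U (fun x => A x i j)) -> smoothR U (fun x => \det (A x)).
Proof.
move=> h; apply: smoothR_sum => s.
by apply: smoothRM; [exact: smoothR_cst|exact: smoothR_prod].
Qed.

(** By Cramer's formula the entries of the inverse are quotients of polynomials in
    those of the matrix. *)
Lemma smoothR_invmx p (A : E -> 'M[R]_p) i j :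
  (forall x, U x -> A x \in unitmx) ->
  (forall i j, smoothR U (fun x => A x i j)) ->
  smoothR U (fun x => invmx (A x) i j).
Proof.
move=> Au h.
have adj : smoothR U (fun x => \adj (A x) i j).
  apply: (@smoothR_ext (fun x => (-1) ^+ (j + i) * \det (row' j (col' i (A x))))).
    by move=> x _; rewrite mxE.
  apply: smoothRM; first exact: smoothR_cst.
  apply: smoothR_det => a b; apply: smoothR_ext (h (lift j a) (lift i b)) => x _.
  by rewrite !mxE.
apply: smoothR_ext (smoothRM (smoothRV _ (smoothR_det h)) adj) => x Ux.
  by rewrite /invmx Au // [RHS]mxE.
by rewrite -unitfE -unitmxE Au.
Qed.

Lemma smoothR_continuous f x : smoothR U f -> U x -> {for x, continuous f}.
Proof. by move=> /(_ 0%N) [h _] Ux; exact: h. Qed.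

Lemma smoothR_partial f l : smoothR U f -> smoothR U ('D_(e_ l) f).
Proof. by move=> h k; have [_ /(_ l) []] := h k.+1. Qed.

Lemma smoothR_differentiable_partials f x : smoothR U f -> U x ->
  differentiable f x /\
  'd f x = (fun h : E => \sum_l h 0 l * 'D_(e_ l) f x) :> (E -> R).
Proof.
move=> h Ux; apply: partials_differentiable => l.
  have [_ /(_ l) [d _]] := h 1%N.
  by apply: filterS (open_nbhs_nbhs (conj oU Ux)) => y; exact: d.
exact: smoothR_continuous (smoothR_partial l h) Ux.
Qed.

Lemma smoothR_differentiable f x : smoothR U f -> U x -> differentiable f x.
Proof. by move=> h Ux; have [] := smoothR_differentiable_partials h Ux. Qed.

Lemma smoothR_derivable f x v : smoothR U f -> U x -> derivable f x v.
Proof. by move=> h Ux; apply: diff_derivable; exact: smoothR_differentiable. Qed.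

Lemma smoothR_deriveE f x v : smoothR U f -> U x ->
  'D_v f x = \sum_l v 0 l * 'D_(e_ l) f x.
Proof.
move=> h Ux; have [df e] := smoothR_differentiable_partials h Ux.
by rewrite deriveE // e.
Qed.

Lemma smoothR_derive f v : smoothR U f -> smoothR U ('D_v f).
Proof.
move=> h; apply: (@smoothR_ext (fun x => \sum_l v 0 l * 'D_(e_ l) f x)).
  by move=> x Ux; rewrite -smoothR_deriveE.
apply: smoothR_sum => l; apply: smoothRM; first exact: smoothR_cst.
exact: smoothR_partial.
Qed.

Lemma smoothR_derive_comm f x u w : smoothR U f -> U x ->
  'D_w ('D_u f) x = 'D_u ('D_w f) x.
Proof.
move=> h Ux.
have nU (P : E -> Prop) : (forall y, U y -> P y) -> \forall y \near x, P y.
  by move=> UP; apply: filterS (open_nbhs_nbhs (conj oU Ux)).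
apply: derive_comm.
- by apply: nU => y; exact: smoothR_derivable.
- by apply: nU => y; exact: smoothR_derivable.
- by apply: nU => y Uy; apply: smoothR_derivable => //; exact: smoothR_derive.
- by apply: nU => y Uy; apply: smoothR_derivable => //; exact: smoothR_derive.
- by apply: smoothR_continuous => //; do 2 apply: smoothR_derive.
- by apply: smoothR_continuous => //; do 2 apply: smoothR_derive.
Qed.

End Open.
End Smooth.

(** * Directional derivatives *)

(** The directional derivative behind an opaque proof: testing the convertibility
    of two different derivatives would otherwise unfold limits of filters. *)
Fact Dv_key (R : realType) (V W : normedModType R) :
  {D : V -> (V -> W) -> V -> W | forall v f, D v f = 'D_v f}.
Proof. by exists (fun v f => 'D_v f). Qed.

Definition Dv (R : realType) (V W : normedModType R) : V -> (V -> W) -> V -> W :=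
  sval (Dv_key V W).

(* The rules for [Dv] are stated through [is_derive], which carries the
   existence of the derivative along with its value. *)
Section Dv.
Variable R : realType.
Implicit Types V W : normedModType R.

Lemma DvE V W v (f : V -> W) : Dv v f = 'D_v f.
Proof. exact: (svalP (Dv_key V W)). Qed.

Lemma DvxE V W v (f : V -> W) x : Dv v f x = 'D_v f x.
Proof. by rewrite DvE. Qed.

Lemma is_derive_uniq V W (f : V -> W) x v a b :
  is_derive x v f a -> is_derive x v f b -> a = b.
Proof. by case=> _ <- [_ <-]. Qed.

Lemma is_derive_near V W (f g : V -> W) df x v :
  (\forall y \near x, f y = g y) -> is_derive x v f df -> is_derive x v g df.
Proof. exact: near_eq_is_derive. Qed.

Lemma derivable_Dv V W (f : V -> W) x v :
  derivable f x v -> is_derive x v f (Dv v f x).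
Proof. by rewrite DvE => /derivableP. Qed.

Lemma differentiable_Dv V W (f : V -> W) x v :
  differentiable f x -> is_derive x v f (Dv v f x).
Proof. by move=> df; apply/derivable_Dv/diff_derivable. Qed.

Lemma is_derive_Dv V W (f : V -> W) x v a : is_derive x v f a -> Dv v f x = a.
Proof. by rewrite DvE; case. Qed.

Lemma Dv_lin V W (f : V -> W) x a u w :
  differentiable f x -> Dv (a *: u + w) f x = a *: Dv u f x + Dv w f x.
Proof. by move=> df; rewrite !DvE !deriveE // linearP. Qed.

Lemma Dv0 V W (f : V -> W) x : Dv 0 f x = 0.
Proof. by rewrite DvE; exact: derive0. Qed.

Variables (n : nat) (U : set 'rV[R]_n).
Hypothesis oU : open U.

Lemma smoothR_Dv f v : smoothR U f -> smoothR U (Dv v f).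
Proof. by move=> h; rewrite DvE; exact: smoothR_derive. Qed.

Lemma smoothR_is_derive f x v : smoothR U f -> U x -> is_derive x v f (Dv v f x).
Proof. by move=> h Ux; apply: derivable_Dv; exact: (smoothR_derivable oU h Ux). Qed.

Lemma smoothR_Dv_sum f x v : smoothR U f -> U x ->
  Dv v f x = \sum_l v 0 l * Dv (basis_vec R l) f x.
Proof.
move=> h Ux; rewrite DvE (smoothR_deriveE oU _ h Ux); apply: eq_bigr => l _.
by rewrite DvE.
Qed.

Lemma smoothR_Dv_comm f x u w : smoothR U f -> U x ->
  Dv w (Dv u f) x = Dv u (Dv w f) x.
Proof. by move=> h Ux; rewrite !DvE; exact: smoothR_derive_comm h Ux. Qed.

End Dv.

(** * Differentiation rules for matrices *)

Section DeriveTools.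
Variables (R : realType) (V : normedModType R).
Implicit Types (x v : V).

Lemma is_derive_mx p q (M : V -> 'M[R]_(p, q)) (dM : 'M[R]_(p, q)) x v :
  (forall i j, is_derive x v (fun y => M y i j) (dM i j)) -> is_derive x v M dM.
Proof.
move=> h; have d : derivable M x v by apply/derivable_mxP => i j; have [] := h i j.
apply: DeriveDef => //; rewrite derive_mx //; apply/matrixP => i j.
by rewrite mxE; have [] := h i j.
Qed.

Lemma is_derive_coord p q (M : V -> 'M[R]_(p, q)) (dM : 'M[R]_(p, q)) x v i j :
  is_derive x v M dM -> is_derive x v (fun y => M y i j) (dM i j).
Proof.
case=> d <-; apply: DeriveDef; first by move/derivable_mxP: d.
by rewrite derive_mx // mxE.
Qed.

Lemma is_derive_sumr (W : normedModType R) (I : Type) (r : seq I)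
    (F : I -> V -> W) (dF : I -> W) x v :
  (forall i, is_derive x v (F i) (dF i)) ->
  is_derive x v (fun y => \sum_(i <- r) F i y) (\sum_(i <- r) dF i).
Proof.
move=> h; elim: r => [|i r IH].
  rewrite big_nil (_ : (fun y => _) = cst 0); last by apply/funext => y; rewrite big_nil.
  exact: is_derive_cst.
rewrite big_cons (_ : (fun y => _) = F i + (fun y => \sum_(i <- r) F i y)).
  exact: is_deriveD.
by apply/funext => y; rewrite big_cons.
Qed.

Lemma is_derive_mulr (f g : V -> R) df dg x v :
  is_derive x v f df -> is_derive x v g dg ->
  is_derive x v (fun y => f y * g y) (df * g x + f x * dg).
Proof.
move=> hf hg; have := is_deriveM hf hg; rewrite addrC /GRing.scale /= [_ * df]mulrC.
by apply.
Qed.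

Lemma is_derive_mulmx p q r (A : V -> 'M[R]_(p, q)) (B : V -> 'M[R]_(q, r)) dA dB x v :
  is_derive x v A dA -> is_derive x v B dB ->
  is_derive x v (fun y => A y *m B y) (dA *m B x + A x *m dB).
Proof.
move=> hA hB; apply: is_derive_mx => i j.
rewrite (_ : (fun y => _) = fun y => \sum_k A y i k * B y k j); last first.
  by apply/funext => y; rewrite mxE.
rewrite !mxE -big_split; apply: is_derive_sumr => k.
by apply: is_derive_mulr; exact: is_derive_coord.
Qed.

Lemma is_derive_scalemx p q (k : V -> R) (A : V -> 'M[R]_(p, q)) dk dA x v :
  is_derive x v k dk -> is_derive x v A dA ->
  is_derive x v (fun y => k y *: A y) (dk *: A x + k x *: dA).
Proof.
move=> hk hA; apply: is_derive_mx => i j.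
rewrite (_ : (fun y => _) = fun y => k y * A y i j); last first.
  by apply/funext => y; rewrite mxE.
by rewrite !mxE; apply: is_derive_mulr => //; exact: is_derive_coord.
Qed.

Lemma is_derive_trmx p q (A : V -> 'M[R]_(p, q)) dA x v :
  is_derive x v A dA -> is_derive x v (fun y => (A y)^T) dA^T.
Proof.
move=> hA; apply: is_derive_mx => i j; rewrite mxE.
rewrite (_ : (fun y => _) = fun y => A y j i); last by apply/funext => y; rewrite mxE.
exact: is_derive_coord.
Qed.

Lemma is_derive_mxtrace p (A : V -> 'M[R]_p) dA x v :
  is_derive x v A dA -> is_derive x v (fun y => \tr (A y)) (\tr dA).
Proof. by move=> hA; apply: is_derive_sumr => i; exact: is_derive_coord. Qed.

Lemma is_derive_inner p (G : V -> 'M[R]_p) (a b : V -> 'rV[R]_p) dG da db x v :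
  is_derive x v G dG -> is_derive x v a da -> is_derive x v b db ->
  is_derive x v (fun y => inner (G y) (a y) (b y))
    (inner dG (a x) (b x) + inner (G x) da (b x) + inner (G x) (a x) db).
Proof.
move=> hG ha hb.
apply: is_derive_eq.
  exact: (is_derive_coord 0 0 (is_derive_mulmx (is_derive_mulmx ha hG)
                                               (is_derive_trmx hb))).
by rewrite /inner mulmxDl [LHS]mxE [X in X + _ = _]mxE [X in X + _ = _]addrC.
Qed.

End DeriveTools.

Lemma differentiable_mx (R : realType) (V : normedModType R) p q
    (M : V -> 'M[R]_(p, q)) x :
  (forall i j, differentiable (fun y => M y i j) x) -> differentiable M x.
Proof.
move=> h.
have -> : M = fun y => \sum_(i < p) \sum_(j < q) (M y i j *: delta_mx i j).
  by apply/funext => y; exact: matrix_sum_delta.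
rewrite (_ : (fun y => _) = \sum_(i < p) \sum_(j < q)
   ((fun y => M y i j *: delta_mx i j) : V -> 'M[R]_(p, q))); last first.
  apply/funext => y; rewrite fct_sumE; apply: eq_bigr => i _.
  by rewrite fct_sumE.
apply: differentiable_sum => i; apply: differentiable_sum => j.
exact: differentiableZl.
Qed.

(** Chain rule, with an inner function that is only known to be derivable in the
    given direction. *)
Lemma is_derive_chain (R : realType) (V U W : normedModType R) (f : U -> W)
    (X : V -> U) dX x v :
  differentiable f (X x) -> is_derive x v X dX ->
  is_derive x v (f \o X) (Dv dX f (X x)).
Proof.
rewrite DvE => df [dX' <-].
pose phi (t : R) := X (x + t *: v).
have p0 : phi 0 = X x by rewrite /phi scale0r addr0.
have pd : is_derive 0 (1 : R) phi ('D_v X x).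
  have := @line_derive R V U X x v 0; rewrite scale0r addr0; exact.
have [pd1 pd2] := pd.
have dphi : differentiable phi 0 by apply/derivable1_diffP.
have df0 : differentiable f (phi 0) by rewrite p0.
have dc : differentiable (f \o phi) 0 by exact: differentiable_comp.
have e : (fun h : R => h^-1 *: ((f \o X) (h *: v + x) - (f \o X) x)) =
         (fun h : R => h^-1 *: ((f \o phi) (h *: 1 + 0) - (f \o phi) 0)).
  by apply/funext => h /=; rewrite addr0 p0 /phi [h *: 1]mulr1 [x + _]addrC.
have : is_derive 0 (1 : R) (f \o phi) ('D_('D_v X x) f (X x)).
  apply: DeriveDef; first exact: diff_derivable.
  by rewrite deriveE // diff_comp //= deriveE -?p0 // -pd2 deriveE.
case=> d1 d2; apply: DeriveDef; first by move: d1; rewrite /derivable -e.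
by rewrite -d2 /derive -e.
Qed.

(** * The metric and its Christoffel symbols *)

Section Inner.
Variables (R : realType) (n : nat).
Implicit Types (M : 'M[R]_n) (u w z : 'rV[R]_n).

Lemma innerDl M u w z : inner M (u + w) z = inner M u z + inner M w z.
Proof. by rewrite /inner !mulmxDl mxE. Qed.

Lemma innerDr M u w z : inner M z (u + w) = inner M z u + inner M z w.
Proof. by rewrite /inner linearD mulmxDr mxE. Qed.

Lemma innerZl M a u z : inner M (a *: u) z = a * inner M u z.
Proof. by rewrite /inner -!scalemxAl mxE. Qed.

Lemma innerZr M a u z : inner M z (a *: u) = a * inner M z u.
Proof. by rewrite /inner linearZ -scalemxAr mxE. Qed.

Lemma innerDm M M' u w : inner (M + M') u w = inner M u w + inner M' u w.
Proof. by rewrite /inner mulmxDr mulmxDl mxE. Qed.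

Lemma innerZm M a u w : inner (a *: M) u w = a * inner M u w.
Proof. by rewrite /inner -scalemxAr -scalemxAl mxE. Qed.

Lemma inner0l M u : inner M 0 u = 0.
Proof. by rewrite /inner !mul0mx mxE. Qed.

Lemma inner0r M u : inner M u 0 = 0.
Proof. by rewrite /inner trmx0 mulmx0 mxE. Qed.

Lemma inner_basis M u c : inner M u (basis_vec R c) = (u *m M) 0 c.
Proof.
by rewrite /inner /basis_vec trmx_delta -colE mxE.
Qed.

Lemma inner_sumr M u z : inner M u z = \sum_c z 0 c * inner M u (basis_vec R c).
Proof.
rewrite [LHS]mxE; apply: eq_bigr => c _; rewrite inner_basis mulrC.
by congr (_ * _); rewrite mxE.
Qed.

Lemma inner_sym M u w : M^T = M -> inner M u w = inner M w u.
Proof.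
move=> Ms; rewrite /inner -[LHS]trace_mx11 -mxtrace_tr !trmx_mul trmxK Ms.
by rewrite mulmxA trace_mx11.
Qed.

(** Used to transfer to the Christoffel symbols and to gradients the properties of
    the forms that they represent. *)
Lemma inner_inj M u w : M \in unitmx ->
  (forall z, inner M u z = inner M w z) -> u = w.
Proof.
move=> Mu h; apply: (can_inj (mulmxK Mu)); apply/rowP => c.
by rewrite -!inner_basis h.
Qed.

Lemma inner_pos_unitmx M : (forall u, u != 0 -> 0 < inner M u u) -> M \in unitmx.
Proof.
move=> h; rewrite -row_free_unit -kermx_eq0; apply/eqP/row_matrixP => i.
rewrite row0; apply/eqP; apply: contraT => /h.
by rewrite /inner -row_mul mulmx_ker row0 mul0mx mxE ltxx.
Qed.

End Inner.

(** The Christoffel form, sealed for the same reason as [Dv]. *)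
Fact Gam_key (R : realType) (n : nat) (G : 'rV[R]_n -> 'M[R]_n) :
  {C : 'rV[R]_n -> 'rV[R]_n -> 'rV[R]_n -> 'rV[R]_n |
    forall x u w, C x u w = christoffel G x u w}.
Proof. by exists (christoffel G). Qed.

Definition Gam (R : realType) (n : nat) (G : 'rV[R]_n -> 'M[R]_n) :=
  sval (Gam_key G).

Lemma GamE (R : realType) (n : nat) (G : 'rV[R]_n -> 'M[R]_n) x u w :
  Gam G x u w = christoffel G x u w.
Proof. exact: (svalP (Gam_key G)). Qed.

Section Christoffel.
Variables (R : realType) (n : nat) (G : 'rV[R]_n -> 'M[R]_n).
Local Notation E := 'rV[R]_n.
Variable U : set E.
Hypothesis oU : open U.
Hypothesis Gsmooth : smooth_on U G.
Hypothesis Gsym : forall x, U x -> (G x)^T = G x.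
Hypothesis Gunit : forall x, U x -> G x \in unitmx.
Local Notation e_ := (basis_vec R (n := n)).
Local Notation Gam := (Gam G).
Local Notation dG x u := (Dv u G x).
Implicit Types (x u v w z : E).

Lemma metric_differentiable x : U x -> differentiable G x.
Proof.
move=> Ux; apply: differentiable_mx => i j.
exact: (smoothR_differentiable oU (smooth_coord oU i j Gsmooth)).
Qed.

Lemma metric_is_derive x u : U x -> is_derive x u G (dG x u).
Proof. by move=> Ux; apply/differentiable_Dv/metric_differentiable. Qed.

Lemma nbhs_dom x : U x -> \forall y \near x, U y.
Proof. by move=> Ux; exact: open_nbhs_nbhs. Qed.

Lemma dG_sym x u : U x -> (dG x u)^T = dG x u.
Proof.
move=> Ux; have h := is_derive_trmx (metric_is_derive u Ux).
apply: (is_derive_uniq _ (metric_is_derive u Ux)).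
by apply: is_derive_near h; apply: filterS (nbhs_dom Ux) => y Uy; rewrite Gsym.
Qed.

Lemma is_derive_inner_metric x u a b : U x ->
  is_derive x u (fun y => inner (G y) a b) (inner (dG x u) a b).
Proof.
move=> Ux; apply: is_derive_eq.
  exact: (is_derive_inner (metric_is_derive u Ux)
                          (is_derive_cst a x u) (is_derive_cst b x u)).
by rewrite inner0l inner0r !addr0.
Qed.

Lemma smooth_inner_metric a b : smoothR U (fun y => inner (G y) a b).
Proof.
apply: (smoothR_ext oU (f := fun y => \sum_j (\sum_i a 0 i * G y i j) * b 0 j)).
  move=> x Ux; rewrite [RHS]mxE; apply: eq_bigr => j _.
  by congr (_ * _); rewrite mxE.
apply: smoothR_sum => // j; apply: smoothRM => //; last exact: smoothR_cst.
apply: smoothR_sum => // i; apply: smoothRM => //; first exact: smoothR_cst.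
exact: smooth_coord.
Qed.

Definition koszul_form x u w z : R :=
  2^-1 * (inner (dG x u) w z + inner (dG x w) u z - inner (dG x z) u w).

(** The Koszul formula for fields with constant components. *)
Lemma koszul x u w z : U x -> inner (G x) (Gam x u w) z = koszul_form x u w z.
Proof.
move=> Ux; rewrite GamE /christoffel; set r := (\row_c _ : E).
have -> : inner (G x) (2^-1 *: r *m invmx (G x)) z = 2^-1 * \sum_c r 0 c * z 0 c.
  rewrite [inner _ _ _](_ : _ = ((2^-1 *: r) *m z^T) 0 0); last first.
    by rewrite /inner mulmxKV ?Gunit.
  rewrite -scalemxAl [in LHS]mxE; congr (_ * _); rewrite mxE.
  by apply: eq_bigr => c _; congr (_ * _); rewrite mxE.
have D a u' w' : 'D_a (fun y => inner (G y) u' w') x = inner (dG x a) u' w'.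
  by rewrite -DvxE; apply/is_derive_Dv/is_derive_inner_metric.
have dz : inner (dG x z) u w = \sum_c z 0 c * inner (dG x (e_ c)) u w.
  rewrite -D -DvxE (smoothR_Dv_sum oU _ (smooth_inner_metric u w) Ux).
  by apply: eq_bigr => c _; rewrite DvxE D.
congr (_ * _); rewrite dz 2!(inner_sumr _ _ z) -big_split -sumrB /=.
apply: eq_bigr => c _; rewrite mxE !D.
move: (inner _ w _) (inner _ u _) (inner _ u w) (z 0 c) => a b d e.
by ring.
Qed.

Lemma Gam_sym x u w : U x -> Gam x u w = Gam x w u.
Proof.
move=> Ux; apply: (inner_inj (Gunit Ux)) => z.
rewrite !koszul // /koszul_form (inner_sym u w (dG_sym z Ux)).
by rewrite [X in X - _]addrC.
Qed.

Lemma dG_lin x a u v : U x -> dG x (a *: u + v) = a *: dG x u + dG x v.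
Proof. by move=> Ux; apply/Dv_lin/metric_differentiable. Qed.

Lemma Gam_linl x a u v w : U x ->
  Gam x (a *: u + v) w = a *: Gam x u w + Gam x v w.
Proof.
move=> Ux; apply: (inner_inj (Gunit Ux)) => z.
rewrite innerDl innerZl !koszul // /koszul_form dG_lin //.
rewrite innerDm innerZm !innerDl !innerZl.
move: (inner _ w z) (inner _ w z) (inner _ u z) (inner _ v z) (inner _ u w) (inner _ v w).
by move=> *; ring.
Qed.

Lemma Gam_linr x a u v w : U x ->
  Gam x w (a *: u + v) = a *: Gam x w u + Gam x w v.
Proof. by move=> Ux; rewrite Gam_sym // Gam_linl // ![Gam x _ w]Gam_sym. Qed.

Lemma GamDl x u v w : U x -> Gam x (u + v) w = Gam x u w + Gam x v w.
Proof. by move=> Ux; rewrite -[u]scale1r Gam_linl // !scale1r. Qed.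
Lemma GamDr x u v w : U x -> Gam x w (u + v) = Gam x w u + Gam x w v.
Proof. by move=> Ux; rewrite -[u]scale1r Gam_linr // !scale1r. Qed.
Lemma Gam0l x w : U x -> Gam x 0 w = 0.
Proof. by move=> Ux; apply: (addIr (Gam x 0 w)); rewrite -GamDl // !add0r. Qed.
Lemma Gam0r x w : U x -> Gam x w 0 = 0.
Proof. by move=> Ux; rewrite Gam_sym // Gam0l. Qed.
Lemma GamZl x a u w : U x -> Gam x (a *: u) w = a *: Gam x u w.
Proof. by move=> Ux; rewrite -[a *: u]addr0 Gam_linl // Gam0l // addr0. Qed.
Lemma GamZr x a u w : U x -> Gam x w (a *: u) = a *: Gam x w u.
Proof. by move=> Ux; rewrite Gam_sym // GamZl // Gam_sym. Qed.
Lemma GamBr x u v w : U x -> Gam x w (u - v) = Gam x w u - Gam x w v.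
Proof. by move=> Ux; rewrite -scaleN1r addrC Gam_linr // scaleN1r addrC. Qed.

(** In the sum of the two Koszul forms, all the derivatives of the metric but one
    cancel. *)
Lemma metric_compat_Gam x u a b : U x ->
  inner (dG x u) a b = inner (G x) (Gam x u a) b + inner (G x) a (Gam x u b).
Proof.
move=> Ux; rewrite (inner_sym a (Gam x u b) (Gsym Ux)) !koszul // /koszul_form.
rewrite (inner_sym b a (dG_sym u Ux)).
move: (inner _ a b) (inner _ u b) (inner _ u a) => p q r; by field.
Qed.

Lemma smooth_Gam u w l : smoothR U (fun x => Gam x u w 0 l).
Proof.
pose r c x : R := 2^-1 * (Dv u (fun y => inner (G y) w (e_ c)) x
    + Dv w (fun y => inner (G y) u (e_ c)) x
    - Dv (e_ c) (fun y => inner (G y) u w) x).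
apply: (smoothR_ext oU (f := fun x => \sum_c r c x * invmx (G x) c l)).
  move=> x _; rewrite GamE [RHS]mxE; apply: eq_bigr => c _.
  by rewrite /r !DvxE; congr (_ * _); rewrite !mxE.
apply: smoothR_sum => // c; apply: smoothRM => //; last first.
  by apply: smoothR_invmx => // i j; exact: smooth_coord.
apply: smoothRM => //; first exact: smoothR_cst.
have D a b c' : smoothR U (Dv a (fun y => inner (G y) b c')).
  by apply: smoothR_Dv => //; exact: smooth_inner_metric.
apply: smoothRD => //; first exact: smoothRD.
apply: (smoothR_ext oU (f := fun x => -1 * Dv (e_ c) (fun y => inner (G y) u w) x)).
  by move=> x _; rewrite mulN1r.
by apply: smoothRM => //; exact: smoothR_cst.
Qed.

End Christoffel.

(** * Curvature *)

Lemma lin_expand (R : realType) n p (f : 'rV[R]_n -> 'rV[R]_p) u :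
  (forall a u v, f (a *: u + v) = a *: f u + f v) ->
  f u = \sum_a u 0 a *: f (basis_vec R a).
Proof.
move=> fl; pose F : {linear 'rV[R]_n -> 'rV[R]_p} :=
  HB.pack f (GRing.isLinear.Build _ _ _ _ f fl).
rewrite -[f]/(F : _ -> _) {1}(row_sum_delta u) linear_sum.
by apply: eq_bigr => a _; rewrite linearZ.
Qed.

Lemma mul_lin1_mx (R : realType) n p (f : 'rV[R]_n -> 'rV[R]_p) u :
  (forall a u v, f (a *: u + v) = a *: f u + f v) -> u *m lin1_mx f = f u.
Proof.
move=> fl; pose F : {linear 'rV[R]_n -> 'rV[R]_p} :=
  HB.pack f (GRing.isLinear.Build _ _ _ _ f fl).
exact: (mul_rV_lin1 F).
Qed.

Section Curvature.
Variables (R : realType) (n : nat) (G : 'rV[R]_n -> 'M[R]_n).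
Local Notation E := 'rV[R]_n.
Variable U : set E.
Hypothesis oU : open U.
Hypothesis Gsmooth : smooth_on U G.
Hypothesis Gsym : forall x, U x -> (G x)^T = G x.
Hypothesis Gunit : forall x, U x -> G x \in unitmx.
Local Notation e_ := (basis_vec R (n := n)).
Local Notation Gam := (Gam G).
Implicit Types (x u v w z : E).

Let linl := Gam_linl oU Gsmooth Gunit.
Let linr := Gam_linr oU Gsmooth Gsym Gunit.

Lemma Gam_expand x u w l : U x ->
  Gam x u w 0 l = \sum_a \sum_b u 0 a * w 0 b * Gam x (e_ a) (e_ b) 0 l.
Proof.
move=> Ux; rewrite (@lin_expand _ _ _ (fun u => Gam x u w)); last first.
  by move=> c u' v'; exact: linl.
rewrite summxE; apply: eq_bigr => a _.
rewrite mxE (@lin_expand _ _ _ (Gam x (e_ a)) w); last first.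
  by move=> c u' v'; exact: linr.
by rewrite summxE mulr_sumr; apply: eq_bigr => b _; rewrite mxE mulrA.
Qed.

Lemma Gam_differentiable x u w : U x -> differentiable (fun y => Gam y u w) x.
Proof.
move=> Ux; apply: differentiable_mx => i l; rewrite ord1.
exact: (smoothR_differentiable oU (smooth_Gam oU Gsmooth Gunit u w l) Ux).
Qed.

Definition dGam x z u w : E := Dv z (fun y => Gam y u w) x.

Lemma dGam_is_derive x z u w : U x ->
  is_derive x z (fun y => Gam y u w) (dGam x z u w).
Proof. by move=> Ux; apply/differentiable_Dv/Gam_differentiable. Qed.

Section ProductRule.
Variables (V : normedModType R) (X p q : V -> E) (dX dp dq : E) (s h : V).
Hypothesis UX : \forall r \near s, U (X r).
Hypothesis hX : is_derive s h X dX.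

Let gam a b l y := Gam y (e_ a) (e_ b) 0 l.

Let chain_gam a b l : is_derive s h (gam a b l \o X) (Dv dX (gam a b l) (X s)).
Proof.
apply: is_derive_chain => //.
exact: (smoothR_differentiable oU (smooth_Gam oU Gsmooth Gunit _ _ l)
   (nbhs_singleton UX)).
Qed.

Let chain_Gam u w : is_derive s h (fun r => Gam (X r) u w) (dGam (X s) dX u w).
Proof.
exact: (is_derive_chain (Gam_differentiable u w (nbhs_singleton UX)) hX).
Qed.

(** [Gam] is bilinear in its last two arguments, hence a finite sum of products of
    coordinates with coefficients depending on the point. *)
Lemma is_derive_Gam : is_derive s h p dp -> is_derive s h q dq ->
  is_derive s h (fun r => Gam (X r) (p r) (q r))
    (dGam (X s) dX (p s) (q s) + Gam (X s) dp (q s) + Gam (X s) (p s) dq).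
Proof.
move=> hp hq; have Us := nbhs_singleton UX.
apply: is_derive_mx => i l; rewrite ord1.
have D (u w : V -> E) du dw : is_derive s h u du -> is_derive s h w dw ->
    is_derive s h (fun r => Gam (X r) (u r) (w r) 0 l)
     (\sum_a \sum_b ((du 0 a * w s 0 b + u s 0 a * dw 0 b) * gam a b l (X s)
        + (u s 0 a * w s 0 b) * Dv dX (gam a b l) (X s))).
  move=> hu hw.
  apply: (@is_derive_near _ _ _ (fun r => \sum_a \sum_b u r 0 a * w r 0 b * gam a b l (X r))).
    by apply: filterS UX => r Ur; rewrite Gam_expand.
  do 2! apply: is_derive_sumr => ?.
  apply: is_derive_mulr; last exact: chain_gam.
  by apply: is_derive_mulr; exact: is_derive_coord.
have dE : dGam (X s) dX (p s) (q s) 0 l =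
    \sum_a \sum_b (p s 0 a * q s 0 b) * Dv dX (gam a b l) (X s).
  apply: (is_derive_uniq (is_derive_coord 0 l (chain_Gam (p s) (q s)))).
  have Dc := D (fun=> p s) (fun=> q s) 0 0 (is_derive_cst (p s) s h) (is_derive_cst (q s) s h).
  apply: (is_derive_eq Dc).
  apply: eq_bigr => a _; apply: eq_bigr => b _.
  by rewrite mxE mxE mul0r mulr0 addr0 mul0r add0r.
apply: (is_derive_eq (D _ _ _ _ hp hq)).
rewrite 2!mxE dE !(Gam_expand _ _ _ Us) -!big_split /=.
apply: eq_bigr => a _; rewrite -!big_split /=; apply: eq_bigr => b _.
rewrite /gam; move: (Dv _ _ _) (Gam _ _ _ _ _) => d g; ring.
Qed.

End ProductRule.

Lemma dGam_linr x z a u v w : U x ->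
  dGam x z w (a *: u + v) = a *: dGam x z w u + dGam x z w v.
Proof.
move=> Ux; apply: (is_derive_uniq (dGam_is_derive z w (a *: u + v) Ux)).
apply: (@is_derive_near _ _ _ (fun y => a *: Gam y w u + Gam y w v)).
  by apply: filterS (nbhs_dom oU Ux) => y Uy; rewrite linr.
exact: (is_deriveD (is_deriveZ a (dGam_is_derive z w u Ux)) (dGam_is_derive z w v Ux)).
Qed.

Lemma dGam_linm x z a u v w : U x ->
  dGam x z (a *: u + v) w = a *: dGam x z u w + dGam x z v w.
Proof.
move=> Ux; apply: (is_derive_uniq (dGam_is_derive z (a *: u + v) w Ux)).
apply: (@is_derive_near _ _ _ (fun y => a *: Gam y u w + Gam y v w)).
  by apply: filterS (nbhs_dom oU Ux) => y Uy; rewrite linl.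
exact: (is_deriveD (is_deriveZ a (dGam_is_derive z u w Ux)) (dGam_is_derive z v w Ux)).
Qed.

Lemma dGam_linl x a u v w z : U x ->
  dGam x (a *: u + v) w z = a *: dGam x u w z + dGam x v w z.
Proof. by move=> Ux; apply/Dv_lin/Gam_differentiable. Qed.

(** The curvature tensor: the expression of [R(u, v)w] in which fields with constant
    components have been substituted. *)
Definition Riem x u v w : E :=
  dGam x u v w - dGam x v u w + Gam x u (Gam x v w) - Gam x v (Gam x u w).

Lemma nabla_constl u (Z : E -> E) x :
  nabla G (fun=> u) Z x = Dv u Z x + Gam x u (Z x).
Proof. by rewrite /nabla DvxE GamE. Qed.

(* Fields with constant components commute. *)
Lemma curvature_atE x u v w : U x -> curvature_at G x u v w = Riem x u v w.
Proof.
move=> Ux; have N a b : nabla G (fun=> a) (fun=> b) = fun y => Gam y a b.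
  apply/funext => y; rewrite nabla_constl.
  by rewrite (is_derive_Dv (is_derive_cst b y a)) add0r.
have br : lie_bracket (fun=> u) (fun=> v) = fun=> (0 : E).
  by apply/funext => y; rewrite /lie_bracket !derive_cst subrr.
rewrite /curvature_at /curvature br !N (Gam0l oU Gsmooth Gunit) // !nabla_constl.
rewrite /Riem /dGam.
move: (Dv u _ x) (Dv v _ x) (Gam x u _) (Gam x v _) => a b c d.
by apply/rowP => l; rewrite !mxE; ring.
Qed.

Lemma Riem_antisym x u v w : Riem x u v w = - Riem x v u w.
Proof.
rewrite /Riem; move: (dGam _ _ _ _) (dGam _ _ _ _) (Gam _ _ _) (Gam _ _ _).
move=> a b c d.
by rewrite !opprD !opprK [- a + b]addrC -!addrA; congr (_ + (_ + _)); rewrite addrC.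
Qed.

Lemma Riem_linl x a u u' v w : U x ->
  Riem x (a *: u + u') v w = a *: Riem x u v w + Riem x u' v w.
Proof.
move=> Ux; rewrite /Riem dGam_linl // dGam_linm // !linl // linr //.
move: (dGam x u v w) (dGam x u' v w) (dGam x v u w) (dGam x v u' w).
move: (Gam x u _) (Gam x u' _) (Gam x v (Gam x u w)) (Gam x v (Gam x u' w)).
by move=> *; apply/rowP => l; rewrite !mxE; ring.
Qed.

Lemma Riem_linm x a u v v' w : U x ->
  Riem x u (a *: v + v') w = a *: Riem x u v w + Riem x u v' w.
Proof.
move=> Ux; rewrite Riem_antisym Riem_linl // opprD -scalerN.
by rewrite -!(Riem_antisym x u).
Qed.

Lemma Riem_linr x a u v w w' : U x ->
  Riem x u v (a *: w + w') = a *: Riem x u v w + Riem x u v w'.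
Proof.
move=> Ux; rewrite /Riem !dGam_linr // !linr //.
move: (dGam x u v w) (dGam x u v w') (dGam x v u w) (dGam x v u w').
move: (Gam x u (Gam x v w)) (Gam x u (Gam x v w')) (Gam x v (Gam x u w)) (Gam x v (Gam x u w')).
by move=> *; apply/rowP => l; rewrite !mxE; ring.
Qed.

Lemma jacobi_opE x v w : U x -> w *m jacobi_op G x v = Riem x w v v.
Proof.
move=> Ux; rewrite /jacobi_op (@mul_lin1_mx _ _ _ (fun w => curvature_at G x w v v)).
  exact: curvature_atE.
by move=> a u u'; rewrite !curvature_atE // Riem_linl.
Qed.

Lemma jacobi_op_entry x v a l : U x -> jacobi_op G x v a l = Riem x (e_ a) v v 0 l.
Proof. by move=> Ux; rewrite -jacobi_opE // /basis_vec -rowE [RHS]mxE. Qed.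

Lemma jacobi_op_expand x v a l : U x ->
  jacobi_op G x v a l =
  \sum_b \sum_c v 0 b * v 0 c * Riem x (e_ a) (e_ b) (e_ c) 0 l.
Proof.
move=> Ux; rewrite jacobi_op_entry //.
rewrite (@lin_expand _ _ _ (fun u => Riem x (e_ a) u v) v); last first.
  by move=> c u' v'; exact: Riem_linm.
rewrite summxE; apply: eq_bigr => b _.
rewrite mxE (@lin_expand _ _ _ (Riem x (e_ a) (e_ b)) v); last first.
  by move=> c u' v'; exact: Riem_linr.
by rewrite summxE mulr_sumr; apply: eq_bigr => c _; rewrite mxE mulrA.
Qed.

Lemma smooth_Riem u v w l : smoothR U (fun x => Riem x u v w 0 l).
Proof.
have sG := smooth_Gam oU Gsmooth Gunit.
have sD z a b : smoothR U (fun x => dGam x z a b 0 l).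
  apply: (smoothR_ext oU (f := Dv z (fun y => Gam y a b 0 l))).
    move=> x Ux; apply: is_derive_Dv; apply: is_derive_coord.
    exact: dGam_is_derive.
  exact: smoothR_Dv.
have sGG a b c : smoothR U (fun x => Gam x a (Gam x b c) 0 l).
  apply: (smoothR_ext oU (f := fun x => \sum_d Gam x b c 0 d * Gam x a (e_ d) 0 l)).
    move=> x Ux; rewrite (@lin_expand _ _ _ (Gam x a) (Gam x b c)); last first.
      by move=> k u' v'; exact: linr.
    by rewrite summxE; apply: eq_bigr => d _; rewrite mxE.
  by apply: smoothR_sum => // d; apply: smoothRM.
have sN f : smoothR U f -> smoothR U (fun x => -1 * f x).
  by move=> sf; apply: smoothRM => //; exact: smoothR_cst.
apply: (smoothR_ext oU (f := fun x => dGam x u v w 0 l + -1 * dGam x v u w 0 l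
  + Gam x u (Gam x v w) 0 l + -1 * Gam x v (Gam x u w) 0 l)).
  by move=> x _; rewrite !mulN1r /Riem !mxE.
by do ! apply: smoothRD => //; apply: sN.
Qed.

Definition jacobi_op_deriv x v (dx dv : E) : 'M[R]_n :=
  \matrix_(a, l) \sum_b \sum_c ((dv 0 b * v 0 c + v 0 b * dv 0 c) *
      Riem x (e_ a) (e_ b) (e_ c) 0 l +
    v 0 b * v 0 c * Dv dx (fun y => Riem y (e_ a) (e_ b) (e_ c) 0 l) x).

(** Along a curve of tangent vectors, the derivative of the Jacobi operator
    depends only on the first-order data of the curve. *)
Lemma is_derive_jacobi_op (c v : R -> E) t dc dv : U (c t) ->
  is_derive t 1 c dc -> is_derive t 1 v dv ->
  is_derive t 1 (fun s => jacobi_op G (c s) (v s)) (jacobi_op_deriv (c t) (v t) dc dv).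
Proof.
move=> Ut hc hv; apply: is_derive_mx => a l; rewrite mxE.
apply: (@is_derive_near _ _ _ (fun r => \sum_b \sum_d v r 0 b * v r 0 d *
   Riem (c r) (e_ a) (e_ b) (e_ d) 0 l)).
  have cc : {for t, continuous c}.
    by apply/differentiable_continuous/derivable1_diffP; case: hc.
  have Uc : \forall r \near t, U (c r) by exact: (cc _ (nbhs_dom oU Ut)).
  apply: filterS Uc => r Ur /=.
  by rewrite jacobi_op_expand.
do 2! apply: is_derive_sumr => ?.
apply: is_derive_mulr; last first.
  apply: (is_derive_chain (f := fun y => Riem y _ _ _ 0 l)) => //.
  exact: (smoothR_differentiable oU (smooth_Riem _ _ _ l)).
by apply: is_derive_mulr; exact: is_derive_coord.
Qed.

End Curvature.

(** * Gradient fields and the Riccati equation *)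

Section SmoothFields.
Variables (R : realType) (n : nat).
Local Notation E := 'rV[R]_n.
Local Notation e_ := (basis_vec R (n := n)).
Variable W : set E.
Hypothesis oW : open W.
Variables (p q : nat) (P : E -> 'M[R]_(p, q)).
Hypothesis sP : forall i j, smoothR W (fun x => P x i j).

Lemma smoothM_differentiable x : W x -> differentiable P x.
Proof.
by move=> Wx; apply: differentiable_mx => i j; exact: (smoothR_differentiable oW (sP i j)).
Qed.

Lemma smoothM_is_derive x u : W x -> is_derive x u P (Dv u P x).
Proof. by move=> Wx; apply/differentiable_Dv/smoothM_differentiable. Qed.

Lemma smoothM_Dv_coord x u i j : W x -> Dv u P x i j = Dv u (fun y => P y i j) x.
Proof.
move=> Wx; apply/esym/is_derive_Dv; apply: is_derive_coord.
exact: smoothM_is_derive.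
Qed.

Lemma smoothM_Dv u i j : smoothR W (fun x => Dv u P x i j).
Proof.
apply: (smoothR_ext oW (f := Dv u (fun y => P y i j))).
  by move=> x Wx; rewrite smoothM_Dv_coord.
exact: smoothR_Dv.
Qed.

End SmoothFields.

Lemma smoothM_Dv_comm (R : realType) n (W : set 'rV[R]_n) p q
    (P : 'rV[R]_n -> 'M[R]_(p, q)) x u w :
  open W -> (forall i j, smoothR W (fun x => P x i j)) -> W x ->
  Dv w (Dv u P) x = Dv u (Dv w P) x.
Proof.
move=> oW sP Wx; apply/matrixP => i j.
have D a : forall i j, smoothR W (fun x => Dv a P x i j) by exact: smoothM_Dv.
rewrite (smoothM_Dv_coord oW (D u)) // (smoothM_Dv_coord oW (D w)) //.
have N a b : Dv a (fun y => Dv b P y i j) x = Dv a (Dv b (fun y => P y i j)) x.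
  apply/is_derive_Dv; apply: (is_derive_near _ (smoothR_is_derive oW a
    (smoothR_Dv oW b (sP i j)) Wx)).
  by apply: filterS (nbhs_dom oW Wx) => y Wy; rewrite (smoothM_Dv_coord oW sP).
by rewrite !N; exact: (smoothR_Dv_comm oW).
Qed.

Section GradientField.
Variables (R : realType) (n : nat) (G : 'rV[R]_n -> 'M[R]_n).
Local Notation E := 'rV[R]_n.
Variable U : set E.
Hypothesis oU : open U.
Hypothesis Gsmooth : smooth_on U G.
Hypothesis Gsym : forall x, U x -> (G x)^T = G x.
Hypothesis Gunit : forall x, U x -> G x \in unitmx.
Variable phi : E -> R.
Hypothesis sphi : smoothR U phi.
Local Notation e_ := (basis_vec R (n := n)).
Local Notation Gam := (Gam G).
Implicit Types (x u v w z : E).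

Let linl := Gam_linl oU Gsmooth Gunit.
Let linr := Gam_linr oU Gsmooth Gsym Gunit.

Definition grad x : E := (\row_l Dv (e_ l) phi x) *m invmx (G x).

Lemma inner_grad x u : U x -> inner (G x) (grad x) u = Dv u phi x.
Proof.
move=> Ux; rewrite (smoothR_Dv_sum oU _ sphi Ux) /inner /grad mulmxKV ?Gunit //.
by rewrite mxE; apply: eq_bigr => l _; rewrite mulrC !mxE.
Qed.

Lemma smooth_grad i l : smoothR U (fun x => grad x i l).
Proof.
rewrite ord1.
apply: (smoothR_ext oU (f := fun x => \sum_c Dv (e_ c) phi x * invmx (G x) c l)).
  by move=> x _; rewrite [RHS]mxE; apply: eq_bigr => c _; congr (_ * _); rewrite mxE.
apply: smoothR_sum => // c; apply: smoothRM => //; first exact: smoothR_Dv.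
by apply: smoothR_invmx => // a b; exact: smooth_coord.
Qed.

Let gdiff := smoothM_is_derive oU smooth_grad.

(** The covariant derivative of [grad] in the direction [u]; the associated operator
    [hess_op] is the Hessian of [phi]. *)
Definition nabla_grad x u : E := Dv u grad x + Gam x u (grad x).

Definition hess_op x : 'M[R]_n := lin1_mx (nabla_grad x).

Lemma nabla_grad_lin x a u v : U x ->
  nabla_grad x (a *: u + v) = a *: nabla_grad x u + nabla_grad x v.
Proof.
move=> Ux; rewrite /nabla_grad linl // (Dv_lin _ _ _ (smoothM_differentiable oU smooth_grad Ux)).
by rewrite scalerDr addrACA.
Qed.

Lemma hess_opE x u : U x -> u *m hess_op x = nabla_grad x u.
Proof. by move=> Ux; apply: mul_lin1_mx => a v w; exact: nabla_grad_lin. Qed.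

(** The covariant Hessian is symmetric because second partial derivatives
    commute and the connection is torsion-free. *)
Lemma nabla_grad_sym x u w : U x ->
  inner (G x) (nabla_grad x u) w = inner (G x) (nabla_grad x w) u.
Proof.
move=> Ux.
have D a b : inner (G x) (nabla_grad x a) b =
    Dv a (Dv b phi) x - inner (G x) (grad x) (Gam x a b).
  have -> : Dv a (Dv b phi) x = inner (Dv a G x) (grad x) b + inner (G x) (Dv a grad x) b.
    apply: is_derive_Dv.
    apply: (@is_derive_near _ _ _ (fun y => inner (G y) (grad y) b)).
      by apply: filterS (nbhs_dom oU Ux) => y Uy; rewrite inner_grad.
    apply: is_derive_eq.
      exact: (is_derive_inner (metric_is_derive oU Gsmooth a Ux) (gdiff a Ux)
              (is_derive_cst b x a)).
    by rewrite inner0r addr0.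
  rewrite (metric_compat_Gam oU Gsmooth Gsym Gunit) // /nabla_grad innerDl.
  by rewrite addrAC addrK addrC.
by rewrite !D (smoothR_Dv_comm oU u w sphi) // (Gam_sym oU Gsmooth Gsym Gunit u w).
Qed.

Lemma hess_op_selfadjoint x : U x -> hess_op x *m G x = G x *m (hess_op x)^T.
Proof.
move=> Ux; apply/matrixP => i j.
have := nabla_grad_sym (e_ i) (e_ j) Ux; rewrite -!hess_opE //.
rewrite (inner_sym _ (e_ i) (Gsym Ux)) /inner trmx_mul.
rewrite /basis_vec !trmx_delta !mulmxA -!colE -![delta_mx 0 i *m _]rowE.
rewrite -!row_mul ![col j _ 0 0]mxE ![row i _ 0 j]mxE.
exact.
Qed.

(* The field [P = grad], as the position field of a Euclidean space, satisfies
   [nabla_P P = P]. *)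
Hypothesis geo : forall x, U x ->
  Dv (grad x) grad x + Gam x (grad x) (grad x) = grad x.

Lemma nabla_grad_grad x : U x -> nabla_grad x (grad x) = grad x.
Proof. exact: geo. Qed.

Let id_dom x : U x -> \forall y \near x, U (id y).
Proof. exact: nbhs_dom. Qed.

Let Ddiff u := smoothM_is_derive oU (smoothM_Dv oU smooth_grad u).

Lemma nabla_grad_is_derive x z u : U x ->
  is_derive x z (fun y => nabla_grad y u)
    (Dv z (Dv u grad) x + dGam G x z u (grad x) + Gam x u (Dv z grad x)).
Proof.
move=> Ux.
have h := is_derive_Gam oU Gsmooth Gsym Gunit (id_dom Ux) (is_derive_id x z)
  (is_derive_cst u x z) (gdiff z Ux).
have := is_deriveD (Ddiff u z Ux) h.
rewrite (Gam0l oU Gsmooth Gunit) // addr0 addrA; exact.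
Qed.

(** Differentiating [nabla_P P = P] in the direction [u] and commuting
    derivatives produces the curvature term. *)
Lemma riccati_pointwise x u : U x -> let p := grad x in
  Dv p (fun y => nabla_grad y u) x =
  nabla_grad x u - nabla_grad x (nabla_grad x u) - Riem G x u p p
  + nabla_grad x (Gam x p u) - Gam x p (nabla_grad x u).
Proof.
move=> Ux p.
rewrite (is_derive_Dv (nabla_grad_is_derive p u Ux)) -/p.
have dir q y : U y -> Dv q grad y = \sum_a q 0 a *: Dv (e_ a) grad y.
  move=> Uy; rewrite (@lin_expand _ _ _ (fun q => Dv q grad y)) // => c v w.
  by rewrite (Dv_lin _ _ _ (smoothM_differentiable oU smooth_grad Uy)).
have h1 : is_derive x u (fun y => Dv (grad y) grad y)
    (Dv (Dv u grad x) grad x + Dv u (Dv p grad) x).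
  apply: (@is_derive_near _ _ _ (fun y => \sum_a grad y 0 a *: Dv (e_ a) grad y)).
    by apply: filterS (nbhs_dom oU Ux) => y Uy; rewrite dir.
  apply: is_derive_eq.
    apply: is_derive_sumr => a; apply: is_derive_scalemx.
      by apply: is_derive_coord; exact: gdiff.
    exact: Ddiff.
  rewrite big_split /= -dir //; congr (_ + _).
  apply/esym/is_derive_Dv.
  apply: (@is_derive_near _ _ _ (fun y => \sum_a p 0 a *: Dv (e_ a) grad y)).
    by apply: filterS (nbhs_dom oU Ux) => y Uy; rewrite dir.
  by apply: is_derive_sumr => a; apply: is_deriveZ; exact: Ddiff.
have h2 := is_derive_Gam oU Gsmooth Gsym Gunit (id_dom Ux) (is_derive_id x u)
  (gdiff u Ux) (gdiff u Ux).
have h3 := is_deriveD h1 h2.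
have near_geo : \forall y \near x, ((fun y => Dv (grad y) grad y) +
    (fun y => Gam (id y) (grad y) (grad y))) y = grad y.
  by apply: filterS (nbhs_dom oU Ux) => y; exact: geo.
have := is_derive_uniq (gdiff u Ux) (is_derive_near near_geo h3).
have -> : nabla_grad x (nabla_grad x u) =
    nabla_grad x (Dv u grad x) + nabla_grad x (Gam x p u).
  have := nabla_grad_lin 1 (Dv u grad x) (Gam x p u) Ux; rewrite !scale1r => <-.
  by rewrite (Gam_sym oU Gsmooth Gsym Gunit p).
have -> : Dv p grad x = p - Gam x p p by apply/eqP; rewrite eq_sym subr_eq (geo Ux).
rewrite (smoothM_Dv_comm p u oU smooth_grad Ux) /nabla_grad /Riem -/p.
rewrite (GamBr oU Gsmooth Gsym Gunit) // (GamDr oU Gsmooth Gsym Gunit) //.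
rewrite (Gam_sym oU Gsmooth Gsym Gunit p u) //.
move: (Dv p _ x) (dGam G x u p p) (dGam G x p u p) (Gam x u (Gam x p p)).
move: (Gam x p (Gam x u p)) (Dv (Gam x u p) _ _) (Gam x (Gam x u p) p).
move: (Dv (Dv u grad x) grad x) (Gam x (Dv u grad x) p) (Gam x p (Dv u grad x)).
move: (Dv u grad x) (Gam x u p) => d g b c e f h i j k l m /=.
by move=> ->; apply/rowP => a; rewrite !mxE; ring.
Qed.

Lemma hess_op_entry x i l : hess_op x i l = nabla_grad x (e_ i) 0 l.
Proof. by rewrite mxE. Qed.

Lemma smooth_hess_op i l : smoothR U (fun x => hess_op x i l).
Proof.
apply: (smoothR_ext oU (f := fun x => Dv (e_ i) grad x 0 l +
    \sum_d grad x 0 d * Gam x (e_ i) (e_ d) 0 l)).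
  move=> x Ux; rewrite hess_op_entry [RHS]mxE; congr (_ + _).
  rewrite [in RHS](@lin_expand _ _ _ (Gam x (e_ i)) (grad x)) => [|a v w].
    by rewrite summxE; apply: eq_bigr => d _; rewrite [RHS]mxE.
  exact: linr.
apply: smoothRD => //; first exact: (smoothM_Dv oU smooth_grad).
apply: smoothR_sum => // d; apply: smoothRM => //; first exact: smooth_grad.
exact: (smooth_Gam oU Gsmooth Gunit).
Qed.

(** The products with [lin1_mx (Gam x (grad x))] are the difference between the
    ordinary and the covariant derivative of [hess_op] in the direction of the
    gradient. *)
Lemma riccati_mx x : U x ->
  Dv (grad x) hess_op x = hess_op x - hess_op x *m hess_op x
    - jacobi_op G x (grad x)
    + lin1_mx (Gam x (grad x)) *m hess_op x
    - hess_op x *m lin1_mx (Gam x (grad x)).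
Proof.
move=> Ux; set p := grad x.
have GM w : w *m lin1_mx (Gam x p) = Gam x p w.
  by rewrite mul_lin1_mx // => a v z; exact: linr.
have row_eq (B C : 'M[R]_n) : (forall i, e_ i *m B = e_ i *m C) -> B = C.
  by move=> h; apply/row_matrixP => i; rewrite !rowE; exact: h.
apply: row_eq => i; rewrite !(mulmxDr, mulmxN) !mulmxA !hess_opE //.
rewrite (jacobi_opE oU Gsmooth Gsym Gunit) // !GM.
have := riccati_pointwise (e_ i) Ux; rewrite /= -/p => <-.
have D := nabla_grad_is_derive p (e_ i) Ux.
apply/rowP => l; rewrite -rowE mxE (is_derive_Dv D).
apply: (is_derive_uniq (is_derive_coord i l (smoothM_is_derive oU smooth_hess_op p Ux))).
apply: is_derive_near (is_derive_coord 0 l D).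
by apply: filterS (nbhs_dom oU Ux) => y Uy; rewrite hess_op_entry.
Qed.

Lemma hess_op_differentiable x : U x -> differentiable hess_op x.
Proof. exact: smoothM_differentiable smooth_hess_op x. Qed.

Lemma jacobi_opZ x a v : U x -> jacobi_op G x (a *: v) = a ^+ 2 *: jacobi_op G x v.
Proof.
move=> Ux.
have z1 w y : Riem G x w y 0 = 0.
  have := Riem_linr oU Gsmooth Gsym Gunit 1 w y 0 0 Ux.
  rewrite !scale1r addr0 => h; apply: (addIr (Riem G x w y 0)).
  by rewrite add0r -h.
have z2 w y : Riem G x w 0 y = 0.
  have := Riem_linm oU Gsmooth Gsym Gunit 1 w 0 0 y Ux.
  rewrite !scale1r addr0 => h; apply: (addIr (Riem G x w 0 y)).
  by rewrite add0r -h.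
have JE w y : w *m jacobi_op G x y = Riem G x w y y.
  exact: (jacobi_opE oU Gsmooth Gsym Gunit).
have RZ w : Riem G x w (a *: v) (a *: v) = a ^+ 2 *: Riem G x w v v.
  rewrite -[a *: v]addr0 (Riem_linm oU Gsmooth Gsym Gunit) //.
  rewrite (Riem_linr oU Gsmooth Gsym Gunit) // (Riem_linr oU Gsmooth Gsym Gunit) //.
  by rewrite !z1 !z2 scaler0 !addr0 scalerA.
apply/row_matrixP => i; rewrite !rowE; apply: etrans (JE _ _) _.
rewrite RZ; apply/esym; apply: etrans; first by rewrite -scalemxAr; reflexivity.
by congr (_ *: _); exact: JE.
Qed.

Lemma lin1_GamZ x a v : U x -> lin1_mx (Gam x (a *: v)) = a *: lin1_mx (Gam x v).
Proof.
move=> Ux; apply/matrixP => i l; rewrite !mxE.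
by rewrite (GamZl oU Gsmooth Gunit) // mxE.
Qed.

(** Along an integral curve of [P / t], with [X] the operator [nabla P - 1]. *)
Lemma riccati_curve (c : R -> E) t v : U (c t) -> is_derive t 1 c v ->
  t *: v = grad (c t) ->
  let X s := hess_op (c s) - 1%:M in let C := lin1_mx (Gam (c t) v) in
  exists2 X', is_derive t 1 X X' &
    t *: X' = - X t - X t *m X t - t ^+ 2 *: jacobi_op G (c t) v
              + t *: (C *m X t - X t *m C).
Proof.
move=> Ut hc tv X C; exists (Dv v hess_op (c t)).
  have h := is_derive_chain (hess_op_differentiable Ut) hc.
  have := is_deriveB h (is_derive_cst (1%:M : 'M[R]_n) t 1); rewrite subr0; exact.
have -> : t *: Dv v hess_op (c t) = Dv (grad (c t)) hess_op (c t).
  rewrite -tv -[t *: v]addr0 (Dv_lin _ _ _ (hess_op_differentiable Ut)).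
  by rewrite Dv0 addr0.
rewrite riccati_mx // -tv jacobi_opZ // lin1_GamZ // -/C /X.
rewrite !mulmxBl !mulmxBr !mul1mx !mulmx1 -!scalemxAl -!scalemxAr scalerBr.
set J := jacobi_op _ _ _; set A := hess_op _; set I := 1%:M.
move: (A *m A) (C *m A) (A *m C) => AA CA AC; move: J C A I => J C A I.
apply/matrixP => i l; rewrite !mxE.
ring.
Qed.

End GradientField.

(** * Limits at zero *)

Section Limits.
Variable R : realType.
Local Notation F := (dnbhs (0 : R)).

Lemma cvg_dnbhs0_opp (f : R -> R) (l : R) :
  f @ F --> l -> (fun t => f (- t)) @ F --> l.
Proof.
move=> /cvgrPdist_le h; apply/cvgrPdist_le => e e0.
have /nbhs_ballP[r /= r0 hr] := h _ e0.
apply/nbhs_ballP; exists r => //= t; rewrite -ball_normE /= sub0r normrN => tr t0.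
by apply: hr; rewrite ?oppr_eq0 // -ball_normE /= sub0r opprK.
Qed.

Lemma dnbhs0_neq : \forall t \near F, t != 0.
Proof. exact: nbhs_dnbhs_neq. Qed.

Lemma cvg_dnbhs_near (f g : R -> R) (l : R) :
  (\forall t \near F, f t = g t) -> f @ F --> l -> g @ F --> l.
Proof.
by move=> fg fl; apply: cvg_trans fl; apply: (@near_eq_cvg _ _ F).
Qed.

Lemma cvg_dnbhs_continuous (f : R -> R) : {for 0, continuous f} -> f @ F --> f 0.
Proof. by move=> c; apply: cvg_within_filter. Qed.

Lemma is_derive_monomial (a t : R) k :
  is_derive t 1 (fun s : R => a / k.+1%:R * s ^+ k.+1) (a * t ^+ k).
Proof.
have h := is_deriveZ (a / k.+1%:R) (@is_deriveX R _ id k.+1 t 1 1 (is_derive_id t 1)).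
have -> : (fun s : R => a / k.+1%:R * s ^+ k.+1) =
    (a / k.+1%:R) *: (id : R -> R) ^+ k.+1 by apply/funext => s; rewrite !fctE.
apply: (is_derive_eq h); rewrite /GRing.scale /= mulr1.
by rewrite mulrA divfK // pnatr_eq0.
Qed.

(** A form of de l'Hospital's rule: integrating [t^k (l + o(1))]. *)
Lemma cvg_integrate (phi psi : R -> R) (k : nat) (l : R) :
  phi 0 = 0 ->
  (\forall t \near (0 : R), is_derive (t : R) 1 phi (t ^+ k.+1 * psi t)) ->
  psi @ F --> l ->
  (fun t => t ^- k.+2 * phi t) @ F --> l / k.+2%:R.
Proof.
move=> p0 dphi /cvgrPdist_le cpsi; apply/cvgrPdist_le => e e0.
have /nbhs_ballP[r /= r0 hr] := cpsi _ e0.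
have /nbhs_ballP[r' /= r'0 hr'] := dphi.
pose d := Num.min r r'.
have d0 : 0 < d by rewrite lt_min r0.
apply/nbhs_ballP; exists d => //= t; rewrite -ball_normE /= sub0r normrN => td t0.
pose phi' := phi - (fun t : R => l / k.+2%:R * t ^+ k.+2).
have dphi' (c : R) : `|c| < d -> is_derive c 1 phi' (c ^+ k.+1 * (psi c - l)).
  move=> cd.
  have h1 : is_derive c 1 phi (c ^+ k.+1 * psi c).
    by apply: hr'; rewrite -ball_normE /= sub0r normrN (lt_le_trans cd) // ge_min lexx orbT.
  have := is_deriveB h1 (is_derive_monomial l c k.+1).
  by rewrite mulrBr [c ^+ k.+1 * l]mulrC; apply.
have small (s : R) : 0 <= s <= 1 -> `|s * t| < d.
  move=> /andP[s0 s1]; apply: le_lt_trans td.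
  by rewrite normrM ger0_norm // ler_piMl.
have [s /small s01|c c01] := @MVT_dir R _ phi' 0 1 t.
  by have [] := dphi' _ s01; rewrite add0r [_ *: 1]mulr1.
rewrite !add0r ![_ *: 1]mulr1 => E.
have [_ D] := dphi' _ (small c c01).
have {}E : phi t - l / k.+2%:R * t ^+ k.+2 = t * ((c * t) ^+ k.+1 * (psi (c * t) - l)).
  rewrite -D -E /phi' !fctE p0 expr0n mulr0 subrr subr0; reflexivity.
have -> : l / k.+2%:R - t ^- k.+2 * phi t =
    - (t ^- k.+2 * (phi t - l / k.+2%:R * t ^+ k.+2)).
  by rewrite mulrBr opprB mulrCA mulVf ?mulr1 // expf_neq0.
rewrite E normrN exprMn [t ^+ k.+2]exprS invfM.
have -> : t^-1 / t ^+ k.+1 * (t * (c ^+ k.+1 * t ^+ k.+1 * (psi (c * t) - l))) =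
    c ^+ k.+1 * (psi (c * t) - l).
  by move: (psi _) => y; field; rewrite t0 expf_neq0.
have [c0|c0] := eqVneq c 0; first by rewrite c0 expr0n mul0r normr0 ltW.
case/andP: c01 => c0' c1.
rewrite normrM ger0_norm ?exprn_ge0 //.
apply: (@le_trans _ _ (1 * e)); last by rewrite mul1r.
apply: ler_pM => //; first by rewrite exprn_ge0.
  by rewrite exprn_ile1.
rewrite distrC; apply: hr; last by rewrite mulf_neq0.
rewrite -ball_normE /= sub0r normrN; apply: lt_le_trans (small c _) _.
  by rewrite c0'.
by rewrite ge_min lexx.
Qed.

(** Entrywise convergence at 0, the value at 0 being ignored: the functions of
    interest are divided by powers of the variable. *)
Definition mxcvg p q (M : R -> 'M[R]_(p, q)) (L : 'M[R]_(p, q)) : Prop :=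
  forall i j, (fun t => M t i j) @ F --> L i j.

Section Mxcvg.
Variables p q r : nat.
Implicit Types M N : R -> 'M[R]_(p, q).

Lemma mxcvg_near M N L : (\forall t \near F, M t = N t) -> mxcvg M L -> mxcvg N L.
Proof.
move=> MN h i j; apply: cvg_dnbhs_near (h i j).
by apply: filterS MN => t ->.
Qed.

Lemma mxcvg_cst (L : 'M[R]_(p, q)) : mxcvg (fun=> L) L.
Proof. by move=> i j; exact: cvg_cst. Qed.

Lemma mxcvgD M N L K : mxcvg M L -> mxcvg N K -> mxcvg (fun t => M t + N t) (L + K).
Proof.
move=> hM hN i j; rewrite mxE.
apply: (@cvg_dnbhs_near (fun t => M t i j + N t i j)).
  by apply: nearW => t; rewrite mxE.
by apply: cvgD.
Qed.

Lemma mxcvgZ (k : R -> R) M (c : R) L :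
  k @ F --> c -> mxcvg M L -> mxcvg (fun t => k t *: M t) (c *: L).
Proof.
move=> hk hM i j; rewrite mxE.
apply: (@cvg_dnbhs_near (fun t => k t * M t i j)).
  by apply: nearW => t; rewrite mxE.
by apply: cvgM.
Qed.

Lemma mxcvgN M L : mxcvg M L -> mxcvg (fun t => - M t) (- L).
Proof.
move=> hM i j; rewrite mxE.
apply: (@cvg_dnbhs_near (fun t => - M t i j)).
  by apply: nearW => t; rewrite mxE.
by apply: cvgN.
Qed.

Lemma mxcvgM M L (N : R -> 'M[R]_(q, r)) K :
  mxcvg M L -> mxcvg N K -> mxcvg (fun t => M t *m N t) (L *m K).
Proof.
move=> hM hN i j; rewrite mxE.
apply: (@cvg_dnbhs_near (fun t => \sum_k M t i k * N t k j)).
  by apply: nearW => t; rewrite mxE.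
by apply: (@cvg_sumr _ _ _ F) => k; apply: cvgM.
Qed.

End Mxcvg.

Lemma mxcvg_trace p (M : R -> 'M[R]_p) L : mxcvg M L -> (fun t => \tr (M t)) @ F --> \tr L.
Proof. by move=> h; apply: (@cvg_sumr _ _ _ F) => i; exact: h. Qed.

Lemma mxcvg_integrate p q (Phi Psi : R -> 'M[R]_(p, q)) k L :
  Phi 0 = 0 ->
  (\forall t \near (0 : R), is_derive (t : R) 1 Phi (t ^+ k.+1 *: Psi t)) ->
  mxcvg Psi L ->
  mxcvg (fun t => t ^- k.+2 *: Phi t) (k.+2%:R^-1 *: L).
Proof.
move=> P0 dP cP i j; rewrite mxE mulrC.
apply: (@cvg_dnbhs_near (fun t => t ^- k.+2 * Phi t i j)).
  by apply: nearW => t; rewrite mxE.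
apply: cvg_integrate (cP i j); first by rewrite P0 mxE.
apply: filterS dP => t h; have := is_derive_coord i j h; rewrite mxE; exact.
Qed.

Lemma mxcvg_derive p q (M : R -> 'M[R]_(p, q)) dM :
  is_derive 0 (1 : R) M dM -> mxcvg (fun t => t^-1 *: (M t - M 0)) dM.
Proof.
move=> h i j; have [d e] := is_derive_coord i j h.
rewrite -e; apply: (@cvg_dnbhs_near (fun t => t^-1 *: (M (t *: 1 + 0) i j - M 0 i j))).
  by apply: nearW => t; rewrite addr0 [t *: 1]mulr1 !mxE.
by move: d; rewrite /derivable /derive.
Qed.

Lemma mxcvg_continuous p q (M : R -> 'M[R]_(p, q)) dM :
  is_derive 0 (1 : R) M dM -> mxcvg M (M 0).
Proof.
move=> [d _] i j; apply: cvg_dnbhs_continuous.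
have di : derivable (fun t => M t i j) 0 1 by move/derivable_mxP: d.
by apply/differentiable_continuous/derivable1_diffP.
Qed.

End Limits.

(** * Expansion of the solution of the Riccati equation *)

Section RiccatiExpansion.
Variables (R : realType) (n : nat).
Variables (X Rm C : R -> 'M[R]_n) (R1 C0 : 'M[R]_n).
Local Notation F := (dnbhs (0 : R)).
Hypothesis ric : \forall t \near (0 : R), exists2 X',
  is_derive (t : R) 1 X X' &
  t *: X' = - X t - X t *m X t - t ^+ 2 *: Rm t + t *: (C t *m X t - X t *m C t).
Hypothesis X0 : X 0 = 0.
Hypothesis dR : is_derive (0 : R) 1 Rm R1.
Hypothesis cC : mxcvg C C0.

Let R0 := Rm 0.
Let Y t := t ^- 2 *: X t.
Let Y0 := - (3^-1 *: R0).
Let Z t := t^-1 *: (Y t - Y0).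
Let Z0 := 4^-1 *: (- R1 + (C0 *m Y0 - Y0 *m C0)).

Let nz := dnbhs0_neq R.

Let cR : mxcvg Rm R0. Proof. exact: mxcvg_continuous dR. Qed.

Let cid : (id : R -> R) @ F --> (0 : R).
Proof. by apply: cvg_within_filter; exact: cvg_id. Qed.

(* The equation in integrable form: the left-hand side [t X' + X] is the
   derivative of [t X]. *)
Let dtX : \forall t \near (0 : R), is_derive (t : R) 1 (fun s => s *: X s)
  (- (X t *m X t) - t ^+ 2 *: Rm t + t *: (C t *m X t - X t *m C t)).
Proof.
apply: filterS ric => t [X' hX e].
apply: (is_derive_eq (is_derive_scalemx (is_derive_id t 1) hX)).
rewrite e scale1r; move: (X t) (X t *m X t) (t ^+ 2 *: _) (t *: (_ - _)) => a b c d.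
by apply/matrixP => i j; rewrite !mxE; ring.
Qed.

Let cX1 : exists D, mxcvg (fun t => t^-1 *: X t) D.
Proof.
have [X' hX _] := nbhs_singleton ric; exists X'.
apply: mxcvg_near (mxcvg_derive hX).
by apply: nearW => t; rewrite X0 subr0.
Qed.

Let cXM k (L : 'M[R]_n) :
  mxcvg (fun t => t ^- k.+1 *: X t) L -> mxcvg (fun t => t ^- k *: X t) 0.
Proof.
move=> h; rewrite -(scale0r L); apply: mxcvg_near (mxcvgZ cid h).
apply: filterS nz => t t0; rewrite scalerA exprS invfM mulrA mulfV ?mul1r //.
Qed.

Let cX : mxcvg X 0.
Proof.
have [D h] := cX1; apply: mxcvg_near (@cXM 0 D _).
  by apply: nearW => t; rewrite expr0 invr1 scale1r.
by apply: mxcvg_near h; apply: nearW => t; rewrite expr1.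
Qed.

(* Differentiability bounds [X / t]; the quadratic term is then negligible
   and integration improves the bound to [X = o(t)]. *)
Let cX1_0 : mxcvg (fun t => t^-1 *: X t) 0.
Proof.
have [D hD] := cX1.
have h : mxcvg (fun t => - ((t^-1 *: X t) *m X t) - t *: Rm t
                     + (C t *m X t - X t *m C t))
           (- (D *m 0) - 0 *: R0 + (C0 *m 0 - 0 *m C0)).
  apply: mxcvgD; last by apply: mxcvgD; [|apply: mxcvgN]; exact: mxcvgM.
  by apply: mxcvgD; apply: mxcvgN; [exact: mxcvgM|exact: mxcvgZ].
rewrite !mulmx0 mul0mx scale0r subrr oppr0 !addr0 in h.
have := @mxcvg_integrate R _ _ (fun t => t *: X t) _ 0 0 _ _ h.
rewrite scaler0 scale0r => /(_ erefl) H.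
apply: mxcvg_near (H _).
  apply: filterS nz => t t0; rewrite scalerA exprS expr1 invfM -mulrA mulVf ?mulr1 //.
apply: filterS dtX => t; rewrite expr1 => h1; apply: (is_derive_eq h1).
have [->|t0] := eqVneq t 0.
  by rewrite X0 !mulmx0 ?expr0n /= !scale0r !oppr0 !addr0.
rewrite -scalemxAl.
move: (X t *m X t) (Rm t) (C t *m X t) (X t *m C t) => a b c d.
by apply/matrixP => i j; rewrite !mxE; field.
Qed.

(** Once [X = o(t)], the right-hand side of the integrable form is [- t^2 R0]
    up to [o(t^2)]. *)
Lemma riccati_order2 : mxcvg Y Y0.
Proof.
have h : mxcvg (fun t => - ((t^-1 *: X t) *m (t^-1 *: X t)) - Rm t
                     + (C t *m (t^-1 *: X t) - (t^-1 *: X t) *m C t))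
           (- ((0 : 'M[R]_n) *m 0) - R0 + (C0 *m 0 - 0 *m C0)).
  apply: mxcvgD; last by apply: mxcvgD; [|apply: mxcvgN]; exact: mxcvgM.
  by apply: mxcvgD; apply: mxcvgN => //; exact: mxcvgM.
rewrite !mulmx0 mul0mx subrr oppr0 add0r addr0 in h.
have := @mxcvg_integrate R _ _ (fun t => t *: X t) _ 1 _ _ _ h.
rewrite scale0r scalerN => /(_ erefl) H.
apply: mxcvg_near (H _).
  apply: filterS nz => t t0; rewrite /Y scalerA exprS invfM -mulrAC mulVf ?mul1r //.
apply: filterS dtX => t h1; apply: (is_derive_eq h1).
have [->|t0] := eqVneq t 0.
  by rewrite X0 !mulmx0 ?expr0n /= !scale0r !oppr0 !addr0.
rewrite -scalemxAl -!scalemxAr -scalemxAl.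
move: (X t *m X t) (Rm t) (C t *m X t) (X t *m C t) => a b c d.
by apply/matrixP => i j; rewrite !mxE; field.
Qed.

(** Beyond [- t^2 R0], the right-hand side of the integrable form is [t^3] times
    [- R1] plus the commutator of [C0] and [Y0], up to [o(t^3)]: the quadratic
    term is [O(t^4)]. *)
Lemma riccati_order3 : mxcvg Z Z0.
Proof.
pose Q t := t^-1 *: (Rm t - R0).
have h : mxcvg (fun t => - ((t^-1 *: X t) *m Y t) - Q t
                     + (C t *m Y t - Y t *m C t))
           (- ((0 : 'M[R]_n) *m Y0) - R1 + (C0 *m Y0 - Y0 *m C0)).
  have cY := riccati_order2.
  apply: mxcvgD; last by apply: mxcvgD; [|apply: mxcvgN]; exact: mxcvgM.
  apply: mxcvgD; apply: mxcvgN; [exact: mxcvgM|exact: mxcvg_derive].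
rewrite !mul0mx oppr0 add0r in h.
pose Phi t := t *: X t + (3^-1 * t ^+ 3) *: R0.
have := @mxcvg_integrate R _ _ Phi _ 2 _ _ _ h.
rewrite {1}/Phi scale0r expr0n mulr0 scale0r addr0 => /(_ erefl) H.
apply: mxcvg_near (H _).
  apply: filterS nz => t t0; rewrite /Z /Phi /Y /Y0 opprK.
  move: (X t) R0 => x r; apply/matrixP => i j; rewrite !mxE.
  by field.
apply: filterS dtX => t h1.
have h2 : is_derive t 1 (fun s : R => (3^-1 * s ^+ 3) *: R0) (t ^+ 2 *: R0).
  have := is_derive_scalemx (is_derive_monomial 1 t 2) (is_derive_cst R0 t 1).
  by rewrite scaler0 addr0 !mul1r; apply.
apply: (is_derive_eq (is_deriveD h1 h2)).
have [->|t0] := eqVneq t 0.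
  by rewrite X0 !mulmx0 !expr0n /= !scale0r !oppr0 !addr0.
rewrite /Q /Y -scalemxAl -!scalemxAr -scalemxAl.
move: (X t *m X t) (Rm t) R0 (C t *m X t) (X t *m C t) => a b c d e.
by apply/matrixP => i j; rewrite !mxE; field.
Qed.

End RiccatiExpansion.

(** * Consequences of parity *)

Lemma cvg_dnbhs_le0 (R : realType) (f : R -> R) (K l : R) :
  (\forall t \near dnbhs (0 : R), `|f t| <= K * `|t|) ->
  f @ dnbhs (0 : R) --> l -> l = 0.
Proof.
move=> fK fl; have f0 : f @ dnbhs (0 : R) --> (0 : R).
  apply/cvgrPdist_le => e e0.
  have K0 : 0 < `|K| + 1 by rewrite ltr_wpDl.
  have t_small : \forall t \near dnbhs (0 : R), `|t| <= e / (`|K| + 1).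
    by apply: dnbhs0_le; rewrite divr_gt0.
  apply: filterS (filterI fK t_small) => t [h1 h2].
  rewrite sub0r normrN; apply: le_trans h1 _.
  rewrite ler_pdivlMr // mulrC in h2; apply: le_trans h2.
  by apply: ler_wpM2r => //; rewrite (le_trans (ler_norm _)) // lerDl.
by rewrite -(cvg_lim (@Rhausdorff R) fl) (cvg_lim (@Rhausdorff R) f0).
Qed.

Section Parity.
Variables (R : realType) (n : nat).
Variables (X Rm C : R -> 'M[R]_n) (R1 C0 : 'M[R]_n).
Local Notation F := (dnbhs (0 : R)).
Hypothesis ric : \forall t \near (0 : R), exists2 X',
  is_derive (t : R) 1 X X' &
  t *: X' = - X t - X t *m X t - t ^+ 2 *: Rm t + t *: (C t *m X t - X t *m C t).
Hypothesis X0 : X 0 = 0.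
Hypothesis dR : is_derive (0 : R) 1 Rm R1.
Hypothesis cC : mxcvg C C0.
(* [b] and [p] are the first two power sums of the eigenvalues of [X], and
   [g / 2] is their second elementary symmetric function. *)
Let b t := \tr (X t).
Let p t := \tr (X t *m X t).
Let g t := b t ^+ 2 - p t.
Variables (c1 c2 K : R).
Hypothesis c1_gt0 : 0 < c1.
Hypothesis c2_ge0 : 0 <= c2.
Hypothesis even : \forall t \near (0 : R)^'+,
  `|c1 * (b t - b (- t)) + c2 * ((g t - g (- t)) / 2)| <= K * t ^+ 6.

Let R0 := Rm 0.
Let Y0 := - (3^-1 *: R0).
Let Z0 := 4^-1 *: (- R1 + (C0 *m Y0 - Y0 *m C0)).
Let Y t := t ^- 2 *: X t.
Let Z t := t^-1 *: (Y t - Y0).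
Let h2 : mxcvg Y Y0. Proof. exact: riccati_order2 ric X0 dR cC. Qed.
Let h3 : mxcvg Z Z0. Proof. exact: riccati_order3 ric X0 dR cC. Qed.
Let expr t := c1 * (b t - b (- t)) + c2 * ((g t - g (- t)) / 2).

Let tr_comm (A B : 'M[R]_n) : \tr (A *m B - B *m A) = 0.
Proof. by rewrite linearB /= mxtrace_mulC subrr. Qed.

Let trN (A : 'M[R]_n) : \tr (- A) = - \tr A.
Proof. exact: raddfN. Qed.

(* The expression is odd in [t], so the bound on the right extends to the left. *)
Let expr_small : \forall t \near F, `|expr t| <= K * `|t| ^+ 6.
Proof.
have exprN t : `|expr (- t)| = `|expr t|.
  rewrite -normrN; congr (`|_|); rewrite /expr opprK.
  by move: (b t) (b (- t)) (g t) (g (- t)) => *; field.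
have /nbhs_ballP[r /= r0 hr] := even.
apply/nbhs_ballP; exists r => //= t; rewrite -ball_normE /= sub0r normrN => tr t0.
have [tp|tn] := ltP 0 t.
  rewrite (gtr0_norm tp); apply: hr => //.
  by rewrite -ball_normE /= sub0r normrN.
have tn' : 0 < - t by rewrite oppr_gt0 lt_neqAle t0.
rewrite -exprN -[`|t|]normrN (gtr0_norm tn'); apply: hr => //.
by rewrite -ball_normE /= sub0r !normrN.
Qed.

(* Hence every limit of [t^-k expr t] with [k < 6] vanishes. *)
Let scaled_small k : (k < 6)%N ->
  \forall t \near F, `|t ^- k * expr t| <= K * `|t|.
Proof.
move=> k6; have t1 : \forall t \near F, `|t| <= 1.
  by apply: dnbhs0_le.
apply: filterS (filterI (filterI expr_small t1) (dnbhs0_neq R)) => t [[ht h1] t0].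
have nt : 0 < `|t| by rewrite normr_gt0.
have K0 : 0 <= K.
  have := le_trans (normr_ge0 _) ht.
  by rewrite pmulr_lge0 // exprn_gt0.
rewrite normrM normfV normrX mulrC ler_pdivrMr ?exprn_gt0 //.
apply: le_trans ht _; rewrite -mulrA; apply: ler_wpM2l => //.
by rewrite -exprS; apply: ler_wiXn2l.
Qed.

Let y t := \tr (Y t).
Let z t := \tr (Z t).
Let w t := \tr (Z t *m Y t + Y0 *m Z t).
Let cz : z @ F --> \tr Z0. Proof. exact: mxcvg_trace h3. Qed.
Let cy : y @ F --> \tr Y0. Proof. exact: mxcvg_trace h2. Qed.
Let cp : (fun t => \tr (Y t *m Y t)) @ F --> \tr (Y0 *m Y0).
Proof. by apply: mxcvg_trace; exact: mxcvgM. Qed.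

Let bE t : t != 0 -> b t = t ^+ 2 * y t.
Proof. by move=> t0; rewrite /y /Y mxtraceZ mulVKf ?expf_neq0. Qed.

Let pE t : t != 0 -> p t = t ^+ 4 * \tr (Y t *m Y t).
Proof.
move=> t0; rewrite /Y -scalemxAl -scalemxAr scalerA mxtraceZ -invfM -exprD.
by rewrite mulVKf ?expf_neq0.
Qed.

Let yE t : t != 0 -> y t = \tr Y0 + t * z t.
Proof. by move=> t0; rewrite /z /Z mxtraceZ mulVKf // linearB /= addrC subrK. Qed.

(** The coefficient of [t^3] in the parity relation: at this order only [b]
    contributes, [g] being [O(t^4)] with an even leading term. *)
Lemma trace_deriv_eq0 : \tr R1 = 0.
Proof.
have : (fun t => t ^- 3 * expr t) @ F -->
    c1 * (\tr Z0 + \tr Z0) + 0 * (c2 / 2 * (\tr Y0 ^+ 2 - \tr (Y0 *m Y0)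
     - (\tr Y0 ^+ 2 - \tr (Y0 *m Y0)))).
  pose f t := y t ^+ 2 - \tr (Y t *m Y t).
  apply: (@cvg_dnbhs_near _ (fun t => c1 * (z t + z (- t)) +
      t * (c2 / 2 * (f t - f (- t))))).
    apply: filterS (dnbhs0_neq R) => t t0; have t0' : - t != 0 by rewrite oppr_eq0.
    rewrite /expr /g !bE // !pE // !yE // /f !yE //.
    move: (z t) (z (- t)) (\tr _) (\tr _) (\tr _) => z1 z2 y1 y2 y3; field.
    by [].
  have cf : f @ F --> \tr Y0 ^+ 2 - \tr (Y0 *m Y0).
    by apply: cvgB => //; rewrite expr2; apply: cvgM.
  apply: cvgD.
    apply: cvgM; first exact: cvg_cst.
    by apply: cvgD => //; exact: cvg_dnbhs0_opp.
  apply: cvgM; first by apply: cvg_within_filter; exact: cvg_id.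
  apply: cvgM; first exact: cvg_cst.
  by apply: cvgB => //; exact: cvg_dnbhs0_opp.
rewrite mul0r addr0 => H; have := cvg_dnbhs_le0 (scaled_small (isT : 3 < 6)%N) H.
rewrite /Z0 mxtraceZ linearD /= tr_comm addr0 linearN /= => /eqP.
rewrite mulf_eq0 (gt_eqF c1_gt0) /= -mulr2n mulrn_eq0 /= mulf_eq0 invr_eq0.
by rewrite pnatr_eq0 /= oppr_eq0 => /eqP.
Qed.

(* Traces annihilate the commutator. *)
Let dtb : \forall t \near (0 : R),
  is_derive (t : R) 1 (fun s => s * b s) (- p t - t ^+ 2 * \tr (Rm t)).
Proof.
apply: filterS ric => t [X' hX e].
apply: (is_derive_eq (is_derive_mulr (is_derive_id t 1) (is_derive_mxtrace hX))).
rewrite /= mul1r -mxtraceZ e !(mxtraceD, trN, mxtraceZ) [\tr (C t *m _)]mxtrace_mulC /b /p.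
move: (\tr (X t)) (\tr (X t *m X t)) (\tr (Rm t)) (\tr (X t *m C t)) => *.
by ring.
Qed.

(** The coefficient of [t^5], once the trace of [Rm] is known to be constant:
    the odd part of [t * \tr X] is then the integral of the odd part of
    [- \tr X^2], whose leading term is a multiple of [\tr (R0 R1)]. *)
Lemma trace_mul_deriv_eq0 :
  (\forall t \near (0 : R), \tr (Rm t) = \tr (Rm 0)) -> \tr (R0 *m R1) = 0.
Proof.
move=> Rcst; set r := \tr (Rm 0) in Rcst.
pose q := \tr (Z0 *m Y0 + Y0 *m Z0).
have cw : w @ F --> q.
  apply: mxcvg_trace; apply: mxcvgD; first exact: mxcvgM.
  by apply: mxcvgM => //; exact: mxcvg_cst.
have cwN := cvg_dnbhs0_opp cw.
have trYY t : t != 0 -> \tr (Y t *m Y t) = \tr (Y0 *m Y0) + t * w t.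
  move=> t0; have YE : Y t = Y0 + t *: Z t.
    by rewrite /Z scalerA mulfV // scale1r addrC subrK.
  rewrite /w -mxtraceZ -mxtraceD scalerDr; congr (\tr _).
  rewrite scalemxAl scalemxAr; move: YE; move: (Y t) (t *: Z t) => A B ->.
  by rewrite !mulmxDl !mulmxDr -!addrA; congr (_ + _); rewrite addrC -!addrA.
have pE' t : t != 0 -> p t = t ^+ 4 * \tr (Y0 *m Y0) + t ^+ 5 * w t.
  by move=> t0; rewrite pE // trYY // mulrDr mulrA -exprSr.
pose d t := t ^- 5 * (b t - b (- t)).
(* The term in [t^3] cancels [t^2 tr Rm] in the derivative of [t tr X], leaving
   [- p]; in [phi s + phi (- s)], which is [s (b s - b (- s))], the even part of
   [p] cancels as well. *)
have cd : d @ F --> - (q + q) / 6%:R.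
  pose phi t := t * b t + r / 3%:R * t ^+ 3.
  have dphi : \forall t \near (0 : R), is_derive (t : R) 1 phi (- p t).
    apply: filterS (filterI dtb Rcst) => t [h hr].
    apply: (is_derive_eq (is_deriveD h (is_derive_monomial r t 2))).
    by rewrite hr; move: (p t) => pt; ring.
  have dphiN : \forall t \near (0 : R), is_derive (t : R) 1 (fun s => phi (- s)) (p (- t)).
    have /nbhs_ballP[e /= e0 he] := dphi.
    apply/nbhs_ballP; exists e => //= t; rewrite -ball_normE /= sub0r normrN => te.
    have h : is_derive (- t) 1 phi (- p (- t)).
      by apply: he; rewrite -ball_normE /= sub0r opprK.
    have hN : is_derive t 1 (fun s : R => - s) (-1) by exact: is_deriveNid.
    by have := @is_derive1_comp R phi (fun s => - s) t _ _ h hN; rewrite mulrN1 opprK.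
  have psiE : \forall t \near (0 : R), is_derive (t : R) 1
      (fun s => phi s + phi (- s)) (t ^+ 5 * - (w t + w (- t))).
    apply: filterS (filterI dphi dphiN) => t [a1 a2].
    apply: (is_derive_eq (is_deriveD a1 a2)).
    have [->|t0] := eqVneq t 0.
      by rewrite oppr0 /p X0 mul0mx mxtrace0 expr0n mul0r oppr0 addr0.
    rewrite !pE' ?oppr_eq0 //; move: (w t) (w (- t)) (\tr _) => *; ring.
  have c := @cvg_integrate R _ (fun t => - (w t + w (- t))) 4 (- (q + q)) _ psiE _.
  apply: (@cvg_dnbhs_near _ (fun t => t ^- 6 * (phi t + phi (- t)))); last first.
    apply: c; first by rewrite /phi oppr0 expr0n !mul0r mulr0 !addr0.
    by apply: cvgN; apply: cvgD; [exact: cw|exact: cwN].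
  apply: filterS (dnbhs0_neq R) => t t0.
  by rewrite /d /phi; move: (b t) (b (- t)) => *; field.
have cb : b @ F --> 0 * 0 * \tr Y0.
  apply: (@cvg_dnbhs_near _ (fun t => t * t * y t)).
    by apply: filterS (dnbhs0_neq R) => t t0; rewrite bE.
  have cid : (id : R -> R) @ F --> (0 : R) by apply: cvg_within_filter; exact: cvg_id.
  by apply: cvgM => //; apply: cvgM.
rewrite mul0r mul0r in cb.
have H : (fun t => t ^- 5 * expr t) @ F -->
    c1 * (- (q + q) / 6%:R) + c2 / 2 * ((- (q + q) / 6%:R) * (0 + 0) - (q + q)).
  apply: (@cvg_dnbhs_near _ (fun t => c1 * d t +
      c2 / 2 * (d t * (b t + b (- t)) - (w t + w (- t))))).
    apply: filterS (dnbhs0_neq R) => t t0; have t0' : - t != 0 by rewrite oppr_eq0.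
    rewrite /expr /g /d !pE' //.
    by move: (b t) (b (- t)) (w t) (w (- t)) (\tr _) => *; field.
  apply: cvgD; first by apply: cvgM => //; exact: cvg_cst.
  apply: cvgM; first exact: cvg_cst.
  apply: cvgB; last by apply: cvgD; [exact: cw|exact: cwN].
  by apply: cvgM => //; apply: cvgD => //; exact: cvg_dnbhs0_opp.
have {H} H := cvg_dnbhs_le0 (scaled_small (isT : 5 < 6)%N) H.
have q0 : q = 0.
  have : (c1 / 3 + c2) * q = 0.
    by apply: oppr_inj; rewrite oppr0 -H; field.
  have cpos : 0 < c1 / 3 + c2 by rewrite ltr_wpDr // divr_gt0.
  move=> h; apply: (@mulfI _ (c1 / 3 + c2)); first by rewrite gt_eqF.
  by rewrite mulr0.
(* The commutator part of [Z0] is orthogonal to [Y0] for the trace form. *)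
have : q = 6^-1 * \tr (R0 *m R1).
  have A : \tr (Y0 *m (C0 *m Y0 - Y0 *m C0)) = 0.
    rewrite mulmxBr mxtraceD trN !mulmxA [\tr (Y0 *m C0 *m Y0)]mxtrace_mulC.
    by rewrite mulmxA subrr.
  rewrite /q mxtraceD [\tr (Z0 *m _)]mxtrace_mulC /Z0 -scalemxAr mxtraceZ.
  rewrite mulmxDr mxtraceD A addr0 mulmxN trN /Y0 mulNmx trN -scalemxAl mxtraceZ.
  by move: (\tr _) => a; field.
rewrite q0 => /esym/eqP; rewrite mulf_eq0 invr_eq0 pnatr_eq0 /= => /eqP //.
Qed.

End Parity.

(** * Normal coordinates and the Gauss lemma *)

(** Normal coordinates read in a chart: [F] is the exponential map at [F 0], with
    inverse [H], between a star-shaped open set [B] of tangent vectors and an open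
    set [V] of the chart; [G] is the matrix of the metric.  The geodesic equation
    and the initial velocity are stated for unit vectors, of which every vector is
    a multiple. *)
Record normal_chart (R : realType) (n : nat) (G : 'rV[R]_n -> 'M[R]_n)
    (V B : set 'rV[R]_n) (F H : 'rV[R]_n -> 'rV[R]_n) : Prop := NormalChart {
  nc_openV : open V ;
  nc_metric_smooth : smooth_on V G ;
  nc_metric_sym : forall x, V x -> (G x)^T = G x ;
  nc_metric_pos : forall x u, V x -> u != 0 -> 0 < inner (G x) u u ;
  nc_openB : open B ;
  nc_center : B 0 ;
  nc_star : forall y (s : R), B y -> `|s| <= 1 -> B (s *: y) ;
  nc_exp_smooth : smooth_on B F ;
  nc_inv_smooth : smooth_on V H ;
  nc_exp_dom : forall y, B y -> V (F y) ;
  nc_expK : forall y, B y -> H (F y) = y ;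
  nc_inv_dom : forall x, V x -> B (H x) ;
  nc_invK : forall x, V x -> F (H x) = x ;
  nc_geodesic : forall (v : 'rV[R]_n) (t : R),
    inner (G (F 0)) v v = 1 -> B (t *: v) ->
    Dv v (Dv v F) (t *: v)
      + Gam G (F (t *: v)) (Dv v F (t *: v)) (Dv v F (t *: v)) = 0 ;
  nc_velocity : forall v : 'rV[R]_n, inner (G (F 0)) v v = 1 -> Dv v F 0 = v
}.

Section NormalCoordinates.
Variables (R : realType) (n : nat) (G : 'rV[R]_n -> 'M[R]_n).
Local Notation E := 'rV[R]_n.
Local Notation e_ := (basis_vec R (n := n)).
Local Notation Gam := (Gam G).
Variables (V B : set E) (F H : E -> E).
Hypothesis nc : normal_chart G V B F H.

Let g0 := G (F 0).
Let oV := nc_openV nc.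
Let Gsmooth := nc_metric_smooth nc.
Let Gsym := nc_metric_sym nc.
Let Gpos := nc_metric_pos nc.
Let oB := nc_openB nc.
Let B0 := nc_center nc.
Let Bstar := nc_star nc.
Let Fsmooth := nc_exp_smooth nc.
Let Hsmooth := nc_inv_smooth nc.
Let FB := nc_exp_dom nc.
Let HF := nc_expK nc.
Let HV := nc_inv_dom nc.
Let FH := nc_invK nc.
Let geoF := nc_geodesic nc.
Let dF0 := nc_velocity nc.

Let Gunit x : V x -> G x \in unitmx.
Proof. by move=> Vx; apply: inner_pos_unitmx => u; exact: Gpos. Qed.

Let g0sym : g0^T = g0. Proof. exact/Gsym/FB. Qed.

Let cF i j : smoothR B (fun y => F y i j). Proof. exact: smooth_coord. Qed.
Let cH i j : smoothR V (fun y => H y i j). Proof. exact: smooth_coord. Qed.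
Let compat := metric_compat_Gam oV Gsmooth Gsym Gunit.

Lemma unit_decomposition (y : E) : y != 0 ->
  exists (t : R) (v : E), [/\ 0 < t, inner g0 v v = 1, y = t *: v & inner g0 y y = t ^+ 2].
Proof.
move=> y0; have p : 0 < inner g0 y y by apply: Gpos => //; exact: FB.
exists (Num.sqrt (inner g0 y y)), ((Num.sqrt (inner g0 y y))^-1 *: y).
have t0 : 0 < Num.sqrt (inner g0 y y) by rewrite sqrtr_gt0.
have sq : Num.sqrt (inner g0 y y) ^+ 2 = inner g0 y y by rewrite sqr_sqrtr // ltW.
split=> //; last by rewrite scalerA mulfV ?scale1r // gt_eqF.
rewrite innerZl innerZr mulrA -expr2 exprVn sq mulVf // gt_eqF //.
Qed.

Let FD y u : B y -> is_derive y u F (Dv u F y).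
Proof. exact: (smoothM_is_derive oB cF). Qed.

Let FDD y u w : B y -> is_derive y u (Dv w F) (Dv u (Dv w F) y).
Proof. exact: (smoothM_is_derive oB (smoothM_Dv oB cF w)). Qed.

Let Fdiff y : B y -> differentiable F y.
Proof. exact: (smoothM_differentiable oB cF). Qed.

Let FD_lin y a u w : B y -> Dv (a *: u + w) F y = a *: Dv u F y + Dv w F y.
Proof. by move=> By; apply/Dv_lin/Fdiff. Qed.

Let FDZ y a u : B y -> Dv (a *: u) F y = a *: Dv u F y.
Proof. by move=> By; rewrite -[a *: u]addr0 FD_lin // Dv0 addr0. Qed.

Lemma Dv_F0 (w : E) : Dv w F 0 = w.
Proof.
have [->|/unit_decomposition[t [v [t0 v1 -> _]]]] := eqVneq w 0; first exact: Dv0.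
by rewrite FDZ // dF0.
Qed.

Section Geodesic.
Variable v : E.
Hypothesis v1 : inner g0 v v = 1.

Definition geod (t : R) : E := F (t *: v).
Definition geod' (t : R) : E := Dv v F (t *: v).
Definition geod'' (t : R) : E := - Gam (geod t) (geod' t) (geod' t).

Let line_diff (t : R) : is_derive t 1 (fun s : R => s *: v) v.
Proof.
have := is_derive_scalemx (is_derive_id t 1) (is_derive_cst v t 1).
by rewrite scaler0 addr0 scale1r; apply.
Qed.

Lemma is_derive_line (f : E -> E) (t : R) : differentiable f (t *: v) ->
  is_derive t 1 (fun s : R => f (s *: v)) (Dv v f (t *: v)).
Proof. by move=> d; exact: (is_derive_chain (X := fun s : R => s *: v) d (line_diff t)). Qed.

Lemma geod_is_derive (t : R) : B (t *: v) -> is_derive (t : R) 1 geod (geod' t).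
Proof. by move=> Bt; apply/is_derive_line/Fdiff. Qed.

Lemma geod'_is_derive t : B (t *: v) -> is_derive (t : R) 1 geod' (geod'' t).
Proof.
move=> Bt; have := is_derive_line (smoothM_differentiable oB (smoothM_Dv oB cF v) Bt).
have /eqP := geoF v1 Bt; rewrite addr_eq0 => /eqP ->; exact.
Qed.

Lemma geod0 : geod 0 = F 0. Proof. by rewrite /geod scale0r. Qed.
Lemma geod'0 : geod' 0 = v. Proof. by rewrite /geod' scale0r dF0. Qed.

Lemma near_B (t : R) : B (t *: v) -> \forall s \near t, B (s *: v).
Proof.
move=> Bt; have c : {for t, continuous (fun s : R => s *: v)}.
  by apply/differentiable_continuous/derivable1_diffP; case: (line_diff t).
exact: (c _ (nbhs_dom oB Bt)).
Qed.

Let metric_along (t : R) : B (t *: v) ->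
  is_derive t 1 (fun s => G (geod s)) (Dv (geod' t) G (geod t)).
Proof.
move=> Bt; exact: (is_derive_chain (X := geod)
  (metric_differentiable oV Gsmooth (FB Bt)) (geod_is_derive Bt)).
Qed.

(** Constancy along a geodesic, in the form in which a conserved quantity is
    compared with its value at the centre. *)
Lemma cst_along (f : R -> R) (t : R) : B (t *: v) ->
  (forall s, B (s *: v) -> is_derive s 1 f 0) -> f t = f 0.
Proof.
move=> Bt df; have Bs (s : R) : 0 <= s <= 1 -> B ((s * t) *: v).
  move=> /andP[s0 s1]; rewrite -scalerA; apply: Bstar => //.
  by rewrite ger0_norm.
have [s s01|c c01] := @MVT_dir R _ f 0 1 t.
  by rewrite add0r [_ *: 1]mulr1; have [] := df _ (Bs s s01).
rewrite !add0r ![_ *: 1]mulr1 => E0; apply/eqP; rewrite -subr_eq0 E0.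
by have [_ ->] := df _ (Bs c c01); rewrite mulr0.
Qed.

Lemma geod_speed t : B (t *: v) -> inner (G (geod t)) (geod' t) (geod' t) = 1.
Proof.
move=> Bt; pose f s := inner (G (geod s)) (geod' s) (geod' s).
have -> : inner (G (geod t)) (geod' t) (geod' t) = f 0.
  apply: (@cst_along f) => // s Bs.
  apply: (is_derive_eq (is_derive_inner (metric_along Bs)
    (geod'_is_derive Bs) (geod'_is_derive Bs))).
  rewrite (compat _ _ _ (FB Bs)) /geod'' -scaleN1r innerZl innerZr.
  by move: (inner _ _ _) (inner _ _ _) => a b; ring.
by rewrite /f geod0 geod'0.
Qed.

End Geodesic.

(** [radial y] is the velocity at time [1] of the geodesic with initial velocity
    [y], i.e. the image of the position field. *)
Definition radial (y : E) : E := Dv y F y.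

Lemma radialZ (t : R) v : B (t *: v) -> radial (t *: v) = t *: geod' v t.
Proof. by move=> Bt; exact: FDZ. Qed.

Lemma radial_energy y : B y -> inner (G (F y)) (radial y) (radial y) = inner g0 y y.
Proof.
move=> By; have [y0|/unit_decomposition[t [v [t0 v1 e ->]]]] := eqVneq y 0.
  by rewrite y0 /radial Dv0 !inner0l.
rewrite e in By *; rewrite radialZ // innerZl innerZr.
by rewrite -/(geod v t) (geod_speed v1 By) mulr1 expr2.
Qed.

Lemma radial_is_derive y w : B y ->
  is_derive y w radial (Dv w F y + Dv y (Dv w F) y).
Proof.
move=> By; have dir q z : B z -> Dv q F z = \sum_a q 0 a *: Dv (e_ a) F z.
  move=> Bz; rewrite (@lin_expand _ _ _ (fun q => Dv q F z)) // => c u u'.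
  exact: FD_lin.
apply: (@is_derive_near _ _ _ (fun z : E => \sum_a z 0 a *: Dv (e_ a) F z)).
  by apply: filterS (nbhs_dom oB By) => z Bz; rewrite /radial [RHS]dir.
apply: is_derive_eq.
  apply: is_derive_sumr => a; apply: is_derive_scalemx.
    by apply: is_derive_coord; exact: is_derive_id.
  exact: FDD.
rewrite big_split /= -dir //; congr (_ + _).
rewrite (smoothM_Dv_comm w y oB cF By).
apply/esym/is_derive_Dv.
apply: (@is_derive_near _ _ _ (fun z : E => \sum_a y 0 a *: Dv (e_ a) F z)).
  by apply: filterS (nbhs_dom oB By) => z Bz; rewrite [RHS]dir.
by apply: is_derive_sumr => a; apply: is_deriveZ; exact: FDD.
Qed.

Let metric_F y w : B y -> is_derive y w (fun z => G (F z)) (Dv (Dv w F y) G (F y)).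
Proof.
move=> By; exact: (is_derive_chain (X := F) (metric_differentiable oV Gsmooth (FB By)) (FD w By)).
Qed.

(** The derivative of the energy identity in the direction [w]. *)
Lemma radial_energy_derive y w : B y ->
  inner (G (F y)) (radial y)
    (Dv w F y + Dv y (Dv w F) y + Gam (F y) (Dv w F y) (radial y)) = inner g0 y w.
Proof.
move=> By; have Vy := FB By.
have h := is_derive_inner (metric_F w By) (radial_is_derive w By) (radial_is_derive w By).
have h0 := is_derive_inner (is_derive_cst g0 y w) (is_derive_id y w) (is_derive_id y w).
have E1 : \forall z \near y, inner g0 z z = inner (G (F z)) (radial z) (radial z).
  by apply: filterS (nbhs_dom oB By) => z Bz; rewrite radial_energy.
have := is_derive_uniq h (is_derive_near E1 h0).
rewrite (compat _ _ _ Vy) (inner_sym _ (radial y) (Gsym Vy)).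
rewrite (inner_sym (Dv w F y + _) _ (Gsym Vy)) (inner_sym w y g0sym).
rewrite [inner 0 _ _](_ : _ = 0); last by rewrite /inner mulmx0 mul0mx mxE.
rewrite [in RHS]/= !innerDr add0r.
move: (inner _ _ (Gam _ _ _)) (inner _ _ (Dv w F y)) (inner _ _ (Dv y _ y)) (inner g0 y w).
by move=> a b c d e; lra.
Qed.

(** The Gauss lemma: along the geodesic, [s <gamma', J>] has the constant derivative
    [<v, w>], where [J] is the field [Dv w F]; the term in which [J] is
    differentiated is eliminated by [radial_energy_derive]. *)
Lemma gauss y w : B y -> inner (G (F y)) (radial y) (Dv w F y) = inner g0 y w.
Proof.
move=> By; have [y0|/unit_decomposition[t [v [t0 v1 e _]]]] := eqVneq y 0.
  by rewrite y0 /radial Dv0 !inner0l.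
rewrite e in By *; rewrite radialZ // !innerZl.
pose J s := Dv w F (s *: v).
pose f (s : R) := s * inner (G (geod v s)) (geod' v s) (J s) - s * inner g0 v w.
suff : f t = f 0.
  by rewrite /f !mul0r subrr => /eqP; rewrite subr_eq0 => /eqP.
apply: (cst_along (v := v)) => // s Bs; have Vs := FB Bs.
have dJ : is_derive s 1 J (Dv v (Dv w F) (s *: v)).
  exact: is_derive_line (smoothM_differentiable oB (smoothM_Dv oB cF w) Bs).
have dG : is_derive s 1 (fun r => G (geod v r)) (Dv (geod' v s) G (geod v s)).
  exact: (is_derive_chain (X := geod v) (metric_differentiable oV Gsmooth Vs)
           (geod_is_derive Bs)).
have h := is_derive_inner dG (geod'_is_derive v1 Bs) dJ.
have h1 := is_derive_mulr (is_derive_id s 1) h.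
have h2 := is_derive_mulr (is_derive_id s 1) (is_derive_cst (inner g0 v w) s 1).
apply: (is_derive_eq (is_deriveB h1 h2)).
rewrite (compat _ _ _ Vs) /geod'' -scaleN1r innerZl !mul1r mulr0 addr0.
have [->|s0] := eqVneq s 0.
  rewrite mul0r addr0 /J scale0r Dv_F0 geod0 geod'0 //.
  by rewrite subrr.
have := radial_energy_derive w Bs; rewrite radialZ //.
have -> : Dv (s *: v) (Dv w F) (s *: v) = s *: Dv v (Dv w F) (s *: v).
  rewrite -[X in Dv X _ _ = _]addr0.
  by rewrite (Dv_lin _ _ _ (smoothM_differentiable oB (smoothM_Dv oB cF w) Bs)) Dv0 addr0.
rewrite (GamZr oV Gsmooth Gsym Gunit) // (Gam_sym oV Gsmooth Gsym Gunit (Dv w F _)) //.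
rewrite !innerDr !innerZr !innerZl -/(J s) -/(geod v s).
move: (inner _ (geod' v s) (J s)) (inner _ (geod' v s) (Dv v _ _)) (inner g0 v w).
move: (inner _ (geod' v s) (Gam _ _ _)) (inner _ (Gam _ _ _) _) => a b c d x.
move=> E0; apply: (mulfI s0); rewrite mulr0 mulrBr /= -E0.
by ring.
Qed.

Definition half_sqdist (x : E) : R := 2^-1 * inner g0 (H x) (H x).

Lemma smooth_half_sqdist : smoothR V half_sqdist.
Proof.
apply: smoothRM => //; first exact: smoothR_cst.
apply: (smoothR_ext oV (f := fun x => \sum_j (\sum_i H x 0 i * g0 i j) * H x 0 j)).
  move=> x Vx; rewrite [RHS]mxE; apply: eq_bigr => j _.
  by congr (_ * _); rewrite mxE.
apply: smoothR_sum => // j; apply: smoothRM => //.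
apply: smoothR_sum => // i; apply: smoothRM => //; exact: smoothR_cst.
Qed.

Local Notation grad := (grad G half_sqdist).
Local Notation hess_op := (hess_op G half_sqdist).

Let sphi := smooth_half_sqdist.

Lemma half_sqdist_derive x u : V x ->
  Dv u half_sqdist x = inner g0 (H x) (Dv u H x).
Proof.
move=> Vx; have hH := smoothM_is_derive oV cH u Vx.
apply: is_derive_Dv.
apply: (is_derive_eq (is_derive_mulr (is_derive_cst (2^-1 : R) x u)
  (is_derive_inner (is_derive_cst g0 x u) hH hH))).
rewrite mul0r add0r [inner 0 _ _](_ : _ = 0); last by rewrite /inner mulmx0 mul0mx mxE.
rewrite (inner_sym (Dv u H x) _ g0sym) /= add0r.
by move: (inner _ _ _) => a; field.
Qed.

Lemma Dv_FH x u : V x -> Dv (Dv u H x) F (H x) = u.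
Proof.
move=> Vx; have hH := smoothM_is_derive oV cH u Vx.
have h := is_derive_chain (X := H) (Fdiff (HV Vx)) hH.
apply: (is_derive_uniq h); apply: is_derive_near (is_derive_id x u).
by apply: filterS (nbhs_dom oV Vx) => z Vz; rewrite /= FH.
Qed.

(** By the Gauss lemma, the image of the position field is the gradient of half
    the squared distance to the centre. *)
Lemma grad_radial x : V x -> grad x = radial (H x).
Proof.
move=> Vx; apply: (inner_inj (Gunit Vx)) => u.
rewrite (inner_grad oV Gunit sphi) // half_sqdist_derive // -gauss; last exact: HV.
by rewrite Dv_FH // FH.
Qed.

Lemma grad_F y : B y -> grad (F y) = radial y.
Proof. by move=> By; rewrite grad_radial ?HF //; exact: FB. Qed.

Lemma grad_geod v (t : R) : B (t *: v) -> grad (geod v t) = t *: geod' v t.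
Proof. by move=> Bt; rewrite grad_F // radialZ. Qed.

Lemma grad_along v (t : R) : inner g0 v v = 1 -> B (t *: v) ->
  Dv (geod' v t) grad (geod v t) = geod' v t + t *: geod'' v t.
Proof.
move=> v1 Bt.
have h := is_derive_chain (X := geod v)
  (smoothM_differentiable oV (smooth_grad oV Gsmooth Gunit sphi) (FB Bt)) (geod_is_derive Bt).
apply: (is_derive_uniq h).
have := is_derive_scalemx (is_derive_id t 1) (geod'_is_derive v1 Bt).
rewrite scale1r; apply: is_derive_near.
by apply: filterS (near_B Bt) => s Bs; rewrite /= grad_geod.
Qed.

(** Along a geodesic the field is [t gamma'(t)], and the second derivative of the
    geodesic cancels the connection term. *)
Lemma nabla_radial x : V x ->
  Dv (grad x) grad x + Gam x (grad x) (grad x) = grad x.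
Proof.
move=> Vx; rewrite -(FH Vx); have := HV Vx; move: (H x) => y By.
have [y0|/unit_decomposition[t [v [t0 v1 e _]]]] := eqVneq y 0.
  rewrite grad_F // y0 /radial Dv0 Dv0 (Gam0l oV Gsmooth Gunit) ?addr0 //.
  exact: FB.
rewrite e in By *; rewrite -/(geod v t) grad_geod //.
have Vt : V (geod v t) by exact: FB.
rewrite -[X in Dv X]addr0.
rewrite (Dv_lin _ _ _ (smoothM_differentiable oV (smooth_grad oV Gsmooth Gunit sphi) Vt)).
rewrite Dv0 addr0 grad_along // (GamZl oV Gsmooth Gunit) //.
rewrite (GamZr oV Gsmooth Gsym Gunit) // /geod''.
move: (Gam (geod v t) (geod' v t) (geod' v t)) (geod' v t) => a b.
by apply/rowP => l; rewrite !mxE; ring.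
Qed.

(** The gradient vanishes at the centre and its derivative there is the identity,
    because the geodesics have the prescribed initial velocity. *)
Lemma hess_op_center : hess_op (F 0) = 1%:M.
Proof.
have V0 : V (F 0) by exact: FB.
have gd := smoothM_differentiable oV (smooth_grad oV Gsmooth Gunit sphi) V0.
have g00 : grad (F 0) = 0 by rewrite grad_F // /radial Dv0.
have D w : Dv w grad (F 0) = w.
  have [->|/unit_decomposition[t [v [t0 v1 -> _]]]] := eqVneq w 0; first exact: Dv0.
  have B0v : B (0 *: v) by rewrite scale0r.
  have := grad_along v1 B0v; rewrite geod0 geod'0 // scale0r addr0 => Dg.
  by rewrite -[in LHS](addr0 (t *: v)) (Dv_lin _ _ _ gd) Dv0 addr0 Dg.
apply/row_matrixP => i; rewrite !rowE mulmx1 (hess_opE oV Gsmooth Gunit sphi) //.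
by rewrite /nabla_grad g00 D (Gam0r oV Gsmooth Gsym Gunit) // addr0.
Qed.

End NormalCoordinates.

(** * Eigenvalues on the orthogonal complement of the normal *)

Lemma char_polyZ_split (F : fieldType) n (A : 'M[F]_n) c s : c != 0 ->
  char_poly A = \prod_(a <- s) ('X - a%:P) ->
  char_poly (c *: A) = \prod_(a <- [seq c * a | a <- s]) ('X - a%:P).
Proof.
move=> c0 e.
have inj : injective (fun p : {poly F} => p \Po (c *: 'X)).
  apply: (can_inj (g := fun p => p \Po (c^-1 *: 'X))) => p.
  by rewrite -comp_polyA comp_polyZ comp_polyX scalerA mulfV // scale1r comp_polyXr.
apply: inj => /=.
have sz : size s = n.
  by have := size_char_poly A; rewrite e size_prod_XsubC => -[].
have -> : char_poly (c *: A) \Po (c *: 'X) = c%:P ^+ n * char_poly A.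
  rewrite /char_poly -detZ -[_ \Po _]/(comp_poly _ _) -det_map_mx.
  congr (\det _); apply/matrixP => i j; rewrite !mxE /=.
  rewrite rmorphB rmorphMn /= comp_polyX comp_polyC mulrBr -mul_polyC.
  by rewrite polyCM mulrnAr.
rewrite e big_map rmorph_prod /= -sz.
elim: s {e sz} => [|a s IH]; first by rewrite !big_nil expr0 mulr1.
rewrite !big_cons /= -IH rmorphB /= comp_polyX comp_polyC polyCM -mul_polyC exprS.
by ring.
Qed.

Lemma sigma_split (R : realType) k n (A : 'M[R]_n) s :
  char_poly A = \prod_(a <- s) ('X - a%:P) -> sigma k A = elem_sym k s.
Proof.
move=> e; apply: elem_sym_perm; apply: prod_XsubC_eq; rewrite -e; apply/esym.
exact: (@xgetPex _ [::] [set s | char_poly A = \prod_(a <- s) ('X - a%:P)]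
  (ex_intro _ s e)).
Qed.

Lemma sum_sub1 (R : comNzRingType) (s : seq R) :
  \sum_(a <- s) (a - 1) = \sum_(a <- s) a - (size s)%:R.
Proof.
elim: s => [|a s IH]; first by rewrite !big_nil subr0.
by rewrite !big_cons IH /= -natr1; ring.
Qed.

Lemma sum_sub1_sqr (R : comNzRingType) (s : seq R) :
  \sum_(a <- s) (a - 1) ^+ 2 =
  \sum_(a <- s) a ^+ 2 - 2 * \sum_(a <- s) a + (size s)%:R.
Proof.
elim: s => [|a s IH]; first by rewrite !big_nil mulr0 subr0 addr0.
by rewrite !big_cons IH /= -natr1; ring.
Qed.

(* [M] is the metric at a point, [N] the unit normal of the sphere of radius [t],
   [A] the Hessian and [S] the derivative of the normal field. *)
Section Shape.
Variables (R : realType) (n : nat) (M A S : 'M[R]_n) (N : 'rV[R]_n) (t : R).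
Hypothesis Msym : M^T = M.
Hypothesis Mpos : forall u, u != 0 -> 0 < inner M u u.
Hypothesis Aself : A *m M = M *m A^T.
Hypothesis NA : N *m A = N.
Hypothesis N1 : inner M N N = 1.
Hypothesis t0 : t != 0.
Hypothesis SA : forall w, inner M w N = 0 -> w *m S = t^-1 *: (w *m A).

(* The kernel of [nu] is the orthogonal complement of [N], and [B] is the matrix
   of [A] on it; self-adjointness makes it invariant. *)
Let nu := M *m N^T.
Let W := row_base (kermx nu).
Let B := W *m A *m pinvmx W.

Let Wnu : W *m nu = 0.
Proof.
by apply/eqP; rewrite -sub_kermx eq_row_base.
Qed.

Let WA : W *m A = B *m W.
Proof.
rewrite /B mulmxKpV // eq_row_base sub_kermx -mulmxA /nu [A *m _]mulmxA Aself.
by rewrite -mulmxA -trmx_mul NA Wnu.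
Qed.

Let Nnu : N *m nu = 1%:M.
Proof.
apply/matrixP => i j; rewrite !ord1 [RHS]mxE eqxx mulr1n -N1 /inner.
by rewrite /nu mulmxA.
Qed.

Let rows r (W' : 'M[R]_(r, n)) : W' *m nu = 0 -> W' *m S = t^-1 *: (W' *m A).
Proof.
move=> W'nu; apply/row_matrixP => i.
rewrite row_mul [row i (_ *: _)]linearZ /= row_mul; apply: SA.
by rewrite /inner -mulmxA -/nu -row_mul W'nu row0 mxE.
Qed.

Let free : row_free (col_mx W N).
Proof.
apply: inj_row_free => u; rewrite -[u]hsubmxK mul_row_col => e.
have b0 : rsubmx u = 0.
  have := congr1 (mulmx^~ nu) e.
  rewrite /= mulmxDl -(mulmxA _ W nu) -(mulmxA _ N nu).
  by rewrite Wnu mulmx0 add0r Nnu mulmx1 mul0mx.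
move: e; rewrite b0 mul0mx addr0 => e; rewrite (_ : lsubmx u = 0) ?row_mx0 //.
by apply: (row_free_inj (row_base_free _)); rewrite e mul0mx.
Qed.

Let rk : (\rank (kermx nu) + 1 = n)%N.
Proof.
have n1 : \rank nu = 1%N.
  apply/eqP; rewrite eqn_leq rank_leq_col lt0n mxrank_eq0.
  apply/eqP => nu0; have := Nnu; rewrite nu0 mulmx0 => /matrixP/(_ 0 0).
  by rewrite !mxE eqxx => /esym/eqP; rewrite oner_eq0.
have := rank_leq_row nu; rewrite n1 => n0.
by rewrite mxrank_ker n1 subnK.
Qed.

(** The eigenvalues of the shape operator are those of [A] on the orthogonal
    complement of [N], divided by [t]. *)
Lemma sigma_shape k : exists s : seq R,
  [/\ size s = n.-1, \tr (A - 1%:M) = \sum_(a <- s) a,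
      \tr ((A - 1%:M) *m (A - 1%:M)) = \sum_(a <- s) a ^+ 2 &
      t ^+ k * sigma k (restrictmx (kermx nu) S) = elem_sym k [seq 1 + a | a <- s]].
Proof.
have [l lE] := selfadjoint_split Msym Mpos Aself.
have cp : char_poly A = char_poly B * ('X - 1) := char_poly_block1 rk WA NA free.
have l1 : 1 \in l by rewrite -root_prod_XsubC -lE cp rootM root_XsubC eqxx orbT.
pose l' := rem 1 l; have pl : perm_eq l (1 :: l') := perm_to_rem l1.
have lE' : char_poly B = \prod_(a <- l') ('X - a%:P).
  apply: (mulIf (x := 'X - 1%:P)); first by rewrite polyXsubC_eq0.
  by rewrite -[RHS]mulrC -[LHS]cp lE (perm_big _ pl) big_cons.
have Sr : restrictmx (kermx nu) S = t^-1 *: B.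
  rewrite /conjmx -/W /B scalemxAl; congr (_ *m _).
  exact: rows.
have sz : size l = n.
  by have := size_char_poly A; rewrite lE size_prod_XsubC => -[].
have sz' : size l' = n.-1 by rewrite size_rem // sz.
have n0 : (0 < n)%N by rewrite -rk addn1.
have nR : n%:R = n.-1%:R + 1 :> R by rewrite natr1 prednK.
exists [seq a - 1 | a <- l']; split.
- by rewrite size_map.
- rewrite mxtraceD raddfN /= mxtrace1 (char_poly_split_trace lE).
  rewrite (perm_big _ pl) big_cons big_map sum_sub1 /= sz' nR.
  by move: (\sum_(_ <- _) _) => b; ring.
- have -> : (A - 1%:M) *m (A - 1%:M) = A *m A - A - A + 1%:M.
    rewrite mulmxBl mulmxBr mulmx1 mul1mx; move: (A *m A) => AA.
    by apply/matrixP => i j; rewrite !mxE; ring.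
  rewrite !mxtraceD !raddfN /= mxtrace1 (char_poly_split_trace lE).
  rewrite (char_poly_split_trace_sqr lE) !(perm_big _ pl) !big_cons big_map /=.
  rewrite sum_sub1_sqr sz' nR.
  by move: (\sum_(_ <- _) _) (\sum_(_ <- _) _) => b c; ring.
rewrite Sr (sigma_split _ (char_polyZ_split (invr_neq0 t0) lE')).
rewrite elem_sym_scale exprVn mulVKf ?expf_neq0 // -map_comp.
by congr (elem_sym k _); rewrite -[LHS]map_id; apply: eq_map => a /=; rewrite addrC subrK.
Qed.

End Shape.

(** * Shape operators of geodesic spheres *)

Section Spheres.
Variables (R : realType) (n : nat) (G : 'rV[R]_n -> 'M[R]_n).
Local Notation E := 'rV[R]_n.
Local Notation Gam := (Gam G).
Variables (V B : set E) (F H : E -> E).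
Hypothesis nc : normal_chart G V B F H.
Local Notation g0 := (G (F 0)).
Local Notation phi := (half_sqdist G F H).
Local Notation hess_op := (hess_op G phi).
Local Notation grad := (grad G phi).
Local Notation geod := (geod F).
Local Notation geod' := (geod' F).

Let oV := nc_openV nc.
Let Gsmooth := nc_metric_smooth nc.
Let Gsym := nc_metric_sym nc.
Let Gpos := nc_metric_pos nc.
Let FB := nc_exp_dom nc.
Let Gunit x : V x -> G x \in unitmx.
Proof. by move=> Vx; apply: inner_pos_unitmx => u; exact: Gpos. Qed.
Let sphi := smooth_half_sqdist nc.
Let geo := nabla_radial nc.
Let grad_diff x : V x -> differentiable grad x.
Proof. exact: (smoothM_differentiable oV (smooth_grad oV Gsmooth Gunit sphi)). Qed.

(** The unit normal of the geodesic spheres centred at [F 0]. *)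
Definition sphere_normal (x : E) : E :=
  Dv ((Num.sqrt (inner g0 (H x) (H x)))^-1 *: H x) F (H x).

(* The factor [1 / r] as a function of [r^2 / 2]. *)
Let inv_norm (s : R) : R := (Num.sqrt (2 * s))^-1.

Let inv_norm_diff (s : R) : 0 < s -> differentiable inv_norm s.
Proof.
move=> s0; have s20 : 0 < 2 * s by rewrite mulr_gt0.
apply/derivable1_diffP.
have h1 : is_derive s 1 (fun s : R => 2 * s) 2.
  have := is_derive_mulr (is_derive_cst (2 : R) s 1) (is_derive_id s 1).
  by rewrite mul0r add0r mulr1; apply.
have h2 := @is_derive1_comp R Num.sqrt (fun s => 2 * s) s _ _ (is_derive1_sqrt s20) h1.
apply: (@derivableV R _ (Num.sqrt \o (fun s => 2 * s)) s 1); last by case: h2.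
by rewrite /= gt_eqF // sqrtr_gt0.
Qed.

Lemma sphere_normalE x : V x -> sphere_normal x = inv_norm (phi x) *: grad x.
Proof.
move=> Vx; rewrite /sphere_normal (grad_radial nc) // /radial.
have By := nc_inv_dom nc Vx.
have Fd := smoothM_differentiable (nc_openB nc)
  (fun i j => smooth_coord (nc_openB nc) i j (nc_exp_smooth nc)) By.
rewrite -[X in Dv X]addr0 (Dv_lin _ _ _ Fd) Dv0 addr0 /inv_norm /half_sqdist.
by rewrite mulrA mulfV ?mul1r // pnatr_eq0.
Qed.

Section Direction.
Variables (v : E) (t : R).
Hypothesis v1 : inner g0 v v = 1.
Hypothesis t0 : 0 < t.
Hypothesis Bt : B (t *: v).
Let x := geod v t.
Let Vx : V x. Proof. exact: FB. Qed.

Let phix : 2 * phi x = t ^+ 2.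
Proof.
rewrite /half_sqdist mulrA mulfV ?pnatr_eq0 // mul1r /x /geod (nc_expK nc) //.
by rewrite innerZl innerZr v1 mulr1 expr2.
Qed.

Let inv_normx : inv_norm (phi x) = t^-1.
Proof. by rewrite /inv_norm phix sqrtr_sqr gtr0_norm. Qed.

Lemma sphere_normal_geod : sphere_normal x = geod' v t.
Proof.
rewrite sphere_normalE // inv_normx (grad_geod nc) // scalerA mulVf ?scale1r //.
by rewrite gt_eqF.
Qed.

Let gradx : grad x = t *: geod' v t. Proof. exact: (grad_geod nc). Qed.

Let normal_derive w : is_derive x w sphere_normal
  (Dv (Dv w phi x) inv_norm (phi x) *: grad x + t^-1 *: Dv w grad x).
Proof.
have phi0 : 0 < phi x by rewrite -(pmulr_rgt0 _ (ltr0n R 2)) phix exprn_gt0.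
have h1 := is_derive_chain (X := phi) (inv_norm_diff phi0) (smoothR_is_derive oV w sphi Vx).
have h2 := is_derive_scalemx h1 (differentiable_Dv w (grad_diff Vx)).
rewrite /= inv_normx in h2; apply: is_derive_near h2.
by apply: filterS (nbhs_dom oV Vx) => z Vz; rewrite sphere_normalE.
Qed.

(** Tangentially to the sphere the length of the gradient is constant, so the
    normalising factor is not differentiated. *)
Lemma shape_lin1 w : inner (G x) w (geod' v t) = 0 ->
  w *m lin1_mx (fun w => nabla G (fun=> w) sphere_normal x) =
  t^-1 *: (w *m hess_op x).
Proof.
have phi0 : 0 < phi x by rewrite -(pmulr_rgt0 _ (ltr0n R 2)) phix exprn_gt0.
have NE u : nabla G (fun=> u) sphere_normal x =
    Dv (Dv u phi x) inv_norm (phi x) *: grad x + t^-1 *: nabla_grad G phi x u.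
  rewrite nabla_constl (is_derive_Dv (normal_derive u)) sphere_normalE // inv_normx.
  by rewrite (GamZr oV Gsmooth Gsym Gunit) // /nabla_grad scalerDr addrA.
move=> w0; rewrite mul_lin1_mx; last first.
  move=> a u u'; rewrite !NE (nabla_grad_lin oV Gsmooth Gunit sphi) //.
  rewrite (Dv_lin _ _ _ (smoothR_differentiable oV sphi Vx)).
  rewrite (Dv_lin _ _ _ (inv_norm_diff phi0)).
  move: (Dv _ inv_norm _) (Dv _ inv_norm _) (grad x) (nabla_grad _ _ _ u) (nabla_grad _ _ _ u').
  by move=> b c d e f; apply/rowP => l; rewrite !mxE /GRing.scale /=; ring.
rewrite NE -(inner_grad oV Gunit sphi) // gradx innerZl (inner_sym _ _ (Gsym Vx)).
by rewrite w0 mulr0 Dv0 scale0r add0r (hess_opE oV Gsmooth Gunit sphi).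
Qed.

Lemma sigma_sphere k : exists s : seq R,
  [/\ size s = n.-1, \tr (hess_op x - 1%:M) = \sum_(a <- s) a,
      \tr ((hess_op x - 1%:M) *m (hess_op x - 1%:M)) = \sum_(a <- s) a ^+ 2 &
      t ^+ k * sigma k (shape_matrix G sphere_normal x) =
      elem_sym k [seq 1 + a | a <- s]].
Proof.
rewrite /shape_matrix sphere_normal_geod.
apply: sigma_shape.
- exact: Gsym.
- by move=> u; exact: Gpos.
- exact: (hess_op_selfadjoint oV Gsmooth Gsym Gunit sphi).
- have := nabla_grad_grad geo Vx; rewrite -(hess_opE oV Gsmooth Gunit sphi) // gradx.
  by rewrite -scalemxAl => /(scalerI (lt0r_neq0 t0)).
- exact: (geod_speed nc).
- by rewrite gt_eqF.
- exact: shape_lin1.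
Qed.

End Direction.
End Spheres.

(** * Parity along a geodesic *)

Section SphereParity.
Variables (R : realType) (n : nat) (G : 'rV[R]_n -> 'M[R]_n).
Local Notation E := 'rV[R]_n.
Local Notation Gam := (Gam G).
Variables (V B : set E) (F H : E -> E).
Hypothesis nc : normal_chart G V B F H.
Local Notation g0 := (G (F 0)).
Local Notation phi := (half_sqdist G F H).
Local Notation hess_op := (hess_op G phi).
Local Notation grad := (grad G phi).
Local Notation geod := (geod F).
Local Notation geod' := (geod' F).
Local Notation shape v t :=
  (shape_matrix G (sphere_normal G F H) (geod v t)).

Let oV := nc_openV nc.
Let Gsmooth := nc_metric_smooth nc.
Let Gsym := nc_metric_sym nc.
Let Gpos := nc_metric_pos nc.
Let FB := nc_exp_dom nc.
Let Gunit x : V x -> G x \in unitmx.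
Proof. by move=> Vx; apply: inner_pos_unitmx => u; exact: Gpos. Qed.
Let sphi := smooth_half_sqdist nc.
Let geo := nabla_radial nc.

Variables (k : nat) (e : R).
Hypothesis kn : (1 <= k <= n.-1)%N.
Hypothesis e0 : 0 < e.
Hypothesis sigma_even : forall (t : R) v, 0 < t < e -> inner g0 v v = 1 ->
  B (t *: v) -> sigma k (shape v t) = sigma k (shape (- v) t).

Section Direction.
Variable v : E.
Hypothesis v1 : inner g0 v v = 1.

Let X s := hess_op (geod v s) - 1%:M.
Let Rm s := jacobi_op G (geod v s) (geod' v s).
Let C s := lin1_mx (Gam (geod v s) (geod' v s)).
(** The derivative at [0] of the Jacobi operators along the geodesic. *)
Let R1 := jacobi_op_deriv G (F 0) v v (- Gam (F 0) v v).

Let B0v : B (0 *: v). Proof. by rewrite scale0r; exact: (nc_center nc). Qed.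
Let nearB := near_B nc B0v.

Let ric : \forall t \near (0 : R), exists2 X',
  is_derive (t : R) 1 X X' &
  t *: X' = - X t - X t *m X t - t ^+ 2 *: Rm t + t *: (C t *m X t - X t *m C t).
Proof.
apply: filterS nearB => t Bt.
apply: (riccati_curve oV Gsmooth Gsym Gunit sphi geo (FB Bt) (geod_is_derive nc Bt)).
by rewrite (grad_geod nc).
Qed.

Let X0 : X 0 = 0.
Proof. by rewrite /X geod0 (hess_op_center nc) subrr. Qed.

Lemma jacobi_along_is_derive (t : R) : B (t *: v) -> is_derive t 1 Rm
  (jacobi_op_deriv G (geod v t) (geod' v t) (geod' v t)
     (- Gam (geod v t) (geod' v t) (geod' v t))).
Proof.
move=> Bt; apply: (is_derive_jacobi_op oV Gsmooth Gsym Gunit (FB Bt)).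
  exact: (geod_is_derive nc Bt).
exact: (geod'_is_derive nc v1 Bt).
Qed.

Let dR : is_derive (0 : R) 1 Rm R1.
Proof.
by have := jacobi_along_is_derive B0v; rewrite geod0 (geod'0 nc).
Qed.

Let cC : mxcvg C (C 0).
Proof.
move=> i j; apply: (@cvg_dnbhs_near _ (fun s => Gam (geod v s) (geod' v s) (basis_vec R i) 0 j)).
  by apply: nearW => s; rewrite mxE.
have -> : C 0 i j = Gam (geod v 0) (geod' v 0) (basis_vec R i) 0 j by rewrite mxE.
apply: (cvg_dnbhs_continuous (f := fun s => Gam (geod v s) (geod' v s) (basis_vec R i) 0 j)).
apply/differentiable_continuous/derivable1_diffP.
have nV : \forall s \near (0 : R), V (geod v s) by apply: filterS nearB => s; exact: FB.
have [d _] := is_derive_coord 0 j (is_derive_Gam oV Gsmooth Gsym Gunit nV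
  (geod_is_derive nc B0v) (geod'_is_derive nc v1 B0v)
  (is_derive_cst (basis_vec R i) (0 : R) 1)).
exact: d.
Qed.

Let c1 : R := (bin_shift n.-1 k 1)%:R.
Let c2 : R := (bin_shift n.-1 k 2)%:R.

(* This is where [1 <= k <= n - 1] enters. *)
Let c1_gt0 : 0 < c1.
Proof.
rewrite /c1 /bin_shift; case/andP: kn => -> kn1; rewrite ltr0n bin_gt0.
exact: leq_sub2r.
Qed.

Let c2_ge0 : 0 <= c2. Proof. by rewrite /c2. Qed.

Let b t := \tr (X t).
Let p t := \tr (X t *m X t).
Let g t := b t ^+ 2 - p t.

(* [p] is the sum of the squares of the eigenvalues of [X], so this bounds each
   of them by [c t^2]. *)
Let p_bound : exists2 c : R, 1 <= c & \forall t \near dnbhs (0 : R), p t <= (c * t ^+ 2) ^+ 2.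
Proof.
have hY := mxcvg_trace (mxcvgM (riccati_order2 ric X0 dR cC) (riccati_order2 ric X0 dR cC)).
set l := \tr (_ *m _) in hY.
exists (`|l| + 1); first by rewrite lerDr.
move/cvgrPdist_le : hY => /(_ _ ltr01) hY.
apply: filterS (filterI (dnbhs0_neq R) hY) => t [t0 h].
have pE : p t = t ^+ 4 * \tr (t ^- 2 *: X t *m (t ^- 2 *: X t)).
  rewrite -scalemxAl -scalemxAr scalerA mxtraceZ -invfM -exprD.
  by rewrite mulVKf ?expf_neq0.
rewrite pE exprMn -exprM mulrC ler_wpM2r ?exprn_even_ge0 //.
apply: (@le_trans _ _ (`|l| + 1)).
  rewrite -lerBlDl; apply: le_trans h.
  rewrite distrC; apply: le_trans (ler_norm _).
  by rewrite lerB // ler_norm.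
by rewrite ler_eXnr // lerDr.
Qed.

Let geodN t : geod (- v) t = geod v (- t).
Proof. by rewrite /geod scalerN scaleNr. Qed.

(** The eigenvalues of [X] are [O(t^2)], so the terms of degree at least 3 in them
    contribute [O(t^6)]; what remains of the equality of the [sigma_k] at the times
    [t] and [- t] of one geodesic is the parity relation. *)
Lemma even_expansion : exists K, \forall t \near (0 : R)^'+,
  `|c1 * (b t - b (- t)) + c2 * ((g t - g (- t)) / 2)| <= K * t ^+ 6.
Proof.
have [K [K0 hK]] := @elem_sym_shift_bound R n.-1 k.
have [c c_ge1 hc] := p_bound.
have c0 : 0 < c by exact: lt_le_trans ltr01 c_ge1.
have /nbhs_ballP[r1 /= r10 hr1] := nearB.
have /nbhs_ballP[r2 /= r20 hr2] := hc.
exists (2 * K * c ^+ 3).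
near=> t.
have t0 : 0 < t by near: t; exact: nbhs_right_gt.
have te : t < e by near: t; exact: nbhs_right_lt.
have tr1 : t < r1 by near: t; exact: nbhs_right_lt.
have tr2 : t < r2 by near: t; exact: nbhs_right_lt.
have tc : t < c^-1 by near: t; apply: nbhs_right_lt; rewrite invr_gt0.
have t_le1 : t <= 1 by apply: ltW; apply: lt_le_trans tc _; rewrite invf_le1.
have Bt : B (t *: v) by apply: hr1; rewrite -ball_normE /= sub0r normrN gtr0_norm.
have BNt : B (- t *: v).
  by apply: hr1; rewrite -ball_normE /= sub0r !normrN gtr0_norm.
have eps : 0 <= c * t ^+ 2 <= 1.
  apply/andP; split; first by rewrite mulr_ge0 ?exprn_ge0 // ltW.
  rewrite expr2 mulrA; apply: mulr_ile1 => //; try exact: ltW.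
    by rewrite mulr_ge0 // ltW.
  by rewrite mulrC -ler_pdivlMr // mul1r ltW.
have small s (u : R) : u != 0 -> `|u| < r2 -> u ^+ 2 = t ^+ 2 ->
    p u = \sum_(a <- s) a ^+ 2 -> forall a, a \in s -> `|a| <= c * t ^+ 2.
  move=> u0 ur ut pu a as_.
  have ct0 : 0 <= c * t ^+ 2 by case/andP: eps.
  rewrite -[X in _ <= X]ger0_norm // -ler_sqr ?nnegrE // !real_normK ?num_real //.
  rewrite -ut; apply: le_trans (hr2 u _ u0).
    by rewrite pu (big_rem a) //= lerDl sumr_ge0 // => x _; exact: sqr_ge0.
  by rewrite -ball_normE /= sub0r normrN.
have [s1 [sz1 tr1' q1 E1]] := sigma_sphere nc v1 t0 Bt k.
have vN1 : inner g0 (- v) (- v) = 1.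
  by rewrite -scaleN1r innerZl innerZr v1 mulr1 mulrNN mulr1.
have BtN : B (t *: - v) by rewrite scalerN -scaleNr.
have [s2 [sz2 tr2' q2 E2]] := sigma_sphere nc vN1 t0 BtN k.
rewrite geodN in tr2' q2.
have ee : elem_sym k [seq 1 + a | a <- s1] = elem_sym k [seq 1 + a | a <- s2].
  by rewrite -E1 -E2 sigma_even // t0.
have nt : `|t| < r2 by rewrite gtr0_norm.
have nNt : `|- t| < r2 by rewrite normrN.
have Nt0 : - t != 0 by rewrite oppr_eq0 gt_eqF.
have h1 := hK s1 (c * t ^+ 2) sz1 eps (small s1 t (lt0r_neq0 t0) nt erefl q1).
have h2 := hK s2 (c * t ^+ 2) sz2 eps (small s2 (- t) Nt0 nNt (sqrrN t) q2).
rewrite ee in h1; rewrite -tr1' -q1 in h1; rewrite -tr2' -q2 in h2.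
rewrite -/(X t) -/(X (- t)) -/(b t) -/(b (- t)) -/(p t) -/(p (- t)) in h1 h2.
rewrite -/c1 -/c2 -/(g t) -/(g (- t)) in h1 h2.
set z := elem_sym _ _ in h1 h2.
move: (g t) (g (- t)) (b t) (b (- t)) z h1 h2 => g1 g2 b1 b2 z; set w := 'C(_, _)%:R.
move=> h1 h2.
have -> : c1 * (b1 - b2) + c2 * ((g1 - g2) / 2) =
    (z - (w + c1 * b2 + c2 * (g2 / 2))) - (z - (w + c1 * b1 + c2 * (g1 / 2))).
  by field.
apply: le_trans (ler_normB _ _) _; apply: le_trans (lerD h2 h1) _.
rewrite le_eqVlt; apply/orP; left; apply/eqP.
by rewrite exprMn; ring.
Unshelve. all: by end_near. Qed.

(** The derivative at the centre of the Ricci curvature [Ric(gamma', gamma')]. *)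
Lemma ricci_stationary : \tr R1 = 0.
Proof.
have [K hK] := even_expansion.
exact: (trace_deriv_eq0 ric X0 dR cC c1_gt0 hK).
Qed.

(** The hypothesis at all points of the chart makes the trace of the Jacobi operators
    constant along the geodesic. *)
Lemma jacobi_trace_eq0 :
  (forall x u, V x -> inner (G x) u u = 1 ->
     \tr (jacobi_op_deriv G x u u (- Gam x u u)) = 0) ->
  \tr (jacobi_op G (F 0) v *m R1) = 0.
Proof.
move=> stat; have [K hK] := even_expansion.
have Rcst : \forall t \near (0 : R), \tr (Rm t) = \tr (Rm 0).
  apply: filterS nearB => t Bt.
  apply: (cst_along nc (v := v) (f := fun t => \tr (Rm t)) Bt) => s Bs.
  apply: (is_derive_eq (is_derive_mxtrace (jacobi_along_is_derive Bs))).
  by apply: stat; [exact: FB|exact: (geod_speed nc)].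
have := trace_mul_deriv_eq0 ric X0 dR cC c1_gt0 c2_ge0 hK Rcst.
by rewrite /Rm geod0 (geod'0 nc).
Qed.

End Direction.
End SphereParity.

(** * From normal balls to normal coordinates in a chart *)

Section ChartGeometry.
Variables (R : realType) (n : nat) (M : riemannian_manifold R n).
Variable i : chart_index M.
Local Notation E := 'rV[R]_n.
Local Notation D := (chart_dom i).
Local Notation G := (metric i).
Let U := chart i @` D.

Lemma chart_image_open : open U. Proof. exact: chart_open. Qed.
Lemma chart_metric_smooth : smooth_on U G. Proof. exact: metric_smooth. Qed.
Lemma chart_metric_sym x : U x -> (G x)^T = G x.
Proof. by case=> p Dp <-; exact: metric_symmetric. Qed.
Lemma chart_metric_pos x u : U x -> u != 0 -> 0 < inner (G x) u u.
Proof. by case=> p Dp <-; exact: metric_pos. Qed.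
Lemma chart_metric_unit x : U x -> G x \in unitmx.
Proof. by move=> Ux; apply: inner_pos_unitmx => u; exact: chart_metric_pos. Qed.

Section NormalBall.
Variables (m : M) (e : R) (Ex : E -> M) (L : M -> E).
Hypothesis Dm : D m.
Hypothesis nb : normal_ball i m e Ex L.
(* The value of [Ex] at 0 is only known through the geodesics, that is, through
   some unit vector. *)
Variable v0 : E.
Hypothesis v01 : unit_vector i m v0.
Let F := chart i \o Ex.
Let H := L \o param i.
Let T := tangent_ball i m e.
Let e0 := normal_ball_radius nb.

Lemma normal_ball_center : Ex 0 = m.
Proof. by have [_ + _] := normal_ball_exp nb v01; rewrite scale0r. Qed.

Let F0 : F 0 = chart i m. Proof. by rewrite /F /= normal_ball_center. Qed.

Let T0 : T 0.
Proof. by rewrite /T /tangent_ball /= inner0l exprn_gt0. Qed.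

Let near_T : \forall y \near (0 : E), T y.
Proof.
pose f (y : E) := \sum_b (\sum_a y 0 a * metric_at i m a b) * y 0 b.
have c : f @ nbhs (0 : E) --> f 0.
  have cc a : (fun y : E => y 0 a) @ nbhs (0 : E) --> (0 : E) 0 a by exact: coord_continuous.
  apply: cvg_sumr => b; apply: cvgM => //; apply: cvg_sumr => a.
  by apply: cvgM => //; exact: cvg_cst.
have fE y : inner (metric_at i m) y y = f y.
  by rewrite /inner [LHS]mxE; apply: eq_bigr => b _; congr (_ * _); rewrite mxE.
have e20 : 0 < e ^+ 2 by rewrite exprn_gt0.
move/cvgrPdist_lt : c => /(_ _ e20); apply: filterS => y.
rewrite -!fE inner0l sub0r normrN /T /tangent_ball /=.
by apply: le_lt_trans; exact: ler_norm.
Qed.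

Let near_D : \forall y \near (0 : E), D (Ex y).
Proof.
have c := normal_ball_continuous nb T0.
have DN : nbhs (Ex 0) D.
  by apply: open_nbhs_nbhs; split; [exact: dom_open|rewrite normal_ball_center].
exact: (c _ DN).
Qed.

(* A ball for the norm of the coordinates is star-shaped, which the set of vectors
   that [Ex] maps into the chart domain need not be. *)
Let radius : {r : R | 0 < r & forall y : E, `|y| < r -> T y /\ D (Ex y)}.
Proof.
apply: cid2.
have : \forall y \near (0 : E), T y /\ D (Ex y).
  by apply: filterS (filterI near_T near_D) => y [].
move=> /nbhs_ballP[r /= r0 hr].
exists r => // y yr; apply: hr.
by rewrite -ball_normE /= sub0r normrN.
Qed.

Let r := s2val radius.
Let r0 : 0 < r. Proof. exact: s2valP radius. Qed.
Let B : set E := [set y | `|y| < r].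
Let BT y : B y -> T y. Proof. by case/(s2valP' radius). Qed.
Let BD y : B y -> D (Ex y). Proof. by case/(s2valP' radius). Qed.
Let W : set E := chart i @` (D `&` (Ex @` T)).
Let V : set E := [set x | W x /\ B (H x)].

Let oB : open B.
Proof.
rewrite (_ : B = ball (0 : E) r); first exact: ball_open.
by apply/seteqP; split=> y; rewrite -ball_normE /B /= sub0r normrN.
Qed.

Let oW : open W.
Proof.
rewrite openE => _ [p [Dp Tp] <-].
have pc := param_continuous Dp.
have n1 : \forall x \near chart i p, (Ex @` T) (param i x).
  apply: pc; rewrite chartK //; apply: open_nbhs_nbhs; split=> //.
  exact: normal_ball_open nb.
have n2 : \forall x \near chart i p, U x.
  by apply: open_nbhs_nbhs; split; [exact: chart_open|exists p].
apply: filterS (filterI n1 n2) => x [Tx [q Dq qx]].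
by exists q => //; split=> //; move: Tx; rewrite -qx chartK.
Qed.

Let WU x : W x -> U x.
Proof. by case=> p [Dp _] <-; exists p. Qed.

Let oV : open V.
Proof.
rewrite openE => x [Wx Bx].
have Hc : {for x, continuous H} by have [c _] := normal_ball_inv_smooth nb i 0; exact: c.
have n1 : \forall z \near x, B (H z) by apply: Hc; exact: open_nbhs_nbhs.
have n2 : \forall z \near x, W z by exact: open_nbhs_nbhs.
by apply: filterS (filterI n2 n1).
Qed.

Let FW y : B y -> W (F y).
Proof.
move=> By; exists (Ex y) => //; split; first exact: BD.
by exists y => //; exact: BT.
Qed.

Let HF y : B y -> H (F y) = y.
Proof.
by move=> By; rewrite /H /F /= chartK ?(normal_ballK nb) //; [exact: BT|exact: BD].
Qed.

Let FH x : V x -> F (H x) = x.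
Proof.
case=> -[p [Dp [y Ty yp]] <-] _.
by rewrite /F /H /= chartK // -yp (normal_ballK nb) ?yp.
Qed.

Let Fsmooth : smooth_on B F.
Proof.
move=> k; apply: Ck_on_sub (normal_ball_smooth nb i k) => y By.
by split; [exact: BT|exact: BD].
Qed.

Let F_diff y u : B y -> differentiable F y /\ differentiable (Dv u F) y.
Proof.
have cF a b : smoothR B (fun y => F y a b) by exact: smooth_coord.
split; first exact: (smoothM_differentiable oB cF).
exact: (smoothM_differentiable oB (smoothM_Dv oB cF u)).
Qed.

Section UnitSpeed.
Variable v : E.
Hypothesis v1 : inner (G (F 0)) v v = 1.
Let c (t : R) := F (t *: v).

Let v1' : unit_vector i m v.
Proof. by move: v1; rewrite F0. Qed.

Let nearB (t : R) : B (t *: v) -> \forall s \near t, B (s *: v).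
Proof.
move=> Bt; have d : {for t, continuous (fun s : R => s *: v)}.
  have := is_derive_scalemx (is_derive_id t 1) (is_derive_cst v t 1).
  by case=> d _; apply/differentiable_continuous/derivable1_diffP.
exact: (d _ (open_nbhs_nbhs (conj oB Bt))).
Qed.

Let dc (t : R) : B (t *: v) -> is_derive t 1 c (Dv v F (t *: v)).
Proof. by move=> Bt; apply: is_derive_line; have [] := F_diff v Bt. Qed.

Let dcE (t : R) : B (t *: v) -> derive1 c t = Dv v F (t *: v).
Proof. by move=> Bt; rewrite derive1E; have [_ ->] := dc Bt. Qed.

Let ddc (t : R) : B (t *: v) ->
  is_derive t 1 (derive1 c) (Dv v (Dv v F) (t *: v)).
Proof.
move=> Bt; have h := is_derive_line (proj2 (F_diff v Bt)).
by apply: is_derive_near h; apply: filterS (nearB Bt) => s Bs; rewrite dcE.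
Qed.

Lemma normal_ball_geodesic (t : R) : B (t *: v) ->
  Dv v (Dv v F) (t *: v) + Gam G (F (t *: v)) (Dv v F (t *: v)) (Dv v F (t *: v)) = 0.
Proof.
move=> Bt; have [geo _ _] := normal_ball_exp nb v1'.
have te : - e < t < e.
  rewrite -ltr_norml -(@ltr_pXn2r _ 2) ?nnegrE ?(ltW e0) // real_normK ?num_real //.
  have := BT Bt; rewrite /T /tangent_ball /= innerZl innerZr.
  by rewrite v1' mulr1 -expr2.
have [_ /(_ i (BD Bt)) [_ _]] := geo t te.
rewrite /covD -/c derive1E -/(derive1 c) dcE // -GamE.
by have [_ ->] := ddc Bt.
Qed.

Lemma normal_ball_velocity : Dv v F 0 = v.
Proof.
have [_ _ h] := normal_ball_exp nb v1'.
have B0 : B (0 *: v) by rewrite scale0r /B /= normr0.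
by have := dcE B0; rewrite scale0r => <-.
Qed.

End UnitSpeed.

Lemma normal_ball_chart :
  exists V B : set E, [/\ normal_chart G V B F H, F 0 = chart i m,
    (forall y, B y -> D (Ex y)) & forall x, V x -> (chart i @` D) x].
Proof.
exists V, B.
have VU x : V x -> U x by case=> /WU.
split=> //; split=> //.
- by move=> k; apply: Ck_on_sub (chart_metric_smooth k) => x /VU.
- by move=> x /VU; exact: chart_metric_sym.
- by move=> x u /VU; exact: chart_metric_pos.
- by rewrite /B /= normr0.
- move=> y s; rewrite /B /= normrZ => yr s1; apply: le_lt_trans yr.
  by rewrite ler_piMl.
- by move=> k; apply: Ck_on_sub (normal_ball_inv_smooth nb i k) => x [].
- by move=> y By; split; [exact: FW|rewrite HF].
- by move=> x [].
- by move=> v t v1 Bt; exact: normal_ball_geodesic.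
- exact: normal_ball_velocity.
Qed.

End NormalBall.
End ChartGeometry.

(** * D'Atri spaces *)

Section DAtri.
Variables (R : realType) (n : nat) (M : riemannian_manifold R n).
Local Notation E := 'rV[R]_n.

Lemma radial_fieldE (i : chart_index M) (m : M) (Ex : E -> M) (L : M -> E) :
  chart i (Ex 0) = chart i m ->
  radial_field i m Ex L i = sphere_normal (metric i) (chart i \o Ex) (L \o param i).
Proof.
move=> e; apply/funext => x.
by rewrite /radial_field /sphere_normal DvxE /metric_at /= e.
Qed.

Variable k : nat.
Hypothesis kn : (1 <= k <= n.-1)%N.
Hypothesis hM : k_DAtri M k.

(** Near [m] the spheres can be described in the chart [i] on both sides, so the
    charts [j] and [j'] of the definition are specialised to [i]. *)
Lemma DAtri_normal_chart (i : chart_index M) (m : M) (v : E) :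
  chart_dom i m -> unit_vector i m v ->
  exists (V B : set E) (F H : E -> E) (e : R),
    [/\ normal_chart (metric i) V B F H, F 0 = chart i m, 0 < e,
        forall x, V x -> (chart i @` chart_dom i) x &
        forall (t : R) u, 0 < t < e -> inner (metric i (F 0)) u u = 1 ->
          B (t *: u) ->
          sigma k (shape_matrix (metric i) (sphere_normal (metric i) F H) (geod F u t)) =
          sigma k (shape_matrix (metric i) (sphere_normal (metric i) F H) (geod F (- u) t))].
Proof.
move=> Dm v1; have [e [Ex [L [nb ev]]]] := hM Dm.
have [V [B [nc F0 BD VU]]] := normal_ball_chart Dm nb v1.
exists V, B, (chart i \o Ex), (L \o param i), e.
split; [exact: nc|exact: F0|exact: normal_ball_radius nb|exact: VU|].
move=> t u te u1 Bt; rewrite F0 in u1.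
have BN : B (t *: - u).
  by rewrite scalerN -scaleN1r; apply: (nc_star nc) => //; rewrite normrN normr1.
have := ev t u i i te u1 (BD _ Bt) (BD _ BN).
rewrite /sphere_shape radial_fieldE //; exact.
Qed.

Lemma DAtri_ricci_stationary (i : chart_index M) (m : M) (v : E) :
  chart_dom i m -> unit_vector i m v ->
  \tr (jacobi_op_deriv (metric i) (chart i m) v v
         (- Gam (metric i) (chart i m) v v)) = 0.
Proof.
move=> Dm v1; have [V [B [F [H [e [nc F0 e0 _ ev]]]]]] := DAtri_normal_chart Dm v1.
have v1' : inner (metric i (F 0)) v v = 1 by rewrite F0.
by have := ricci_stationary nc kn e0 ev v1'; rewrite F0.
Qed.

(** The stationarity of the trace is needed at the points of the geodesic, where
    the normal coordinates are other ones; it is available because the hypothesis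
    is on all points of [M]. *)
Lemma DAtri_jacobi_trace (i : chart_index M) (m : M) (v : E) :
  chart_dom i m -> unit_vector i m v ->
  \tr (jacobi_op (metric i) (chart i m) v *m
       jacobi_op_deriv (metric i) (chart i m) v v
         (- Gam (metric i) (chart i m) v v)) = 0.
Proof.
move=> Dm v1; have [V [B [F [H [e [nc F0 e0 VU ev]]]]]] := DAtri_normal_chart Dm v1.
have v1' : inner (metric i (F 0)) v v = 1 by rewrite F0.
have := jacobi_trace_eq0 nc kn e0 ev v1' _; rewrite F0; apply.
by move=> x u /VU[p Dp <-] u1; exact: DAtri_ricci_stationary.
Qed.

End DAtri.

(** In components, the covariant derivative of an operator field differs from
    the ordinary one by a commutator with the connection matrix. *)
Lemma covD_opE (R : realType) (n : nat) (G : 'rV[R]_n -> 'M[R]_n)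
    (c : R -> 'rV[R]_n) (A : R -> 'M[R]_n) (dA : 'M[R]_n) (t : R) :
  (forall a u w, Gam G (c t) (derive1 c t) (a *: u + w) =
     a *: Gam G (c t) (derive1 c t) u + Gam G (c t) (derive1 c t) w) ->
  is_derive t 1 A dA ->
  let C := lin1_mx (Gam G (c t) (derive1 c t)) in
  covD_op G c A t = dA + A t *m C - C *m A t.
Proof.
move=> lin hA C.
have GM w : Gam G (c t) (derive1 c t) w = w *m C by exact/esym/(mul_lin1_mx w lin).
have dc (w : 'rV[R]_n) : derive1 (fun=> w) t = 0 by rewrite derive1E derive_cst.
have dM w : derive1 (fun s => w *m A s) t = w *m dA.
  rewrite derive1E; have [_ ->] := is_derive_mulmx (is_derive_cst w t 1) hA.
  by rewrite mul0mx add0r.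
have cE w : covD G c (fun s => w *m A s) t - covD G c (fun=> w) t *m A t =
    w *m (dA + A t *m C - C *m A t).
  rewrite /covD dc dM -!GamE !GM add0r.
  by rewrite mulmxBr mulmxDr !mulmxA.
have linK (D : 'M[R]_n) : lin1_mx (mulmx^~ D) = D.
  apply/row_matrixP => l; rewrite !rowE mul_lin1_mx // => a u w.
  exact: (linearP (mulmxr D)).
rewrite -[RHS]linK; congr (lin1_mx _); apply/funext => w; exact: cE.
Qed.

Section JacobiDerivative.
Variables (R : realType) (n : nat) (M : riemannian_manifold R n).
Variables (i : chart_index M) (gamma : R -> M) (d : R) (v : 'rV[R]_n).
Hypothesis Dm : chart_dom i (gamma 0).
Hypothesis d0 : 0 < d.
Hypothesis geo : geodesic gamma (- d) d.
Hypothesis gv : derive1 (chart i \o gamma) 0 = v.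
Local Notation G := (metric i).
Let c := chart i \o gamma.
Let oU := @chart_image_open _ _ M i.
Let Gsmooth := @chart_metric_smooth _ _ _ i.
Let Gsym := @chart_metric_sym _ _ _ i.
Let Gunit := @chart_metric_unit _ _ _ i.
Let Ux : (chart i @` chart_dom i) (c 0). Proof. by exists (gamma 0). Qed.

Lemma is_derive_jacobi_along :
  is_derive (0 : R) 1 (jacobi_along i gamma)
    (jacobi_op_deriv G (chart i (gamma 0)) v v (- Gam G (chart i (gamma 0)) v v)).
Proof.
have t0 : - d < 0 < d by rewrite oppr_lt0 d0.
have [_ /(_ i Dm) [nd dd ge]] := geo t0.
have hc : is_derive (0 : R) 1 c v.
  apply: DeriveDef; first exact: nbhs_singleton nd.
  by rewrite -derive1E gv.
have hdc : is_derive (0 : R) 1 (derive1 c) (- Gam G (c 0) v v).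
  have ge' : derive1 (derive1 c) 0 + Gam G (c 0) v v = 0.
    by rewrite GamE -gv; exact: ge.
  apply: (DeriveDef dd); rewrite -derive1E.
  by apply/eqP; rewrite -addr_eq0 ge'.
have := is_derive_jacobi_op oU Gsmooth Gsym Gunit Ux hc hdc.
by rewrite gv.
Qed.

(** The commutator has no trace against the operator itself. *)
Lemma trace_jacobi_deriv :
  let A0 := jacobi_op G (chart i (gamma 0)) v in
  \tr (jacobi_deriv i gamma *m A0) =
  \tr (A0 *m jacobi_op_deriv G (chart i (gamma 0)) v v
               (- Gam G (chart i (gamma 0)) v v)).
Proof.
move=> A0.
have AE : jacobi_along i gamma 0 = A0 by rewrite /jacobi_along gv.
have lin := Gam_linr oU Gsmooth Gsym Gunit.
rewrite /jacobi_deriv (covD_opE _ is_derive_jacobi_along); last first.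
  by move=> a u w; exact: lin.
rewrite AE; clear AE lin; move: A0 (jacobi_op_deriv _ _ _ _ _) (lin1_mx _) => A0 R1 C.
rewrite mulmxBl mulmxDl raddfB /= mxtraceD.
by rewrite [\tr (C *m A0 *m A0)]mxtrace_mulC mulmxA addrK mxtrace_mulC.
Qed.

End JacobiDerivative.

Unset Implicit Arguments.
Theorem proposition3p2 (R : realType) (n : nat) (M : riemannian_manifold R n)
    (k : nat) (hk : (1 <= k <= n.-1)%N) (hM : k_DAtri M k)
    (i : chart_index M) (m : M) (him : chart_dom i m)
    (v : 'rV[R]_n) (hv : unit_vector i m v)
    (d : R) (hd : 0 < d) (gamma : R -> M)
    (hgamma : geodesic_from i m v d gamma) :
  \tr (jacobi_deriv i gamma *m jacobi_op (metric i) (chart i m) v) = 0.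
Proof.
have [geo g0 gv] := hgamma.
have Dg : chart_dom i (gamma 0) by rewrite g0.
have := trace_jacobi_deriv Dg hd geo gv; rewrite /= g0 => ->.
exact: DAtri_jacobi_trace hk hM _ _ _ him hv.
Qed.
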